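(* Let $2<q<\infty$. There exist constants $C,c>0$, independent of $\delta$, such that for every $\delta>0$ there is a solution $u$ of the incompressible Navier-Stokes system on $\mathbb{R}^3$ $$\partial_t u-\Delta u+u\cdot\nabla u+\nabla p=0,\qquad \mathrm{div}\,u=0,\qquad u(x,0)=u_0(x),$$ with some initial data $u_0\in\dot F^{-1,q}_\infty(\mathbb{R}^3)$ satisfying $\mathrm{div}\,u_0=0$ and $$\|u_0\|_{\dot F^{-1,q}_\infty(\mathbb{R}^3)}\le C\,\delta,$$ such that for some $0<T<\delta$, $$\|u(T)\|_{\dot F^{-1,q}_\infty(\mathbb{R}^3)}\ge \frac{c}{\delta}.$$
   Context: The unknowns are a velocity field $u(x,t)\in\mathbb{R}^3$ and a scalar pressure $p(x,t)$, $(x,t)\in\mathbb{R}^3\times(0,\infty)$. The system is considered in its equivalent integral form $u=e^{t\Delta}u_0-B(u,u)$, where $e^{t\Delta}$ is the heat semigroup, $\mathbb{P}=Id-\nabla\Delta^{-1}\mathrm{div}$ is the Leray projection, and $B(u,v)=\int_0^t e^{(t-\tau)\Delta}\mathbb{P}(u\cdot\nabla v)\,d\tau$; the solution exists on a time interval containing $[0,T]$. Let $\varphi(\xi)=\varphi(|\xi|)\ge 0$ be a smooth real-valued function with $\mathrm{supp}\,\varphi\subset\{5/8\le|\xi|\le 7/4\}$, $\varphi\equiv1$ on $\{7/8\le|\xi|\le5/4\}$ and $\sum_{j\in\mathbb{Z}}\varphi(2^{-j}\xi)=1$ for $\xi\in\mathbb{R}^3\setminus\{0\}$. Let $\Delta_j$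 be the Fourier multiplier operator with symbol $\varphi(2^{-j}\xi)$. Let $Z'(\mathbb{R}^3)=S'(\mathbb{R}^3)/P(\mathbb{R}^3)$ be the tempered distributions modulo polynomials. For $1<q<\infty$, $\dot F^{-1,q}_\infty(\mathbb{R}^3)$ is the set of $f\in Z'(\mathbb{R}^3)$ for which there is a sequence of functions $\{f_k\}_{k\in\mathbb{Z}}$ with $f=\sum_{k\in\mathbb{Z}}\Delta_kf_k$ in $Z'(\mathbb{R}^3)$ and $\big\|\,\|\{2^{-k}|f_k(\cdot)|\}_k\|_{\ell^q}\big\|_{L^\infty(\mathbb{R}^3)}<\infty$; the norm $\|f\|_{\dot F^{-1,q}_\infty}$ is the infimum of this last quantity over all such representations. For vector fields the norm is taken componentwise. *)

(* Defs.v *)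
From HB Require Import structures.
From mathcomp Require Import all_boot all_order all_algebra.
From mathcomp Require Import complex.
From mathcomp Require Import all_classical all_reals all_analysis ess_sup_inf.

Set Implicit Arguments.
Unset Strict Implicit.
Unset Printing Implicit Defensive.

Import Order.TTheory GRing.Theory Num.Theory.
Import numFieldNormedType.Exports.

Local Open Scope classical_set_scope.
Local Open Scope ring_scope.
Local Open Scope complex_scope.

Section Euclidean_space.
Context {R : realType}.

(* A product type carries both the normed space and the measurable structure,
   which 'rV[R]_3 does not.  The library norm on it is the max norm; the
   Euclidean norm is [enorm]. *)
Local Notation E := (R * R * R)%type.

Definition coord (x : E) (i : 'I_3) : R := nth 0 [:: x.1.1; x.1.2; x.2] i.

Definition basis (i : 'I_3) : E :=
  ((i == 0 :> nat)%:R, (i == 1 :> nat)%:R, (i == 2 :> nat)%:R).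

Definition dot (x y : E) : R := \sum_(i < 3) coord x i * coord y i.

Definition enorm (x : E) : R := Num.sqrt (dot x x).

Definition leb3 :
    {measure set (measurableTypeR R * measurableTypeR R * measurableTypeR R)%type
      -> \bar R} :=
  ((@lebesgue_measure R \x @lebesgue_measure R) \x @lebesgue_measure R)%E.

(* [pderivs [:: i1; ...; in] f] is the iterated partial derivative
   d_i1 (... (d_in f)). *)
Definition pderivs (s : seq 'I_3) (f : E -> R) : E -> R :=
  foldr (fun i h => 'D_(basis i) h) f s.

Definition smooth (f : E -> R) : Prop :=
  forall s x, differentiable (pderivs s f) x.

End Euclidean_space.

Section Complex_functions.
Context {R : realType}.
Local Notation E := (R * R * R)%type.
Local Notation mE :=
  (measurableTypeR R * measurableTypeR R * measurableTypeR R)%type.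
Local Notation C := R[i].

Definition cmodulus (z : C) : R :=
  Num.sqrt (complex.Re z ^+ 2 + complex.Im z ^+ 2).

Definition cis (t : R) : C := cos t +i* sin t.

Definition cintegral (f : E -> C) : C :=
  (\int[leb3]_x complex.Re (f x)) +i* (\int[leb3]_x complex.Im (f x)).

Definition cpderivs (s : seq 'I_3) (f : E -> C) : E -> C := fun x =>
  pderivs s (fun y => complex.Re (f y)) x
    +i* pderivs s (fun y => complex.Im (f y)) x.

Definition csmooth (f : E -> C) : Prop :=
  smooth (fun x => complex.Re (f x)) /\ smooth (fun x => complex.Im (f x)).

Definition cmeasurable (f : E -> C) : Prop :=
  measurable_fun [set: mE] (fun x => complex.Re (f x)) /\
  measurable_fun [set: mE] (fun x => complex.Im (f x)).

(* [sum_{k in Z} a k = l], the limit being taken in both directions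
   independently. *)
Definition zsums_to (a : int -> C) (l : C) : Prop :=
  (fun MN : nat * nat =>
     cmodulus (\sum_(0 <= k < MN.1) a k%:Z
               + \sum_(0 <= k < MN.2) a (- k.+1%:Z) - l))
    @ filter_prod \oo \oo --> (0 : R).

End Complex_functions.

(* Distributions are functionals on all functions E -> C, of which only the
   values on Schwartz functions are constrained; some explicit functionals
   below also make sense on functions of mere polynomial decay. *)
Definition functional (R : realType) := (R * R * R -> R[i]) -> R[i].

Section Distributions.
Context {R : realType}.
Local Notation E := (R * R * R)%type.
Local Notation C := R[i].

Definition schwartz (g : E -> C) : Prop :=
  csmooth g /\
  forall (s : seq 'I_3) (m : nat), exists M : R, forall x,
    (1 + enorm x) ^+ m * cmodulus (cpderivs s g x) <= M.

(* Continuity is the domination by one of the Schwartz seminorms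
   max_{|s| <= m} sup_x (1 + |x|)^m |d^s g(x)|. *)
Definition tempered (f : functional R) : Prop :=
  (forall (a : C) g h, schwartz g -> schwartz h ->
     f (fun x => a * g x + h x) = a * f g + f h) /\
  exists (K : R) (m : nat), forall g (M : R), schwartz g ->
    (forall s x, (size s <= m)%N ->
       (1 + enorm x) ^+ m * cmodulus (cpderivs s g x) <= M) ->
    cmodulus (f g) <= K * M.

(* Schwartz functions orthogonal to all polynomials, i.e. those on which the
   classes of S'/P have well-defined values: Z' is the dual of this space. *)
Definition schwartz_mod_poly (g : E -> C) : Prop :=
  schwartz g /\
  forall a : 'I_3 -> nat,
    cintegral (fun x => (\prod_(i < 3) coord x i ^+ a i)%:C * g x) = 0.

Definition of_fun (h : E -> C) : functional R :=
  fun g => cintegral (fun x => h x * g x).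

Definition partial (k : 'I_3) (f : functional R) : functional R :=
  fun g => - f (cpderivs [:: k] g).

Definition fourier (g : E -> C) : E -> C :=
  fun xi => cintegral (fun x => g x * cis (- dot x xi)).

Definition inv_fourier (h : E -> C) : E -> C :=
  fun x => (((2 * pi) ^+ 3)^-1)%:C *
           cintegral (fun xi => h xi * cis (dot x xi)).

Definition multiplier_fun (m : E -> R) (g : E -> C) : E -> C :=
  inv_fourier (fun xi => (m xi)%:C * fourier g xi).

(* The transpose of the multiplier m(xi) is m(-xi); all the symbols used below
   are even. *)
Definition multiplier (m : E -> R) (f : functional R) : functional R :=
  fun g => f (multiplier_fun m g).

End Distributions.

Section Triebel_Lizorkin.
Context {R : realType}.
Local Notation E := (R * R * R)%type.
Local Notation C := R[i].

Definition littlewood_paley (phi : E -> R) : Prop :=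
  [/\ smooth phi,
      forall xi, 0 <= phi xi,
      forall xi eta, enorm xi = enorm eta -> phi xi = phi eta,
      closure [set xi | phi xi != 0]
        `<=` [set xi | 5 / 8 <= enorm xi <= 7 / 4] &
      (forall xi, 7 / 8 <= enorm xi <= 5 / 4 -> phi xi = 1) /\
      (forall xi, xi != 0 ->
         zsums_to (fun j : int => (phi ((2 : R) ^ (- j) *: xi))%:C) 1)].

Definition dyadic_block (phi : E -> R) (k : int)
  : functional R -> functional R :=
  multiplier (fun xi => phi ((2 : R) ^ (- k) *: xi)).

(* || (sum_k (2^{-k} |f_k|)^q)^{1/q} ||_{L^oo} *)
Definition tl_size (q : R) (fk : int -> E -> C) : \bar R :=
  ess_sup leb3 (fun x =>
    ((\esum_(k in [set: int]) ((2 ^ (- k) * cmodulus (fk k x)) `^ q)%:E)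
       `^ q^-1)%E).

(* f = sum_k Delta_k f_k in Z' (weak-* convergence modulo polynomials). *)
Definition tl_decomposition (phi : E -> R) (f : functional R)
    (fk : int -> E -> C) : Prop :=
  (forall k, cmeasurable (fk k)) /\
  forall g, schwartz_mod_poly g ->
    zsums_to (fun k => dyadic_block phi k (of_fun (fk k)) g) (f g).

(* The distribution f (more precisely its class modulo polynomials) belongs to
   the space F^{-1,q}_oo. *)
Definition in_tl (phi : E -> R) (q : R) (f : functional R) : Prop :=
  tempered f /\
  exists fk, tl_decomposition phi f fk /\ (tl_size q fk < +oo)%E.

Definition tl_norm (phi : E -> R) (q : R) (f : functional R) : \bar R :=
  ereal_inf [set tl_size q fk | fk in
    [set fk | tl_decomposition phi f fk /\ (tl_size q fk < +oo)%E]].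

Definition in_tl_vec (phi : E -> R) (q : R) (f : 'I_3 -> functional R)
  : Prop :=
  forall i, in_tl phi q (f i).

Definition tl_norm_vec (phi : E -> R) (q : R) (f : 'I_3 -> functional R)
  : \bar R := \big[maxe/0%E]_(i < 3) tl_norm phi q (f i).

End Triebel_Lizorkin.

Section Navier_Stokes.
Context {R : realType}.
Local Notation E := (R * R * R)%type.
Local Notation mE :=
  (measurableTypeR R * measurableTypeR R * measurableTypeR R)%type.
Local Notation C := R[i].

Definition of_field (v : 'I_3 -> E -> R) (i : 'I_3) : functional R :=
  of_fun (fun x => (v i x)%:C).

Definition div_free (f : 'I_3 -> functional R) : Prop :=
  forall g, schwartz g -> \sum_(i < 3) partial i (f i) g = 0.

Definition heat (t : R) : functional R -> functional R :=
  multiplier (fun xi => expR (- t * enorm xi ^+ 2)).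

(* Id - grad Laplacian^{-1} div has the matrix symbol
   delta_ij - xi_i xi_j / |xi|^2. *)
Definition leray (f : 'I_3 -> functional R) (i : 'I_3) : functional R :=
  fun g => \sum_(j < 3)
    multiplier (fun xi => (i == j)%:R - coord xi i * coord xi j / enorm xi ^+ 2)
      (f j) g.

(* u.grad v for div u = 0 and bounded u, v, written
   sum_k d_k (u_k v_j). *)
Definition advection (u v : 'I_3 -> E -> R) (j : 'I_3) : functional R :=
  fun g => \sum_(k < 3) partial k (of_fun (fun x => (u k x * v j x)%:C)) g.

(* B(u, v)(t).  Tested on a Schwartz function the integrand of the space
   integral is bounded times O(|x|^{-4}): the Leray projection of a Schwartz
   function decays only like |x|^{-3}, and the derivative in [advection] gains
   one order, so the integral converges for merely bounded u, v. *)
Definition bilinear (u v : R -> 'I_3 -> E -> R) (t : R) (i : 'I_3)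
  : functional R := fun g =>
  let h tau := heat (t - tau) (leray (advection (u tau) (v tau)) i) g in
  (\int[lebesgue_measure]_(tau in `[0, t]) complex.Re (h tau))
    +i* (\int[lebesgue_measure]_(tau in `[0, t]) complex.Im (h tau)).

(* Bounded solution on [0, T] of u = e^{t Laplacian} u0 - B(u, u), an identity
   between tempered distributions (not only modulo polynomials). *)
Definition navier_stokes_solution (T : R) (u0 : 'I_3 -> functional R)
    (u : R -> 'I_3 -> E -> R) : Prop :=
  [/\ forall i, measurable_fun (`[0, T] `*` [set: mE])
        (fun z : measurableTypeR R * mE => u z.1 i z.2),
      exists M : R, forall t i x, 0 <= t <= T -> `|u t i x| <= M,
      forall t, 0 <= t <= T -> div_free (of_field (u t)) &
      forall t i g, 0 <= t <= T -> schwartz g ->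
        of_field (u t) i g = heat t (u0 i) g - bilinear u u t i g].

End Navier_Stokes.

(* Main.v *)
(** The solution is a 2.5-dimensional shear flow u = (v(x2,t), 0, w(x1,x2,t)).
    Here v = sum_n A 2^n e^(-4^n t) cos(2^n x2), with n running over r consecutive
    integers from m on, solves the heat equation, and w solves the linear equation
    w_t + v d_1 w = Delta w with initial value sum_n A 2^n cos(x1 + 2^n x2 + pi/2).
    For both components the pressure vanishes: in Fourier variables each term that the
    Leray projection could produce carries a factor xi_i with xi_i = 0 on its support.
    Each Picard iterate of w is a finite sum of plane waves, and the supremum of the
    j-th one is at most eps^j amp with eps = sum_n A 2^-n, so the series converges
    when m is large.

    All frequencies of the data lie in different dyadic blocks, so its norm is at most
    r^(1/q) A.  In the first iterate the interaction of the frequency 2^n with itself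
    produces the wave cos(x1), and the r contributions have the same sign: its amplitude
    is at least a constant times r A^2 once 4^m T >= 1.  With A = delta r^(-1/q) and
    q > 2, r A^2 is as large as we like when r is; the later iterates are negligible for
    m large, and the norm of u(T) is bounded from below by testing against the inverse
    Fourier transform of phi, which only sees frequencies near the unit sphere. *)

From HB Require Import structures.
Require Import Defs.
From mathcomp Require Import all_boot all_order all_algebra.
From mathcomp Require Import complex.
From mathcomp Require Import all_classical all_reals all_analysis.
From mathcomp Require Import ring lra.
From mathcomp Require Import ess_sup_inf measurable_realfun.

Set Implicit Arguments.
Unset Strict Implicit.
Unset Printing Implicit Defensive.

Import Order.TTheory GRing.Theory Num.Theory.
Import numFieldNormedType.Exports.

Local Open Scope classical_set_scope.
Local Open Scope ring_scope.

(** * Complex-valued integrals *)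

(** The identities to prove hold between tempered distributions, and the Leray symbol is the
    obstacle: it is discontinuous at the origin, so the projection of a Schwartz function is in
    general neither Schwartz nor integrable, while the flow is merely bounded. What is integrable is
    a derivative of the projection of a heat-smoothed function: its symbol is a superposition of
    dilates of Schwartz functions, which exhibits an integrable kernel. A plane wave of frequency z
    can then be tested against it, and sees a symbol only through its values at z and -z. Signs
    protect the first iterate from cancellation: with the chosen phases all coefficients are
    nonnegative, and so is phi. The data has phase -pi/2 and is invisible to the even test function.
    For fixed r and A, eps is O(2^-m) and amp is O(2^m), so the tail eps^2 amp beyond the first
    iterate is O(2^-m); this is why m is chosen last. Finiteness of the norm of w at time T needs
    its own argument, since w has unboundedly many modes: w itself is used in every block k >= 0,
    which is admissible because all its frequencies have norm at least 1. *)

Section complex_numbers.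
Context {R : realType}.
Local Open Scope complex_scope.
Local Notation C := R[i].
Implicit Types (z w : C) (x : R).

Lemma cmodulus_ge0 z : 0 <= cmodulus z.
Proof. exact: sqrtr_ge0. Qed.

Lemma cmodulus_sqr z : cmodulus z ^+ 2 = complex.Re z ^+ 2 + complex.Im z ^+ 2.
Proof. by rewrite sqr_sqrtr// addr_ge0// sqr_ge0. Qed.

Lemma cmodulusM z w : cmodulus (z * w) = cmodulus z * cmodulus w.
Proof.
case: z => a b; case: w => c d; rewrite /cmodulus -sqrtrM/=; last first.
  by rewrite addr_ge0// sqr_ge0.
by congr Num.sqrt; ring.
Qed.

Lemma norm_Re_le z : `|complex.Re z| <= cmodulus z.
Proof. by rewrite -sqrtr_sqr ler_wsqrtr// lerDl sqr_ge0. Qed.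

Lemma norm_Im_le z : `|complex.Im z| <= cmodulus z.
Proof. by rewrite -sqrtr_sqr ler_wsqrtr// lerDr sqr_ge0. Qed.

Lemma cmodulusD z w : cmodulus (z + w) <= cmodulus z + cmodulus w.
Proof.
(* Cauchy-Schwarz for the coordinates, by Lagrange's identity. *)
have h : complex.Re z * complex.Re w + complex.Im z * complex.Im w
    <= cmodulus z * cmodulus w.
  rewrite (le_trans (ler_norm _))// -sqrtr_sqr -sqrtrM; last first.
    by rewrite addr_ge0// sqr_ge0.
  rewrite ler_wsqrtr// -subr_ge0.
  rewrite (_ : _ - _ = (complex.Re z * complex.Im w
    - complex.Im z * complex.Re w) ^+ 2) ?sqr_ge0//; ring.
rewrite -(@ler_pXn2r _ 2)// ?nnegrE ?addr_ge0 ?cmodulus_ge0//.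
rewrite sqrrD !cmodulus_sqr; case: z w h => [a b] [c d]/= h.
nra.
Qed.

Lemma cmodulus_real x : cmodulus x%:C = `|x|.
Proof. by rewrite /cmodulus/= expr0n addr0 sqrtr_sqr. Qed.

Lemma cmodulus0 : cmodulus (0 : C) = 0.
Proof. by rewrite /cmodulus/= !expr0n/= addr0 sqrtr0. Qed.

Lemma cmodulusN z : cmodulus (- z) = cmodulus z.
Proof. by case: z => a b; rewrite /cmodulus/= !sqrrN. Qed.

Lemma cmodulus_le_ReIm z : cmodulus z <= `|complex.Re z| + `|complex.Im z|.
Proof.
rewrite -(@ler_pXn2r _ 2)// ?nnegrE ?addr_ge0 ?cmodulus_ge0//.
by rewrite sqrrD cmodulus_sqr !real_normK ?num_real// lerD2r lerDl mulrn_wge0.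
Qed.

Lemma cmodulus_cis x : cmodulus (cis x) = 1.
Proof. by rewrite /cmodulus/= cos2Dsin2 sqrtr1. Qed.

Lemma cisD x y : cis (x + y) = cis x * cis y.
Proof. by rewrite /cis cosD sinD; simpc; congr (_ +i* _); rewrite addrC. Qed.

Lemma cis0 : cis (0 : R) = 1.
Proof. by rewrite /cis cos0 sin0. Qed.

Lemma ReD z w : complex.Re (z + w) = complex.Re z + complex.Re w.
Proof. by case: z; case: w. Qed.

Lemma ImD z w : complex.Im (z + w) = complex.Im z + complex.Im w.
Proof. by case: z; case: w. Qed.

Lemma ReM z w : complex.Re (z * w) = complex.Re z * complex.Re w - complex.Im z * complex.Im w.
Proof. by case: z; case: w. Qed.

Lemma ImM z w : complex.Im (z * w) = complex.Re z * complex.Im w + complex.Im z * complex.Re w.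
Proof. by case: z => a b; case: w => c d/=. Qed.

Lemma eq_cplx z w : complex.Re z = complex.Re w -> complex.Im z = complex.Im w -> z = w.
Proof. by case: z => a b; case: w => c d/= -> ->. Qed.

End complex_numbers.

Section complex_integral.
Context {R : realType} {d : measure_display} {T : measurableType d}.
Local Open Scope complex_scope.
Local Notation C := R[i].
Implicit Types (f g : T -> C).

(** Over an arbitrary measurable type, because integrands also live on the time axis and on
    products; over R^3 this is [cmeasurable]. *)
Definition cmeas f :=
  measurable_fun [set: T] (fun x => complex.Re (f x)) /\
  measurable_fun [set: T] (fun x => complex.Im (f x)).

Lemma cmeas_modulus f : cmeas f -> measurable_fun [set: T] (fun x => cmodulus (f x)).
Proof.
move=> [mr mi]; apply: measurableT_comp => //; first exact: continuous_measurable_fun (@sqrt_continuous R).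
by apply: measurable_funD; apply: measurable_funX.
Qed.

Lemma cmeasD f g : cmeas f -> cmeas g -> cmeas (fun x => f x + g x).
Proof.
move=> [fr fi] [gr gi]; split.
  by under eq_fun do rewrite ReD; exact: measurable_funD.
by under eq_fun do rewrite ImD; exact: measurable_funD.
Qed.

Lemma cmeasM f g : cmeas f -> cmeas g -> cmeas (fun x => f x * g x).
Proof.
move=> [fr fi] [gr gi]; split.
  under eq_fun do rewrite ReM.
  by apply: measurable_funB; exact: measurable_funM.
under eq_fun do rewrite ImM.
by apply: measurable_funD; exact: measurable_funM.
Qed.

Lemma cmeas_cst (c : C) : cmeas (fun=> c).
Proof. by split; exact: measurable_cst. Qed.

Lemma cmeas_real (h : T -> R) : measurable_fun [set: T] h -> cmeas (fun x => (h x)%:C).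
Proof. by move=> mh; split => //=; exact: measurable_cst. Qed.

Lemma cmeas_cis (h : T -> R) : measurable_fun [set: T] h -> cmeas (fun x => cis (h x)).
Proof.
move=> mh; split => /=; apply: measurableT_comp => //.
  exact: continuous_measurable_fun (@continuous_cos R).
exact: continuous_measurable_fun (@continuous_sin R).
Qed.

Lemma cmeas_comp {d' : measure_display} {T' : measurableType d'} f (k : T' -> T) :
  cmeas f -> measurable_fun setT k ->
  measurable_fun [set: T'] (fun x => complex.Re (f (k x))) /\
  measurable_fun [set: T'] (fun x => complex.Im (f (k x))).
Proof. by move=> [mr mi] mk; split; [exact: measurableT_comp mr mk|exact: measurableT_comp mi mk]. Qed.

(** As in [zsums_to], convergence in C is expressed by the [cmodulus] of the difference tending to
    0, so uniqueness of limits comes from the triangle inequality. *)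
Lemma cvg_cmodulus_unique (u : nat -> C) (a b : C) :
  (fun n => cmodulus (u n - a)) @ \oo --> (0 : R) ->
  (fun n => cmodulus (u n - b)) @ \oo --> (0 : R) -> a = b.
Proof.
move=> ua ub; apply/eqP; rewrite -subr_eq0; apply/eqP.
suff h : cmodulus (a - b) <= 0.
  have h0 : cmodulus (a - b) = 0 by apply/eqP; rewrite eq_le h cmodulus_ge0.
  apply: eq_cplx; apply/eqP; rewrite -normr_le0 -h0; [exact: norm_Re_le|exact: norm_Im_le].
have uab : (fun n => cmodulus (u n - b) + cmodulus (u n - a)) @ \oo --> (0 : R).
  by rewrite -[X in _ --> X]addr0; exact: cvgD.
apply: (ler_cvg_to (cvg_cst (cmodulus (a - b))) uab); apply: nearW => n.
rewrite -(cmodulusN (u n - a)) (le_trans _ (cmodulusD _ _))//.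
by rewrite (_ : u n - b + _ = a - b)//; ring.
Qed.

Context (mu : {measure set T -> \bar R}).

(** For [leb3] this is convertible to [cintegral]; the measure is a parameter so that space, time
    and product integrals share one theory. *)
Definition cint f : C :=
  (\int[mu]_x complex.Re (f x)) +i* (\int[mu]_x complex.Im (f x)).

Definition cL1 f :=
  cmeas f /\ mu.-integrable setT (fun x => (cmodulus (f x))%:E).

Lemma le_cL1 f (h : T -> R) : cmeas f -> mu.-integrable setT (EFin \o h) ->
  (forall x, cmodulus (f x) <= h x) -> cL1 f.
Proof.
move=> mf ih fh; split => //; apply: le_integrable ih => //.
  by apply/measurable_EFinP; exact: cmeas_modulus.
move=> x _ /=; rewrite lee_fin ger0_norm ?cmodulus_ge0//.
by rewrite (le_trans (fh x))// ler_norm.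
Qed.

Lemma cL1_Re f : cL1 f -> mu.-integrable setT (EFin \o (fun x => complex.Re (f x))).
Proof.
move=> [[mr mi] ifm]; apply: le_integrable ifm => //; first exact/measurable_EFinP.
by move=> x _ /=; rewrite lee_fin [leRHS]ger0_norm ?cmodulus_ge0// norm_Re_le.
Qed.

Lemma cL1_Im f : cL1 f -> mu.-integrable setT (EFin \o (fun x => complex.Im (f x))).
Proof.
move=> [[mr mi] ifm]; apply: le_integrable ifm => //; first exact/measurable_EFinP.
by move=> x _ /=; rewrite lee_fin [leRHS]ger0_norm ?cmodulus_ge0// norm_Im_le.
Qed.

Lemma cL1_real (h : T -> R) : mu.-integrable setT (EFin \o h) -> cL1 (fun x => (h x)%:C).
Proof.
move=> ih; apply: (@le_cL1 _ (Num.norm \o h)).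
- by apply: cmeas_real; apply/measurable_EFinP; exact: (measurable_int mu).
- exact: integrable_norm.
- by move=> x /=; rewrite cmodulus_real.
Qed.

Lemma cL1D f g : cL1 f -> cL1 g -> cL1 (fun x => f x + g x).
Proof.
move=> [mf jf] [mg jg]; apply: (@le_cL1 _ (fun x => cmodulus (f x) + cmodulus (g x))).
- exact: cmeasD.
- by apply: eq_integrable (integrableD _ jf jg).
- by move=> x; exact: cmodulusD.
Qed.

Lemma cL1M_bounded f g (M : R) : cL1 f -> cmeas g -> (forall x, cmodulus (g x) <= M) ->
  cL1 (fun x => g x * f x).
Proof.
move=> [mf jf] mg gM; apply: (@le_cL1 _ (fun x => M * cmodulus (f x))).
- exact: cmeasM.
- by apply: eq_integrable (integrableZl _ M jf).
- by move=> x; rewrite cmodulusM ler_wpM2r ?cmodulus_ge0.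
Qed.

Lemma cL1Z (c : C) f : cL1 f -> cL1 (fun x => c * f x).
Proof.
by move=> jf; apply: (@cL1M_bounded _ (fun=> c) (cmodulus c)) => //; exact: cmeas_cst.
Qed.

Lemma eq_cint f g : f =1 g -> cint f = cint g.
Proof. by move=> /funext ->. Qed.

Lemma cint_real (h : T -> R) : cint (fun x => (h x)%:C) = (\int[mu]_x h x)%:C.
Proof. by apply: eq_cplx => //=; rewrite /Rintegral integral0_eq. Qed.

Lemma cintD f g : cL1 f -> cL1 g -> cint (fun x => f x + g x) = cint f + cint g.
Proof.
move=> jf jg; apply: eq_cplx => /=.
  under eq_Rintegral do rewrite ReD.
  by rewrite RintegralD//; exact: cL1_Re.
under eq_Rintegral do rewrite ImD.
by rewrite RintegralD//; exact: cL1_Im.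
Qed.

Lemma cintZ (c : C) f : cL1 f -> cint (fun x => c * f x) = c * cint f.
Proof.
move=> jf; have jr := cL1_Re jf; have ji := cL1_Im jf.
have jrZ a : mu.-integrable setT (EFin \o (fun x => a * complex.Re (f x))).
  by apply: eq_integrable (integrableZl _ a jr).
have jiZ a : mu.-integrable setT (EFin \o (fun x => a * complex.Im (f x))).
  by apply: eq_integrable (integrableZl _ a ji).
apply: eq_cplx; rewrite ?ReM ?ImM/=.
  under eq_Rintegral do rewrite ReM.
  by rewrite RintegralB// !RintegralZl.
under eq_Rintegral do rewrite ImM.
by rewrite RintegralD// !RintegralZl.
Qed.

Lemma cint0 : cint (fun=> 0) = 0.
Proof. by rewrite /cint/= /Rintegral !integral0_eq. Qed.

Lemma cint_sum (I : Type) (s : seq I) (F : I -> T -> C) :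
  (forall i, cL1 (F i)) ->
  cL1 (fun x => \sum_(i <- s) F i x) /\
  cint (fun x => \sum_(i <- s) F i x) = \sum_(i <- s) cint (F i).
Proof.
move=> jF; elim: s => [|i s [IH1 IH2]].
  split; last by under eq_cint do rewrite big_nil; rewrite big_nil cint0.
  apply: (@le_cL1 _ (fun=> 0)); first exact: (eq_ind _ cmeas (cmeas_cst 0) _ (funext (fun=> esym (big_nil _ _ _ _)))).
    exact: integrable0.
  by move=> x; rewrite big_nil cmodulus0.
split.
  under eq_fun do rewrite big_cons.
  exact: cL1D.
under eq_cint do rewrite big_cons.
by rewrite cintD// big_cons IH2.
Qed.

(** Multiplying f by the conjugate [w] of its integral z turns the integral into the real number
    |z|^2; monotonicity of the real integral then bounds it by |z| times the integral of |f|. *)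
Lemma cmodulus_cint_le f : cL1 f ->
  cmodulus (cint f) <= \int[mu]_x cmodulus (f x).
Proof.
move=> jf; set z := cint f; set I := \int[mu]_x _.
have [->|z0] := eqVneq (cmodulus z) 0.
  by apply: Rintegral_ge0 => x _; exact: cmodulus_ge0.
have zgt0 : 0 < cmodulus z by rewrite lt_neqAle eq_sym z0 cmodulus_ge0.
pose w : C := complex.Re z -i* complex.Im z.
have wz : complex.Re (w * z) = cmodulus z ^+ 2.
  by rewrite cmodulus_sqr /w ReM/=; ring.
have mw : cmodulus w = cmodulus z by rewrite /cmodulus/= sqrrN.
rewrite -(ler_pM2l zgt0) -expr2 -wz -cintZ//=.
rewrite /I -RintegralZl//; last by case: jf.
apply: le_Rintegral => //.
- exact/cL1_Re/cL1Z.
- by apply: eq_integrable (integrableZl _ (cmodulus z) jf.2).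
- move=> x _; rewrite (le_trans (ler_norm _))// (le_trans (norm_Re_le _))//.
  by rewrite cmodulusM mw.
Qed.

Lemma rintegrableD (f g : T -> R) : mu.-integrable setT (EFin \o f) ->
  mu.-integrable setT (EFin \o g) -> mu.-integrable setT (EFin \o (fun x => f x + g x)).
Proof. by move=> jf jg; apply: eq_integrable (integrableD measurableT jf jg). Qed.

Lemma rintegrableB (f g : T -> R) : mu.-integrable setT (EFin \o f) ->
  mu.-integrable setT (EFin \o g) -> mu.-integrable setT (EFin \o (fun x => f x - g x)).
Proof. by move=> jf jg; apply: eq_integrable (integrableB measurableT jf jg). Qed.

Lemma rintegrableZ (c : R) (f : T -> R) : mu.-integrable setT (EFin \o f) ->
  mu.-integrable setT (EFin \o (fun x => c * f x)).
Proof. by move=> jf; apply: eq_integrable (integrableZl measurableT c jf). Qed.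

Lemma rint_dominated (f_ : nat -> T -> R) (f h : T -> R) :
  (forall n, measurable_fun setT (f_ n)) ->
  (forall x, (fun n => f_ n x) @ \oo --> f x) ->
  mu.-integrable setT (EFin \o h) ->
  (forall n x, `|f_ n x| <= h x) ->
  (fun n => \int[mu]_x f_ n x) @ \oo --> \int[mu]_x f x.
Proof.
move=> mf ff ih fh.
have mff : measurable_fun setT f by exact: measurable_fun_cvg mf _.
have jf : mu.-integrable setT (EFin \o f).
  apply: le_integrable ih => //; first exact/measurable_EFinP.
  move=> x _ /=; rewrite lee_fin [leRHS]ger0_norm; last first.
    exact: le_trans (fh 0 x).
  by apply: (ler_cvg_to (cvg_norm (ff x)) (cvg_cst (h x))); apply: nearW.
apply: fine_cvg; rewrite fineK; last exact: integrable_fin_num.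
apply: (@dominated_cvg _ _ _ mu setT measurableT _ _ (EFin \o h)) => //.
- by move=> n; apply/measurable_EFinP.
- by move=> x _; apply: cvg_EFin; [exact: nearW|exact: ff].
- by move=> n x _ /=; rewrite lee_fin.
Qed.

Lemma cint_dominated (f_ : nat -> T -> C) f (h : T -> R) :
  (forall n, cmeas (f_ n)) ->
  (forall x, (fun n => cmodulus (f_ n x - f x)) @ \oo --> (0 : R)) ->
  mu.-integrable setT (EFin \o h) ->
  (forall n x, cmodulus (f_ n x) <= h x) ->
  (fun n => cmodulus (cint (f_ n) - cint f)) @ \oo --> (0 : R).
Proof.
move=> mf ff ih fh.
have cR x : (fun n => complex.Re (f_ n x)) @ \oo --> complex.Re (f x).
  apply/cvgrPdist_le => e e0; have /cvgrPdist_le/(_ _ e0) := ff x.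
  apply: filterS => n; rewrite sub0r normrN ger0_norm ?cmodulus_ge0// => h1.
  rewrite distrC (le_trans _ h1)// (le_trans _ (norm_Re_le _))// ReD.
  by case: (f x).
have cI x : (fun n => complex.Im (f_ n x)) @ \oo --> complex.Im (f x).
  apply/cvgrPdist_le => e e0; have /cvgrPdist_le/(_ _ e0) := ff x.
  apply: filterS => n; rewrite sub0r normrN ger0_norm ?cmodulus_ge0// => h1.
  rewrite distrC (le_trans _ h1)// (le_trans _ (norm_Im_le _))// ImD.
  by case: (f x).
have dR : (fun n => \int[mu]_x complex.Re (f_ n x)) @ \oo --> \int[mu]_x complex.Re (f x).
  apply: rint_dominated ih _ => //.
  - by move=> n; exact: (mf n).1.
  - by move=> n x; rewrite (le_trans (norm_Re_le _)).
have dI : (fun n => \int[mu]_x complex.Im (f_ n x)) @ \oo --> \int[mu]_x complex.Im (f x).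
  apply: rint_dominated ih _ => //.
  - by move=> n; exact: (mf n).2.
  - by move=> n x; rewrite (le_trans (norm_Im_le _)).
apply/cvgrPdist_le => e e0; near=> n.
rewrite sub0r normrN ger0_norm ?cmodulus_ge0// (le_trans (cmodulus_le_ReIm _))//.
rewrite ReD ImD/= [e]splitr lerD// distrC; near: n.
  by have /cvgrPdist_le := dR; apply; rewrite divr_gt0.
by have /cvgrPdist_le := dI; apply; rewrite divr_gt0.
Unshelve. all: by end_near. Qed.

End complex_integral.

Section product_sigma_finite.
Context d1 d2 (T1 : measurableType d1) (T2 : measurableType d2) (R : realType).
Variable m1 : {sigma_finite_measure set T1 -> \bar R}.
Variable m2 : {sigma_finite_measure set T2 -> \bar R}.

Lemma sigma_finite_prod : sigma_finite setT (m1 \x m2)%E.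
Proof.
have /sigma_finiteP[F [TF ndF Foo]] := sigma_finiteT m1.
have /sigma_finiteP[G [TG ndG Goo]] := sigma_finiteT m2.
exists (fun n => F n `*` G n).
  rewrite -setXTT TF TG; apply/seteqP; split => -[x y].
    move=> [/= [n _ Fnx] [k _ Gky]]; exists (maxn n k) => //; split.
    - by move: x Fnx; exact/subsetPset/ndF/leq_maxl.
    - by move: y Gky; exact/subsetPset/ndG/leq_maxr.
  by move=> [n _ []/= ? ?]; split; exists n.
move=> k; have [? ?] := Foo k; have [? ?] := Goo k.
split; first exact: measurableX.
by rewrite product_measure1E// lte_mul_pinfty// ge0_fin_numE.
Qed.

(** Fubini's theorem asks for sigma-finite factors, and here a factor is often itself a product: R^3
    is (R x R) x R, and pairs of points of R^3 occur below. *)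
Definition prod_sf : {sigma_finite_measure set (T1 * T2)%type -> \bar R} :=
  HB.pack (m1 \x m2)%E
    (Measure_isSigmaFinite.Build _ _ _ (m1 \x m2)%E sigma_finite_prod).

End product_sigma_finite.

(** * Integration on R^3 *)

Section measure_R3.
Context {R : realType}.
Local Notation mR := (measurableTypeR R).
Local Notation E := (R * R * R)%type.
Local Notation mE := (mR * mR * mR)%type.
Local Notation leb := (@lebesgue_measure R).

(** [leb3] with its sigma-finiteness attached. The two are convertible, so Fubini statements for
    [mu3] apply to integrals over [leb3]. *)
Definition mu3 : {sigma_finite_measure set mE -> \bar R} :=
  prod_sf (prod_sf leb leb) leb.

Lemma leb3_iter (f : mE -> \bar R) : measurable_fun setT f -> (forall x, 0 <= f x)%E ->
  (\int[leb3]_x f x = \int[leb]_a \int[leb]_b \int[leb]_c f (a, b, c))%E.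
Proof.
move=> mf f0.
transitivity (\int[prod_sf leb leb]_z \int[leb]_c f (z, c))%E.
  exact: (@fubini_tonelli1 _ _ _ _ _ (prod_sf leb leb) leb f).
apply: (@fubini_tonelli1 _ _ _ _ _ leb leb (fun z => \int[leb]_c f (z, c))%E).
  exact: (@measurable_fun_fubini_tonelli_F _ _ _ _ _ leb f).
by move=> x; exact: integral_ge0.
Qed.

(** Lebesgue measure is determined by its values on half-open intervals, and the pushforward under x
    -> l x + a, multiplied by l, has the same values there. *)
Lemma lebesgue_affine (a l : R) (f : mR -> \bar R) : 0 < l ->
  measurable_fun setT f -> (forall x, 0 <= f x)%E ->
  (\int[leb]_x f x = l%:E * \int[leb]_x f (l * x + a)%R)%E.
Proof.
move=> l0 mf f0.
pose phi (x : mR) : mR := l * x + a.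
have mphi : measurable_fun setT phi by apply: measurable_funD => //; apply: measurable_funM.
pose pf : {measure set mR -> \bar R} := pushforward leb phi.
rewrite (eq_measure_integral (mscale (NngNum (ltW l0)) (pf mphi))).
  by rewrite ge0_integral_mscale//= ge0_integral_pushforward.
move=> A mA _; apply: lebesgue_measure_unique => // X /ocitvP[->|[[c d]/= cd ->]].
  by rewrite !measure0.
rewrite /mscale/= /pushforward.
have -> : phi @^-1` `]c, d] = `](c - a) / l, (d - a) / l]%classic.
  apply/seteqP; split => x /=; rewrite !in_itv/= /phi ltr_pdivrMr// ler_pdivlMr//.
    by rewrite mulrC ltrBlDr lerBrDr.
  by rewrite mulrC ltrBlDr lerBrDr.
rewrite !lebesgue_measure_itv/= !lte_fin ltr_pM2r ?invr_gt0// ltrD2r cd.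
by rewrite -!EFinB -EFinM -mulrBl mulrC mulfVK ?gt_eqF//; congr EFin; ring.
Qed.

(** A dilation composed with a translation acts on each coordinate separately, so Tonelli reduces
    the claim to the one-dimensional case, used three times. *)
Lemma leb3_affine (a : mE) (l : R) (f : mE -> \bar R) : 0 < l ->
  measurable_fun setT f -> (forall x, 0 <= f x)%E ->
  (\int[leb3]_x f x =
   (l ^+ 3)%:E * \int[leb3]_x f ((l * x.1.1 + a.1.1, l * x.1.2 + a.1.2, l * x.2 + a.2)%R : mE))%E.
Proof.
move=> l0 mf f0.
have maff : measurable_fun setT (fun x : mE =>
   (l * x.1.1 + a.1.1, l * x.1.2 + a.1.2, l * x.2 + a.2) : mE).
  apply/measurable_fun_pairP; split => /=.
    apply/measurable_fun_pairP; split => /=; apply: measurable_funD => //;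
      apply: measurable_funM => //; apply: measurableT_comp => //.
  by apply: measurable_funD => //; apply: measurable_funM.
rewrite !leb3_iter//; last exact: measurableT_comp.
have ms2 u v : measurable_fun setT (fun c : mR => f (u, v, c)).
  by apply: measurableT_comp => //; exact: measurable_pair1.
have mF2 : measurable_fun setT (fun z : mR * mR => \int[leb]_c f (z, c))%E.
  exact: (@measurable_fun_fubini_tonelli_F _ _ _ _ _ leb f).
have F20 (z : mR * mR) : (0 <= \int[leb]_c f (z, c))%E by exact: integral_ge0.
have ms1 u : measurable_fun setT (fun v : mR => \int[leb]_c f (u, v, c))%E.
  by apply: (measurableT_comp mF2); exact: measurable_pair1.
have F10 u : (0 <= \int[leb]_v \int[leb]_c f (u, v, c))%E by exact: integral_ge0.
have mF1 : measurable_fun setT (fun u : mR => \int[leb]_v \int[leb]_c f (u, v, c))%E.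
  exact: (@measurable_fun_fubini_tonelli_F _ _ _ _ _ leb (fun z => \int[leb]_c f (z, c))%E).
pose g (x : mE) : \bar R := f (l * x.1.1 + a.1.1, l * x.1.2 + a.1.2, l * x.2 + a.2).
have mg : measurable_fun setT g by exact: measurableT_comp.
have g0 x : (0 <= g x)%E by exact: f0.
have mG2 : measurable_fun setT (fun z : mR * mR => \int[leb]_c g (z, c))%E.
  exact: (@measurable_fun_fubini_tonelli_F _ _ _ _ _ leb g).
have G20 z : (0 <= \int[leb]_c g (z, c))%E by exact: integral_ge0.
have mG1 : measurable_fun setT (fun u : mR => \int[leb]_v \int[leb]_c g (u, v, c))%E.
  exact: (@measurable_fun_fubini_tonelli_F _ _ _ _ _ leb (fun z => \int[leb]_c g (z, c))%E).
have lE0 : (0 <= l%:E)%E by rewrite lee_fin ltW.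
have h2 u v : (\int[leb]_c f ((l * u + a.1.1)%R, (l * v + a.1.2)%R, c) =
    l%:E * \int[leb]_c g (u, v, c))%E.
  exact: (lebesgue_affine a.2 l0 (ms2 _ _)).
have h1 u : (\int[leb]_v \int[leb]_c f ((l * u + a.1.1)%R, v, c) =
    l%:E * (l%:E * \int[leb]_v \int[leb]_c g (u, v, c)))%E.
  rewrite [LHS](lebesgue_affine a.1.2 l0 (ms1 _) (fun=> F20 (_, _))).
  congr (_ * _)%E; transitivity (\int[leb]_v (l%:E * \int[leb]_c g (u, v, c)))%E.
    by apply: eq_integral => v _; exact: h2.
  have mG2u : measurable_fun setT (fun v : mR => \int[leb]_c g (u, v, c))%E.
    by apply: (measurableT_comp mG2); exact: measurable_pair1.
  by rewrite (@ge0_integralZl _ _ _ leb setT measurableT _ mG2u).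
rewrite [LHS](lebesgue_affine a.1.1 l0 mF1 F10).
transitivity (l%:E * \int[leb]_u (l%:E * (l%:E * \int[leb]_v \int[leb]_c g (u, v, c))))%E.
  by congr (_ * _)%E; apply: eq_integral => u _; exact: h1.
rewrite (@ge0_integralZl _ _ _ leb setT measurableT) //.
- rewrite (@ge0_integralZl _ _ _ leb setT measurableT) //.
    by rewrite !muleA -!EFinM; congr (_%:E * _)%E; ring.
  by move=> u _; apply: integral_ge0 => v _; exact: integral_ge0.
- exact: measurable_funeM.
- by move=> u _; apply: mule_ge0 => //; apply: integral_ge0 => v _; exact: integral_ge0.
Qed.

Definition aff (l : R) (a x : E) : E := (l * x.1.1 + a.1.1, l * x.1.2 + a.1.2, l * x.2 + a.2).

Lemma rint_affine (a : E) (l : R) (f : mE -> R) : 0 < l ->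
  leb3.-integrable setT (EFin \o f) ->
  leb3.-integrable setT (EFin \o (f \o aff l a)) /\
  \int[leb3]_x f x = l ^+ 3 * \int[leb3]_x f (aff l a x).
Proof.
move=> l0 jf; have /measurable_EFinP mf := measurable_int _ jf.
have maff : measurable_fun setT (aff l a : mE -> mE).
  apply/measurable_fun_pairP; split => /=.
    apply/measurable_fun_pairP; split => /=; apply: measurable_funD => //;
      apply: measurable_funM => //; apply: measurableT_comp => //.
  by apply: measurable_funD => //; apply: measurable_funM.
have mfa : measurable_fun setT (f \o aff l a : mE -> R) by exact: measurableT_comp.
have l30 : 0 < l ^+ 3 by exact: exprn_gt0.
have jfa : leb3.-integrable setT (EFin \o (f \o aff l a)).
  apply/integrableP; split; first exact/measurable_EFinP.
  case/integrableP : jf => _; rewrite (leb3_affine a l0)//.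
    move=> h; rewrite ltey; apply/eqP => e; move: h.
    by rewrite [X in (_ * X)%E](_ : _ = +oo%E) ?gt0_muley ?ltxx ?lte_fin.
  by apply: measurableT_comp => //; exact/measurable_EFinP.
split => //.
rewrite /Rintegral [X in fine X](_ : _ = (l ^+ 3)%:E * \int[leb3]_x (f (aff l a x))%:E)%E.
  by rewrite fineM//; exact: integrable_fin_num jfa.
rewrite integralE [in RHS]integralE muleBr//; last first.
  by rewrite fin_num_adde_defr//; exact: (integrable_pos_fin_num measurableT jfa).
congr (_ - _)%E.
  rewrite (funepos_comp (EFin \o f) (aff l a)).
  apply: (@leb3_affine a l ((EFin \o f)^\+)%E) => //.
  by apply: measurable_funepos; exact/measurable_EFinP.
rewrite (funeneg_comp (EFin \o f) (aff l a)).
apply: (@leb3_affine a l ((EFin \o f)^\-)%E) => //.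
by apply: measurable_funeneg; exact/measurable_EFinP.
Qed.

Lemma measurable_aff (a : E) (l : R) : measurable_fun setT (aff l a : mE -> mE).
Proof.
apply/measurable_fun_pairP; split => /=.
  apply/measurable_fun_pairP; split => /=; apply: measurable_funD => //;
    apply: measurable_funM => //; apply: measurableT_comp => //.
by apply: measurable_funD => //; apply: measurable_funM.
Qed.

Lemma cint_affine (a : E) (l : R) (f : mE -> R[i]) : 0 < l ->
  cL1 leb3 f ->
  cL1 leb3 (f \o aff l a) /\
  cint leb3 f = (l ^+ 3)%:C%C * cint leb3 (fun x => f (aff l a x)).
Proof.
move=> l0 jf; split.
  split; last exact: (rint_affine a l0 jf.2).1.
  case: jf => -[mr mi] _; split.
    exact: (measurableT_comp mr (measurable_aff a l)).
  exact: (measurableT_comp mi (measurable_aff a l)).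
rewrite /cint (rint_affine a l0 (cL1_Re jf)).2 (rint_affine a l0 (cL1_Im jf)).2.
by apply: eq_cplx; rewrite ?ReM ?ImM/=; ring.
Qed.

End measure_R3.

Section product_integrals.
Context {R : realType}.
Context d1 d2 (T1 : measurableType d1) (T2 : measurableType d2).
Variable m1 : {sigma_finite_measure set T1 -> \bar R}.
Variable m2 : {sigma_finite_measure set T2 -> \bar R}.

Lemma measurable_rint (f : T1 * T2 -> R) : measurable_fun setT f ->
  measurable_fun setT (fun x => \int[m2]_y f (x, y)).
Proof.
move=> mf; apply: measurableT_comp => //.
under eq_fun do rewrite integralE.
apply: emeasurable_funB.
  under eq_fun do rewrite (funepos_comp (EFin \o f) (pair _)).
  apply: (@measurable_fun_fubini_tonelli_F _ _ _ _ _ m2 ((EFin \o f)^\+)%E) => //.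
  by apply: measurable_funepos; exact/measurable_EFinP.
under eq_fun do rewrite (funeneg_comp (EFin \o f) (pair _)).
apply: (@measurable_fun_fubini_tonelli_F _ _ _ _ _ m2 ((EFin \o f)^\-)%E) => //.
by apply: measurable_funeneg; exact/measurable_EFinP.
Qed.

Lemma cmeas_cint (f : T1 * T2 -> R[i]) : cmeas f ->
  cmeas (fun x => cint m2 (fun y => f (x, y))).
Proof.
move=> [mr mi]; split; first exact: measurable_rint mr.
exact: measurable_rint mi.
Qed.

End product_integrals.

Section fubini_complex.
Context {R : realType}.
Context d1 d2 (T1 : measurableType d1) (T2 : measurableType d2).
Variable m1 : {sigma_finite_measure set T1 -> \bar R}.
Variable m2 : {sigma_finite_measure set T2 -> \bar R}.

Lemma fine_ae_integral d (T : measurableType d) (m : {measure set T -> \bar R})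
   (F : T -> \bar R) : measurable_fun setT F -> {ae m, forall x, F x \is a fin_num} ->
  (\int[m]_x (fine (F x))%:E = \int[m]_x F x)%E.
Proof.
move=> mF aeF; apply: ae_eq_integral => //.
- by apply/measurable_EFinP; exact: measurableT_comp.
- by apply: filterS aeF => x /= h _; rewrite fineK.
Qed.

Lemma integrable_fine d (T : measurableType d) (m : {measure set T -> \bar R})
   (F : T -> \bar R) : m.-integrable setT F -> m.-integrable setT (EFin \o (fine \o F)).
Proof.
move=> jF; have jF0 := jF; apply: le_integrable jF => //.
  by apply/measurable_EFinP; apply: measurableT_comp => //; exact: measurable_int jF0.
by move=> x _ /=; case: (F x) => [r||]; rewrite //= ?lexx// normr0 leey.
Qed.

(** [Rintegral] applies [fine] to the inner integrals at every point, but these are finite only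
    almost everywhere; [fine_ae_integral] bridges the gap. *)
Lemma rint_fubini (f : T1 * T2 -> R) :
  (m1 \x m2)%E.-integrable setT (EFin \o f) ->
  \int[m1]_x \int[m2]_y f (x, y) = \int[m2]_y \int[m1]_x f (x, y).
Proof.
move=> jf; rewrite /Rintegral.
have h1 := @integral12_prod_meas1 _ _ _ _ _ m1 m2 _ jf.
have h2 := @integral21_prod_meas1 _ _ _ _ _ m1 m2 _ jf.
congr fine; rewrite [LHS](@fine_ae_integral _ _ m1 (fubini_F m2 (EFin \o f))).
- rewrite [RHS](@fine_ae_integral _ _ m2 (fubini_G m1 (EFin \o f))); first by rewrite h1 h2.
    exact: (measurable_fubini_G jf).
  apply: filterS (ae_integrable2 jf) => y jy.
  exact: (integrable_fin_num measurableT jy).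
- exact: (measurable_fubini_F jf).
- apply: filterS (ae_integrable1 jf) => x jx.
  exact: (integrable_fin_num measurableT jx).
Qed.

Lemma cL1_prod (f : T1 * T2 -> R[i]) (h : T1 -> R) :
  cmeas f -> m1.-integrable setT (EFin \o h) ->
  (forall x, \int[m2]_y (cmodulus (f (x, y)))%:E <= (h x)%:E)%E ->
  cL1 (prod_sf m1 m2) f.
Proof.
move=> mf jh fh; split => //; have mm := cmeas_modulus mf.
apply/(integrable12ltyP m1 m2); first exact/measurable_EFinP.
apply: le_lt_trans (integrable_lty measurableT jh).
apply: ge0_le_integral => //.
- by move=> x _; exact: integral_ge0.
- apply: (@measurable_fun_fubini_tonelli_F _ _ _ _ _ m2 (fun z => `|(cmodulus (f z))%:E|)%E) => //.
  by apply: measurableT_comp => //; exact/measurable_EFinP.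
- exact: measurable_int jh.
- move=> x _; apply: le_trans (fh x).
  by under eq_integral do rewrite abse_EFin ger0_norm ?cmodulus_ge0//.
Qed.

Lemma cL1_prod_mul (f : T1 * T2 -> R[i]) (a : T1 -> R) (b : T2 -> R) :
  cmeas f -> m1.-integrable setT (EFin \o a) -> m2.-integrable setT (EFin \o b) ->
  (forall x y, cmodulus (f (x, y)) <= a x * b y) ->
  cL1 (prod_sf m1 m2) f.
Proof.
move=> mf ja jb fab; apply: (@cL1_prod _ (fun x => `|a x| * \int[m2]_y `|b y|)) => //.
  have := rintegrableZ (\int[m2]_y `|b y|) (integrable_norm ja).
  by congr (_.-integrable _ _); apply/funext => x /=; rewrite mulrC.
move=> x; have jn : m2.-integrable setT (EFin \o (fun y => `|a x| * `|b y|)).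
  exact/rintegrableZ/integrable_norm.
apply: (@le_trans _ _ (\int[m2]_y (`|a x| * `|b y|)%:E)%E).
  apply: ge0_le_integral => //.
  - by move=> y _; rewrite lee_fin cmodulus_ge0.
  - by apply/measurable_EFinP; have /= := measurable_fun_pair2 x (cmeas_modulus mf).
  - exact: measurable_int jn.
  - by move=> y _; rewrite lee_fin (le_trans (fab x y))// -normrM ler_norm.
rewrite -RintegralZl//; last exact: integrable_norm.
by rewrite /Rintegral fineK// (integrable_fin_num measurableT jn).
Qed.

Lemma cint_fubini (f : T1 * T2 -> R[i]) : cL1 (prod_sf m1 m2) f ->
  cint m1 (fun x => cint m2 (fun y => f (x, y))) =
  cint m2 (fun y => cint m1 (fun x => f (x, y))).
Proof.
move=> jf; apply: eq_cplx => /=.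
  exact: (rint_fubini (cL1_Re jf)).
exact: (rint_fubini (cL1_Im jf)).
Qed.

Lemma cL1_cint2 (f : T1 * T2 -> R[i]) : cL1 (prod_sf m1 m2) f ->
  cL1 m1 (fun x => cint m2 (fun y => f (x, y))).
Proof.
move=> jf.
have jr := @integrable_fubini_F _ _ _ _ _ m1 m2 _ (cL1_Re jf).
have ji := @integrable_fubini_F _ _ _ _ _ m1 m2 _ (cL1_Im jf).
apply: (le_cL1 _ (integrableD measurableT (integrable_norm (integrable_fine jr)) (integrable_norm (integrable_fine ji)))).
  by apply: cmeas_cint; case: jf.
by move=> x /=; exact: cmodulus_le_ReIm.
Qed.

End fubini_complex.

Section fubini_swap.
Context {R : realType}.
Context d1 d2 (T1 : measurableType d1) (T2 : measurableType d2).
Variable m1 : {sigma_finite_measure set T1 -> \bar R}.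
Variable m2 : {sigma_finite_measure set T2 -> \bar R}.

Lemma cL1_swap (f : T1 * T2 -> R[i]) : cL1 (prod_sf m1 m2) f ->
  cL1 (prod_sf m2 m1) (fun z => f (z.2, z.1)).
Proof.
move=> jf; have ms : cmeas (fun z : T2 * T1 => f (z.2, z.1)).
  by apply: (cmeas_comp jf.1); exact: measurable_swap.
split=> //; apply/(integrable12ltyP m2 m1).
  by apply/measurable_EFinP; exact: cmeas_modulus.
have mm : measurable_fun setT (fun z => (cmodulus (f z))%:E).
  by apply/measurable_EFinP; exact/cmeas_modulus/jf.1.
exact: ((integrable21ltyP m1 m2 mm).1 jf.2).
Qed.

Lemma cL1_cint1 (f : T1 * T2 -> R[i]) : cL1 (prod_sf m1 m2) f ->
  cL1 m2 (fun y => cint m1 (fun x => f (x, y))).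
Proof. by move=> /cL1_swap; exact: cL1_cint2. Qed.

End fubini_swap.

(** * Measurability of continuous functions *)

Section caratheodory.
Context {R : realType} {d : measure_display} {T : measurableType d}.
Local Notation mR := (measurableTypeR R).

(** Rounding y down to the grid of step 1/(n+1) gives a function that is measurable as a countable
    union of strips, and continuity in y makes these functions converge to f. *)
Lemma measurable_caratheodory (f : T * mR -> R) :
  (forall t, continuous (fun y : R => f (t, y))) ->
  (forall y, measurable_fun setT (fun t => f (t, y))) ->
  measurable_fun setT f.
Proof.
move=> cf mf.
pose q (n : nat) (z : int) : R := z%:~R / n.+1%:R.
pose fn n (z : T * mR) := f (z.1, q n (Num.floor (n.+1%:R * z.2))).
have n0 n : 0 < n.+1%:R :> R by rewrite ltr0n.
apply: (@measurable_fun_cvg _ _ _ _ fn) => [n|[t y] _].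
  move=> _ A mA; rewrite setTI.
  have -> : fn n @^-1` A = \bigcup_(z : int)
      (((fun t => f (t, q n z)) @^-1` A) `*` `[q n z, q n (z + 1)[%classic).
    apply/seteqP; split => [[t y]/= Afn|[t y]/= [z _ [/= Atz]]].
      exists (Num.floor (n.+1%:R * y)) => //; split => //=.
      by rewrite in_itv/= /q ler_pdivrMr// ltr_pdivlMr// mulrC floor_itv.
    rewrite in_itv/= /q ler_pdivrMr// ltr_pdivlMr// [y * _]mulrC.
    by rewrite -floor_eq /fn/= => /eqP ->.
  apply: countable_bigcupT_measurable; first exact: countableP.
  move=> z; apply: measurableX; last exact: measurable_itv.
  by rewrite -[X in measurable X]setTI; exact: mf.
apply: (@cvg_comp _ _ _ (fun n => q n (Num.floor (n.+1%:R * y))) (fun y => f (t, y)) _ (nbhs y)); last exact: cf.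
apply/cvgrPdist_le => e e0; near=> n.
have /andP[h1 h2] := floor_itv (n.+1%:R * y).
have h3 : 0 <= y - q n (Num.floor (n.+1%:R * y)).
  by rewrite subr_ge0 /q ler_pdivrMr ?n0// [y * _]mulrC.
have h4 : y - q n (Num.floor (n.+1%:R * y)) <= n.+1%:R^-1.
  rewrite lerBlDl -[X in _ <= _ + X]mul1r /q -mulrDl ler_pdivlMr ?n0// [y * _]mulrC ltW//.
  by rewrite (lt_le_trans h2)// intrD.
rewrite ger0_norm// (le_trans h4)//; near: n.
have := near_infty_natSinv_lt (PosNum e0).
by apply: filterS => n /= /ltW.
Unshelve. all: by end_near. Qed.

End caratheodory.

Section euclidean.
Context {R : realType}.
Local Notation mR := (measurableTypeR R).
Local Notation E := (R * R * R)%type.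
Local Notation mE := (mR * mR * mR)%type.
Local Notation coord := (@Defs.coord R).
Local Notation basis := (@Defs.basis R).
Implicit Types (x y z : E) (i j : 'I_3) (f g : E -> R).

Lemma forall_ord3 (P : 'I_3 -> Prop) : P 0 -> P 1 -> P 2%:R -> forall i, P i.
Proof.
move=> P0 P1 P2 i; case: i => -[|[|[|//]]] hi.
- by rewrite (_ : Ordinal hi = 0)//; exact: val_inj.
- by rewrite (_ : Ordinal hi = 1)//; exact: val_inj.
- by rewrite (_ : Ordinal hi = 2%:R)//; exact: val_inj.
Qed.

Lemma coordE x : (coord x 0 = x.1.1) * (coord x 1 = x.1.2) * (coord x 2%:R = x.2).
Proof. by []. Qed.

Lemma sum3 (V : nmodType) (F : 'I_3 -> V) : \sum_(i < 3) F i = F 0 + F 1 + F 2%:R.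
Proof.
rewrite !big_ord_recl big_ord0 addr0 addrA; congr (_ + F _ + F _); exact: val_inj.
Qed.

Lemma coordD x y i : coord (x + y) i = coord x i + coord y i.
Proof. by elim/forall_ord3: i. Qed.

Lemma coordZ (a : R) x i : coord (a *: x) i = a * coord x i.
Proof. by elim/forall_ord3: i. Qed.

Lemma coord_basis i j : coord (basis i) j = (i == j)%:R.
Proof. by elim/forall_ord3: i; elim/forall_ord3: j. Qed.

Lemma dotE x y : dot x y = x.1.1 * y.1.1 + x.1.2 * y.1.2 + x.2 * y.2.
Proof. by rewrite /dot sum3. Qed.

Lemma dotC x y : dot x y = dot y x.
Proof. by rewrite !dotE; ring. Qed.

Lemma dotDl x y z : dot (x + y) z = dot x z + dot y z.
Proof. by rewrite !dotE/=; ring. Qed.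

Lemma dotZl (a : R) x z : dot (a *: x) z = a * dot x z.
Proof. by rewrite !dotE/=; rewrite /GRing.scale/=; ring. Qed.

Lemma dotNl x z : dot (- x) z = - dot x z.
Proof. by rewrite !dotE/=; ring. Qed.

Lemma dot_basis x i : dot (basis i) x = coord x i.
Proof. by rewrite dotE; elim/forall_ord3: i => /=; rewrite coordE; ring. Qed.

Lemma dotxx_ge0 x : 0 <= dot x x.
Proof. by rewrite dotE !addr_ge0// -expr2 sqr_ge0. Qed.

Lemma enorm_sqr x : enorm x ^+ 2 = dot x x.
Proof. by rewrite sqr_sqrtr ?dotxx_ge0. Qed.

Lemma enorm_ge0 x : 0 <= enorm x.
Proof. exact: sqrtr_ge0. Qed.

Lemma coord_le_enorm x i : `|coord x i| <= enorm x.
Proof.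
rewrite -sqrtr_sqr ler_wsqrtr// dotE.
by elim/forall_ord3: i; rewrite coordE; have := sqr_ge0 x.1.1; have := sqr_ge0 x.1.2; have := sqr_ge0 x.2; nra.
Qed.

Lemma enorm_le x : enorm x <= `|x.1.1| + `|x.1.2| + `|x.2|.
Proof.
have h : 0 <= `|x.1.1| + `|x.1.2| + `|x.2| by rewrite !addr_ge0.
rewrite -(@ler_pXn2r _ 2)// ?nnegrE ?enorm_ge0// enorm_sqr dotE.
rewrite -!expr2 -[x.1.1 ^+ 2]real_normK ?num_real// -[x.1.2 ^+ 2]real_normK ?num_real//.
rewrite -[x.2 ^+ 2]real_normK ?num_real//.
by have := normr_ge0 x.1.1; have := normr_ge0 x.1.2; have := normr_ge0 x.2; nra.
Qed.

(** The sigma-algebra on R^3 is the product of those of the factors, so continuity is exploited one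
    coordinate at a time through [measurable_caratheodory]. *)
Lemma continuous_measurable3 f : continuous f -> measurable_fun setT (f : mE -> R).
Proof.
move=> cf; apply: (@measurable_caratheodory _ _ (mR * mR)%type f).
  move=> t y; apply: (@continuous_comp _ _ _ (fun y : R => (t, y)) f).
    exact: (cvg_pair (@cvg_cst _ _ _ _ _) cvg_id).
  exact: cf.
move=> y; apply: (@measurable_caratheodory _ _ mR (fun t => f (t, y))).
  move=> t s; apply: (@continuous_comp _ _ _ (fun s : R => (t, s, y)) f).
    exact: (cvg_pair (cvg_pair (@cvg_cst _ _ _ _ _) cvg_id) (@cvg_cst _ _ _ _ _)).
  exact: cf.
move=> s; apply: continuous_measurable_fun => t.
apply: (@continuous_comp _ _ _ (fun t : R => (t, s, y)) f).
  exact: (cvg_pair (cvg_pair cvg_id (@cvg_cst _ _ _ _ _)) (@cvg_cst _ _ _ _ _)).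
exact: cf.
Qed.

Lemma measurable_coord i : measurable_fun setT (fun x : mE => coord x i).
Proof.
elim/forall_ord3: i => /=; rewrite /coord/=; apply: measurableT_comp => //.
Qed.

Lemma measurable_dot (y : E) : measurable_fun setT (fun x : mE => dot x y).
Proof.
under eq_fun do rewrite dotE.
by apply: measurable_funD; [apply: measurable_funD|]; apply: measurable_funM => //; apply: measurableT_comp.
Qed.

Lemma measurable_dot2 : measurable_fun setT (fun z : mE * mE => dot z.1 z.2).
Proof.
under eq_fun do rewrite dotE.
apply: measurable_funD; [apply: measurable_funD|]; apply: measurable_funM => //; do ?apply: measurableT_comp => //.
Qed.

End euclidean.

(** * Integrable majorants and integration by parts *)

Section integrable_weight.
Context {R : realType}.
Local Notation mR := (measurableTypeR R).
Local Notation E := (R * R * R)%type.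
Local Notation mE := (mR * mR * mR)%type.
Local Notation leb := (@lebesgue_measure R).
Local Notation coord := (@Defs.coord R).
Local Notation basis := (@Defs.basis R).

(** A product of three Cauchy profiles: it is integrable by Tonelli, and a unit shift changes it by
    a bounded factor only. *)
Definition weight (x : E) : R :=
  ((1 + x.1.1 ^+ 2) * (1 + x.1.2 ^+ 2) * (1 + x.2 ^+ 2))^-1.

Lemma onesqr_gt0 (t : R) : 0 < 1 + t ^+ 2.
Proof. by rewrite ltr_pwDl// sqr_ge0. Qed.

Lemma weight_gt0 x : 0 < weight x.
Proof. by rewrite invr_gt0 !mulr_gt0// onesqr_gt0. Qed.

Lemma integrable_oneDsqrV :
  leb.-integrable setT (EFin \o (fun t : R => (1 + t ^+ 2)^-1)).
Proof.
have mf : measurable_fun setT (fun t : mR => (1 + t ^+ 2)^-1).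
  exact: continuous_measurable_fun continuous_oneDsqrV.
apply/integrableP; split; first exact/measurable_EFinP.
under eq_integral do rewrite /= ger0_norm ?invr_ge0 ?ltW ?onesqr_gt0//.
rewrite (@ge0_symfun_integralT _ (fun t : R => (1 + t ^+ 2)^-1)).
- rewrite (_ : [set x | 0 <= x] = `[0, +oo[%classic); last first.
    by apply/seteqP; split => x/=; rewrite in_itv/= andbT.
  by rewrite [X in (_ * X)%E]integral0y_oneDsqr -EFinM ltry.
- by move=> x; rewrite invr_ge0 ltW// onesqr_gt0.
- exact: continuous_oneDsqrV.
- by move=> x/=; rewrite sqrrN.
Qed.

Lemma measurable_weight : measurable_fun setT (weight : mE -> R).
Proof.
have mf : measurable_fun setT (fun t : mR => (1 + t ^+ 2)^-1).
  exact: continuous_measurable_fun continuous_oneDsqrV.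
rewrite /weight; under eq_fun do rewrite !invfM.
by apply: measurable_funM; [apply: measurable_funM|]; apply: (measurableT_comp mf) => //; apply: measurableT_comp.
Qed.

Lemma integrable_weight : leb3.-integrable setT (EFin \o weight).
Proof.
have mf : measurable_fun setT (fun t : mR => (1 + t ^+ 2)^-1).
  exact: continuous_measurable_fun continuous_oneDsqrV.
have [r [r0 hr]] : exists r : R, 0 <= r /\ (\int[leb]_t ((1 + t ^+ 2)^-1)%:E = r%:E)%E.
  exists (fine (\int[leb]_t ((1 + t ^+ 2)^-1)%:E)%E); split.
    by apply: fine_ge0; apply: integral_ge0 => t _; rewrite lee_fin invr_ge0 ltW// onesqr_gt0.
  by rewrite fineK// (integrable_fin_num measurableT integrable_oneDsqrV).
have V0 t : 0 <= (1 + t ^+ 2 : R)^-1 by rewrite invr_ge0 ltW// onesqr_gt0.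
apply/integrableP; split; first by apply/measurable_EFinP; exact: measurable_weight.
rewrite leb3_iter//; last first.
  by apply: measurableT_comp => //; apply/measurable_EFinP; exact: measurable_weight.
have h1 u v : (\int[leb]_c `|(weight (u, v, c))%:E| =
    ((1 + u ^+ 2)^-1 * (1 + v ^+ 2)^-1)%:E * r%:E)%E.
  rewrite -hr -ge0_integralZl//; last by rewrite lee_fin mulr_ge0.
    by apply: eq_integral => c _; rewrite abse_EFin gtr0_norm ?weight_gt0// /weight/= !invfM.
    exact/measurable_EFinP.
  by move=> c _; rewrite lee_fin.
have h2 u : (\int[leb]_v \int[leb]_c `|(weight (u, v, c))%:E| =
    ((1 + u ^+ 2)^-1)%:E * (r * r)%:E)%E.
  transitivity (\int[leb]_v (((1 + u ^+ 2)^-1 * r)%:E * ((1 + v ^+ 2)^-1)%:E))%E.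
    by apply: eq_integral => v _; rewrite h1 -!EFinM; congr EFin; ring.
  rewrite (@ge0_integralZl _ _ _ leb setT measurableT)//.
  - by rewrite hr -!EFinM mulrA.
  - exact/measurable_EFinP.
  - by move=> v _; rewrite lee_fin.
  - by rewrite lee_fin mulr_ge0.
rewrite (_ : (\int[leb]_a _)%E = (r * r * r)%:E) ?ltry//.
transitivity (\int[leb]_u ((r * r)%:E * ((1 + u ^+ 2)^-1)%:E))%E.
  by apply: eq_integral => u _; rewrite [LHS]h2 muleC.
rewrite (@ge0_integralZl _ _ _ leb setT measurableT)//.
- by rewrite hr.
- exact/measurable_EFinP.
- by move=> v _; rewrite lee_fin.
- by rewrite lee_fin mulr_ge0.
Qed.

Definition dominated (f : E -> R) := exists C, forall x, `|f x| <= C * weight x.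

Lemma dominated_integrable f : measurable_fun setT (f : mE -> R) -> dominated f ->
  leb3.-integrable setT (EFin \o f).
Proof.
move=> mf [C hC]; apply: le_integrable (integrableZl measurableT C integrable_weight) => //.
  exact/measurable_EFinP.
move=> x _ /=; rewrite lee_fin (le_trans (hC x))//.
by rewrite ler_norm.
Qed.

(** This turns a bound on a derivative into a bound, uniform in the step, on the difference
    quotients, whose mean value points are shifted by at most 1. *)
Lemma weight_shift (x : E) (t : R) j : `|t| <= 1 ->
  weight (x + t *: basis j) <= 3 * weight x.
Proof.
move=> t1; have key (a : R) : (1 + (a + t) ^+ 2)^-1 <= 3 * (1 + a ^+ 2)^-1.
  rewrite -[3]invrK -invfM lef_pV2 ?posrE ?mulr_gt0 ?onesqr_gt0 ?invr_gt0//.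
  rewrite mulrC ler_pdivrMr//.
  have t2 : t ^+ 2 <= 1 by rewrite -[t ^+ 2]real_normK ?num_real// expr_le1.
  have := sqr_ge0 (a + 2 * t); nra.
have V0 (a : R) : 0 <= (1 + a ^+ 2 : R)^-1 by rewrite invr_ge0 ltW// onesqr_gt0.
rewrite /weight !invfM; elim/forall_ord3: j => /=; rewrite !scaler0 ?addr0 /GRing.scale/= mulr1.
- have := key x.1.1; have := mulr_ge0 (V0 x.1.2) (V0 x.2); nra.
- have := key x.1.2; have := mulr_ge0 (V0 x.1.1) (V0 x.2); nra.
- have := key x.2; have := mulr_ge0 (V0 x.1.1) (V0 x.1.2); nra.
Qed.

(** The exponent is 6 = 3 * 2: each of the three factors 1 + x_i^2 of [weight] is at most (1 +
    |x|)^2. *)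
Lemma decay_dominated (f : E -> R) M :
  (forall x, (1 + enorm x) ^+ 6 * `|f x| <= M) -> dominated f.
Proof.
move=> hM; exists M => x; rewrite /weight ler_pdivlMr; last by rewrite !mulr_gt0// onesqr_gt0.
apply: le_trans (hM x); rewrite mulrC; apply: ler_wpM2r => //.
have key i : 1 + coord x i ^+ 2 <= (1 + enorm x) ^+ 2.
  have h := coord_le_enorm x i.
  have : `|coord x i| ^+ 2 <= enorm x ^+ 2 by rewrite ler_sqr ?nnegrE ?enorm_ge0.
  by rewrite real_normK ?num_real//; have := enorm_ge0 x; nra.
have := key 0; have := key 1; have := key 2%:R; rewrite !coordE => k2 k1 k0.
have k01 := ler_pM (ltW (onesqr_gt0 _)) (ltW (onesqr_gt0 _)) k0 k1.
have := ler_pM (mulr_ge0 (ltW (onesqr_gt0 _)) (ltW (onesqr_gt0 _))) (ltW (onesqr_gt0 _)) k01 k2.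
by rewrite -!exprD.
Qed.

Lemma affine1_basis (x : E) (t : R) j : aff 1 (t *: basis j) x = x + t *: basis j.
Proof. by rewrite /aff !mul1r; case: x => -[]. Qed.

Lemma is_derive_line (f : E -> R) (x v : E) (t : R) :
  derivable f (x + t *: v) v ->
  is_derive t 1 (fun s : R => f (x + s *: v)) ('D_v f (x + t *: v)).
Proof.
move=> df.
have e : (fun h : R => h^-1 *: (((fun s : R => f (x + s *: v)) \o shift t) (h *: 1) - f (x + t *: v))) =
    (fun h => h^-1 *: ((f \o shift (x + t *: v)) (h *: v) - f (x + t *: v))).
  apply/funext => h /=; congr (_ *: (f _ - _)).
  by rewrite [h *: 1]mulr1 scalerDl addrCA.
by split; rewrite /derivable /derive e.
Qed.

(** By translation invariance every difference quotient has integral 0. The mean value theorem and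
    [weight_shift] dominate the quotients, so the limit can be taken under the integral. *)
Lemma integral_derive0 (f : E -> R) j :
  (forall x, differentiable f x) -> dominated f -> dominated ('D_(basis j) f) ->
  leb3.-integrable setT (EFin \o ('D_(basis j) f : mE -> R)) /\
  \int[leb3]_x 'D_(basis j) f x = 0.
Proof.
move=> df domf [C hC].
pose h (n : nat) : R := n.+1%:R^-1.
have h0 n : 0 < h n by rewrite invr_gt0.
have h1 n : h n <= 1 by rewrite invf_le1 ?ltr0n// ler1n.
pose g n x := (h n)^-1 * (f (x + h n *: basis j) - f x).
have mf : measurable_fun setT (f : mE -> R).
  by apply: continuous_measurable3 => x; exact: differentiable_continuous.
have mfs n : measurable_fun setT (fun x : mE => f (x + h n *: basis j)).
  have := measurableT_comp mf (measurable_aff (h n *: basis j) 1).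
  by congr measurable_fun; apply/funext => x /=; rewrite affine1_basis.
have gD x : (fun n => g n x) @ \oo --> 'D_(basis j) f x.
  have : derivable f x (basis j) by exact: diff_derivable.
  move=> /cvg_ex[l hl]; rewrite /derive (cvg_lim _ hl)//.
  have /cvgr_dnbhsP/(_ h) := hl.
  have hh : (forall n, h n != 0) /\ h n @[n --> \oo] --> 0.
    by split; [move=> n; rewrite gt_eqF|exact: cvg_harmonic].
  move=> /(_ hh); apply: cvg_trans; apply: near_eq_cvg; apply: nearW => n.
  by rewrite /g/= [h n *: _ + x]addrC.
have mg n : measurable_fun setT (g n : mE -> R).
  by apply: measurable_funM => //; apply: measurable_funB.
have gC n x : `|g n x| <= 3 * C * weight x.
  have dl (t : R) : is_derive t 1 (fun t : R => f (x + t *: basis j)) ('D_(basis j) f (x + t *: basis j)).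
    by apply: is_derive_line; exact: diff_derivable.
  have [||c] := @MVT_segment R (fun t => f (x + t *: basis j)) (fun t => 'D_(basis j) f (x + t *: basis j)) 0 (h n).
  - exact: ltW.
  - apply: derivable_within_continuous => t _; exact: ex_derive.
  rewrite in_itv/= => /andP[c0 c1]; rewrite scale0r addr0 subr0 => e.
  rewrite /g e mulrCA mulVf ?gt_eqF// mulr1 (le_trans (hC _))//.
  rewrite [3 * C]mulrC -mulrA; apply: ler_wpM2l; last first.
    by apply: weight_shift; rewrite ger0_norm// (le_trans c1).
  have := le_trans (normr_ge0 _) (hC 0); rewrite pmulr_lge0//; exact: weight_gt0.
have jf := dominated_integrable mf domf.
have gint n : \int[leb3]_x g n x = 0.
  have [js e] := rint_affine (h n *: basis j) ltr01 jf.
  have {}js : leb3.-integrable setT (EFin \o (fun x : mE => f (x + h n *: basis j))).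
    by move: js; congr (_.-integrable _ _); apply/funext => x /=; rewrite affine1_basis.
  rewrite /g RintegralZl//; last by apply: eq_integrable (integrableB measurableT js jf).
  rewrite RintegralB//.
  rewrite e expr1n mul1r; under [X in X - _]eq_Rintegral do rewrite -affine1_basis.
  by rewrite subrr mulr0.
have mD : measurable_fun setT ('D_(basis j) f : mE -> R).
  by apply: (@measurable_fun_cvg _ _ _ _ g) => // x _; exact: gD.
split; first by apply: dominated_integrable => //; exists C.
have := rint_dominated mg gD (integrableZl measurableT (3 * C) integrable_weight) gC.
under eq_fun do rewrite gint.
by move=> /(cvg_lim (@Rhausdorff R)); rewrite lim_cst.
Qed.

End integrable_weight.

(** * Schwartz functions and the Fourier transform *)

Section schwartz_functions.
Context {R : realType}.
Local Notation mR := (measurableTypeR R).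
Local Notation E := (R * R * R)%type.
Local Notation mE := (mR * mR * mR)%type.
Local Notation coord := (@Defs.coord R).
Local Notation basis := (@Defs.basis R).
Implicit Types (f g : E -> R) (i j : 'I_3) (s : seq 'I_3).

Definition sch f := smooth f /\
  forall s (m : nat), exists M : R, forall x, (1 + enorm x) ^+ m * `|pderivs s f x| <= M.

Lemma pderivs_rcons s j f : pderivs (rcons s j) f = pderivs s ('D_(basis j) f).
Proof. by rewrite /pderivs foldr_rcons. Qed.

Lemma smooth_differentiable f x : smooth f -> differentiable f x.
Proof. by move=> /(_ [::]). Qed.

Lemma smooth_derive f j : smooth f -> smooth ('D_(basis j) f).
Proof. by move=> sf s x; rewrite -pderivs_rcons. Qed.

Lemma sch_derive f j : sch f -> sch ('D_(basis j) f).
Proof.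
move=> [sf df]; split; first exact: smooth_derive.
by move=> s m; have [M hM] := df (rcons s j) m; exists M => x; rewrite -pderivs_rcons.
Qed.

Lemma sch_differentiable f x : sch f -> differentiable f x.
Proof. by case=> sf _; exact: smooth_differentiable. Qed.

Lemma sch_dominated f : sch f -> dominated f.
Proof. by case=> _ /(_ [::] 6%N)[M hM]; exact: decay_dominated hM. Qed.

Lemma sch_measurable f : sch f -> measurable_fun setT (f : mE -> R).
Proof.
by move=> sf; apply: continuous_measurable3 => x; apply: differentiable_continuous; exact: sch_differentiable.
Qed.

Lemma sch_integrable f : sch f -> leb3.-integrable setT (EFin \o (f : mE -> R)).
Proof. by move=> sf; apply: dominated_integrable; [exact: sch_measurable|exact: sch_dominated]. Qed.

Lemma coord_continuous i : continuous (fun y => coord y i).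
Proof.
elim/forall_ord3: i => u; rewrite /Defs.coord/=.
- by apply: (@cvg_comp _ _ _ (fst : E -> R * R) fst _ (nbhs u.1)); exact: cvg_fst.
- by apply: (@cvg_comp _ _ _ (fst : E -> R * R) snd _ (nbhs u.1)); [exact: cvg_fst|exact: cvg_snd].
- exact: cvg_snd.
Qed.

Lemma coord_differentiable i x : differentiable (fun y => coord y i) x.
Proof.
have lin : linear (fun y => coord y i) by move=> a u v; rewrite coordD coordZ.
pose L := GRing.isLinear.Build _ _ _ _ _ lin.
pose F : {linear E -> R} := HB.pack (fun y => coord y i) L.
exact: (@linear_differentiable R E R F x (@coord_continuous i)).
Qed.

Lemma derive_coord i v x : 'D_v (fun y => coord y i) x = coord v i.
Proof.
apply: cvg_lim => //; apply: cvg_near_cst.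
near=> h; rewrite /= coordD coordZ addrK /GRing.scale/= mulrA mulVf ?mul1r//.
near: h; exact: nbhs_dnbhs_neq.
Unshelve. all: by end_near. Qed.

Lemma derive_addE f g x v : derivable f x v -> derivable g x v ->
  'D_v (fun y => f y + g y) x = 'D_v f x + 'D_v g x.
Proof. exact: deriveD. Qed.

Lemma derive_mulE f g x v : derivable f x v -> derivable g x v ->
  'D_v (fun y => f y * g y) x = f x * 'D_v g x + g x * 'D_v f x.
Proof. exact: deriveM. Qed.

(* [leibniz j s] lists the derivatives that Leibniz' rule produces besides [coord j * d^s f]. *)
Fixpoint leibniz j s : seq (seq 'I_3) :=
  if s is i :: s' then (if i == j then [:: s'] else [::]) ++ map (cons i) (leibniz j s') else [::].

Lemma pderivs_coordM j s f : smooth f ->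
  pderivs s (fun x => coord x j * f x) =
  (fun x => coord x j * pderivs s f x + \sum_(t <- leibniz j s) pderivs t f x).
Proof.
move=> sf; elim: s => [|i s IH]; first by apply/funext => x /=; rewrite big_nil addr0.
rewrite /= -/(pderivs s _) IH; apply/funext => x.
have d1 : derivable (fun x => coord x j * pderivs s f x) x (basis i).
  by apply: derivableM; apply: diff_derivable; [exact: coord_differentiable|exact: sf].
have dS (r : seq (seq 'I_3)) : differentiable (fun x => \sum_(t <- r) pderivs t f x) x /\
    'D_(basis i) (fun x => \sum_(t <- r) pderivs t f x) x = \sum_(t <- map (cons i) r) pderivs t f x.
  elim: r => [|t r [h1 h2]].
    under eq_fun do rewrite big_nil; rewrite big_nil; split; first exact: differentiable_cst.
    exact: derive_cst.
  under eq_fun do rewrite big_cons; split; first by apply: differentiableD => //; exact: sf.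
  rewrite big_cons -h2 derive_addE//; apply: diff_derivable => //; exact: sf.
rewrite derive_addE//; last by apply: diff_derivable; have [] := dS (leibniz j s).
rewrite (dS _).2 derive_mulE; last 2 first.
- by apply: diff_derivable; exact: coord_differentiable.
- by apply: diff_derivable; exact: sf.
rewrite derive_coord coord_basis big_cat/= -addrA; congr (_ + _).
congr (_ + _).
by case: (i == j); rewrite ?big_seq1 ?big_nil ?mulr1 ?mulr0.
Qed.

Lemma smooth_coordM j f : smooth f -> smooth (fun x => coord x j * f x).
Proof.
move=> sf s x; rewrite pderivs_coordM//; apply: differentiableD.
  by apply: differentiableM; [exact: coord_differentiable|exact: sf].
elim: (leibniz j s) => [|t r IH].
  by under eq_fun do rewrite big_nil; exact: differentiable_cst.
by under eq_fun do rewrite big_cons; apply: differentiableD => //; exact: sf.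
Qed.

Lemma sch_coordM j f : sch f -> sch (fun x => coord x j * f x).
Proof.
move=> [sf df]; split; first exact: smooth_coordM.
move=> s m; rewrite pderivs_coordM//.
have [M1 h1] := df s m.+1.
have [M2 h2] : exists M, forall x, (1 + enorm x) ^+ m * `|\sum_(t <- leibniz j s) pderivs t f x| <= M.
  elim: (leibniz j s) => [|t r [M IH]].
    by exists 0 => x; rewrite big_nil normr0 mulr0.
  have [N hN] := df t m; exists (N + M) => x; rewrite big_cons.
  apply: le_trans (lerD (hN x) (IH x)); rewrite -mulrDr; apply: ler_wpM2l; last exact: ler_normD.
  by rewrite exprn_ge0// addr_ge0// enorm_ge0.
exists (M1 + M2) => x; apply: le_trans (lerD (h1 x) (h2 x)).
have p0 : 0 <= (1 + enorm x) ^+ m by rewrite exprn_ge0// addr_ge0// enorm_ge0.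
rewrite exprSr -mulrA -mulrDr; apply: ler_wpM2l => //.
rewrite (le_trans (ler_normD _ _))// lerD2r normrM; apply: ler_wpM2r => //.
by rewrite (le_trans (coord_le_enorm _ _))// lerDr.
Qed.

End schwartz_functions.

Section fourier_integrals.
Context {R : realType}.
Local Open Scope complex_scope.
Local Notation C := R[i].
Local Notation mR := (measurableTypeR R).
Local Notation E := (R * R * R)%type.
Local Notation mE := (mR * mR * mR)%type.
Local Notation coord := (@Defs.coord R).
Local Notation basis := (@Defs.basis R).
Implicit Types (f : E -> R) (h : E -> C) (s : R) (x y : E) (i j : 'I_3).

(** The sign s is -1 for [fourier] and 1 for [inv_fourier] (up to (2 pi)^-3), so that each fact is
    proved once for both. *)
Definition FT s h y : C := cint leb3 (fun x : mE => h x * cis (s * dot x y)).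

Lemma cmeas_cis_dot s y : cmeas (fun x : mE => cis (s * dot x y)).
Proof. by apply: cmeas_cis; apply: measurable_funM => //; exact: measurable_dot. Qed.

Lemma cL1_cis s y h : cL1 leb3 (h : mE -> C) -> cL1 leb3 (fun x : mE => h x * cis (s * dot x y)).
Proof.
move=> jh; under eq_fun do rewrite mulrC.
apply: (@cL1M_bounded _ _ _ _ _ _ 1) => //; first exact: cmeas_cis_dot.
by move=> x; rewrite cmodulus_cis.
Qed.

Lemma FT_bound s h y : cL1 leb3 (h : mE -> C) ->
  cmodulus (FT s h y) <= \int[leb3]_x cmodulus (h x).
Proof.
move=> jh; rewrite (le_trans (cmodulus_cint_le (cL1_cis s y jh)))//.
by under eq_Rintegral do rewrite cmodulusM cmodulus_cis mulr1.
Qed.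

Lemma FTD s g h y : cL1 leb3 (g : mE -> C) -> cL1 leb3 (h : mE -> C) ->
  FT s (fun x => g x + h x) y = FT s g y + FT s h y.
Proof.
move=> jg jh; rewrite /FT; under eq_cint do rewrite mulrDl.
by rewrite cintD//; exact: cL1_cis.
Qed.

Lemma FTZ s (c : C) h y : cL1 leb3 (h : mE -> C) ->
  FT s (fun x => c * h x) y = c * FT s h y.
Proof.
move=> jh; rewrite /FT; under eq_cint do rewrite -mulrA.
by rewrite cintZ//; exact: cL1_cis.
Qed.

Lemma dominatedM_bounded f (k : E -> R) (B : R) : dominated f -> (forall x, `|k x| <= B) ->
  dominated (fun x => k x * f x).
Proof.
move=> [D hD] kB; exists (B * D) => x; rewrite normrM -mulrA.
by apply: ler_pM.
Qed.

Lemma dominatedD f g : dominated f -> dominated g -> dominated (fun x => f x + g x : R).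
Proof.
move=> [D hD] [D' hD']; exists (D + D') => x.
by rewrite (le_trans (ler_normD _ _))// mulrDl lerD.
Qed.

Lemma dominated_eq f g : dominated f -> f =1 g -> dominated g.
Proof. by move=> df /funext <-. Qed.

Lemma diff_comp1 f (k dk : R -> R) x v : differentiable f x -> is_derive (f x) 1 k (dk (f x)) ->
  differentiable (k \o f) x /\ 'D_v (k \o f) x = dk (f x) * 'D_v f x.
Proof.
move=> df [kd ke].
have dk1 : differentiable k (f x) by exact/derivable1_diffP.
split; first exact: differentiable_comp.
rewrite deriveE; last exact: differentiable_comp.
rewrite diff_comp//= deriveE// deriv1E//= derive1E ke.
by rewrite mulrC.
Qed.

Lemma differentiable_dot s y x : differentiable (fun x => s * dot x y) x.
Proof.
rewrite (_ : (fun x => _) = (fun x => s * coord y 0 * coord x 0 + s * coord y 1 * coord x 1 + s * coord y 2%:R * coord x 2%:R)).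
  by apply: differentiableD; [apply: differentiableD|]; apply: differentiableM; do ?exact: coord_differentiable; exact: differentiable_cst.
by apply/funext => z; rewrite dotE !coordE; ring.
Qed.

Lemma derive_dot s y x v : 'D_v (fun x => s * dot x y) x = s * dot v y.
Proof.
apply: cvg_lim => //; apply: cvg_near_cst.
near=> h; rewrite /= dotDl dotZl mulrDr addrK /GRing.scale/= mulrCA (mulrA h^-1) mulVf ?mul1r//.
near: h; exact: nbhs_dnbhs_neq.
Unshelve. all: by end_near. Qed.

(** Integration by parts: [integral_derive0] is applied to the product of f with the cosine and with
    the sine separately ([key]), and the two results are the real and imaginary parts. *)
Lemma FT_derive s f j y : (forall x, differentiable f x) -> dominated f ->
  dominated ('D_(basis j) f) ->
  FT s (fun x => ('D_(basis j) f x)%:C) y = (0 -i* (s * coord y j)) * FT s (fun x => (f x)%:C) y.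
Proof.
move=> df domf domD.
pose c x := cos (s * dot x y); pose c' x := sin (s * dot x y).
have cb x : `|c x| <= 1 by rewrite ler_norml cos_geN1 cos_le1.
have sb x : `|c' x| <= 1 by rewrite ler_norml sin_geN1 sin_le1.
have dc x : differentiable c x /\ 'D_(basis j) c x = - (s * coord y j) * c' x.
  have [h1 h2] := @diff_comp1 _ cos (fun t => - sin t) x (basis j) (differentiable_dot s y x) (is_derive_cos _).
  by split => //; rewrite h2 derive_dot dot_basis mulNr mulrC mulNr.
have ds x : differentiable c' x /\ 'D_(basis j) c' x = (s * coord y j) * c x.
  have [h1 h2] := @diff_comp1 _ sin cos x (basis j) (differentiable_dot s y x) (is_derive_sin _).
  by split => //; rewrite h2 derive_dot dot_basis mulrC.
have mc : measurable_fun setT (c : mE -> R) by apply: continuous_measurable3 => x; apply: differentiable_continuous; exact: (dc x).1.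
have mc' : measurable_fun setT (c' : mE -> R) by apply: continuous_measurable3 => x; apply: differentiable_continuous; exact: (ds x).1.
have mf : measurable_fun setT (f : mE -> R) by apply: continuous_measurable3 => x; exact: differentiable_continuous.
have mD : measurable_fun setT ('D_(basis j) f : mE -> R).
  have [+ _] := integral_derive0 df domf domD.
  by move=> /(measurable_int leb3)/measurable_EFinP.
have J k g : measurable_fun setT (k : mE -> R) -> measurable_fun setT (g : mE -> R) ->
  (forall x, `|k x| <= 1) -> dominated g -> leb3.-integrable setT (EFin \o (fun x : mE => k x * g x)).
  move=> mk mg kb domg; apply: dominated_integrable; first exact: measurable_funM.
  exact: dominatedM_bounded kb.
have key (k : E -> R) (r : R) (g : E -> R) : (forall x, differentiable k x) -> (forall x, 'D_(basis j) k x = r * g x) ->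
    measurable_fun setT (k : mE -> R) -> measurable_fun setT (g : mE -> R) ->
    (forall x, `|k x| <= 1) -> (forall x, `|g x| <= 1) ->
    \int[leb3]_x (k x * 'D_(basis j) f x) = - (r * \int[leb3]_x (g x * f x)).
  move=> dk1 dk2 mk mg kb gb.
  have De x : 'D_(basis j) (fun x => k x * f x) x = k x * 'D_(basis j) f x + r * (g x * f x).
    rewrite derive_mulE; [|exact: diff_derivable..].
    by rewrite dk2 [f x * _]mulrC mulrA.
  have dd : dominated ('D_(basis j) (fun x => k x * f x)).
    apply: (dominated_eq _ (fun x => esym (De x))).
    apply: dominatedD; first exact: dominatedM_bounded kb.
    have rb (x : E) : `|(fun=> r) x| <= `|r| by [].
    by apply: dominatedM_bounded rb; exact: dominatedM_bounded gb.
  have [] := @integral_derive0 _ (fun x => k x * f x) j.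
  - by move=> x; exact: differentiableM.
  - exact: dominatedM_bounded kb.
  - exact: dd.
  move=> _; under eq_Rintegral do rewrite De.
  rewrite RintegralD//; [|exact: J|]; last first.
    by apply: eq_integrable (integrableZl _ r (J _ _ mg mf gb domf)).
  by rewrite RintegralZl//; [move/eqP; rewrite addr_eq0 => /eqP|exact: J].
have kc := key c (- (s * coord y j)) c' (fun x => (dc x).1) (fun x => (dc x).2) mc mc' cb sb.
have ks := key c' (s * coord y j) c (fun x => (ds x).1) (fun x => (ds x).2) mc' mc sb cb.
apply: eq_cplx => /=.
  rewrite mul0r add0r; under eq_Rintegral do rewrite mul0r subr0 mulrC.
  rewrite kc; under [in RHS]eq_Rintegral do rewrite mul0r addr0 mulrC.
  by rewrite /c'; ring.
rewrite mul0r add0r; under eq_Rintegral do rewrite mul0r addr0 mulrC.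
rewrite ks; under [in RHS]eq_Rintegral do rewrite mul0r subr0 mulrC.
by rewrite /c; ring.
Qed.

(** Derivatives yield decay in one coordinate at a time; this collects it into decay in |y|. The
    factor 4 comes from bounding a sum of four terms by four times the largest. *)
Lemma pow_enorm_le (m : nat) (y : E) :
  (1 + enorm y) ^+ m <= 4 ^+ m * (1 + `|coord y 0| ^+ m + `|coord y 1| ^+ m + `|coord y 2%:R| ^+ m).
Proof.
rewrite !coordE; set a : R := `|y.1.1|; set b : R := `|y.1.2|; set c : R := `|y.2|.
have [a0 b0 c0] : [/\ 0 <= a, 0 <= b & 0 <= c] by split; exact: normr_ge0.
have h : 1 + enorm y <= 1 + a + b + c by rewrite -!addrA lerD2l !addrA enorm_le.
have [M [M0 hM hMm]] : exists M, [/\ 0 <= M, 1 + a + b + c <= 4 * M & M ^+ m <= 1 + a ^+ m + b ^+ m + c ^+ m].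
  have am := exprn_ge0 m a0; have bm := exprn_ge0 m b0; have cm := exprn_ge0 m c0.
  exists (Num.max (Num.max 1 a) (Num.max b c)); split.
  - by rewrite !le_max ler01.
  - have h1 : 1 <= Num.max (Num.max 1 a) (Num.max b c) by rewrite !le_max lexx.
    have h2 : a <= Num.max (Num.max 1 a) (Num.max b c) by rewrite !le_max lexx orbT.
    have h3 : b <= Num.max (Num.max 1 a) (Num.max b c) by rewrite !le_max lexx !orbT.
    have h4 : c <= Num.max (Num.max 1 a) (Num.max b c) by rewrite !le_max lexx !orbT.
    lra.
  - by rewrite /Num.max; do !case: ifP => _; rewrite ?expr1n; lra.
have e0 : 0 <= 1 + enorm y by rewrite addr_ge0// enorm_ge0.
rewrite (le_trans (lerXn2r m _ _ (le_trans h hM))) ?nnegrE ?mulr_ge0//.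
by rewrite exprMn ler_wpM2l// exprn_ge0.
Qed.

Lemma cL1_sch f : sch f -> cL1 leb3 (fun x : mE => (f x)%:C).
Proof. by move=> sf; apply: cL1_real; exact: sch_integrable. Qed.

Lemma FT_sch_derive s f j y : sch f ->
  FT s (fun x => ('D_(basis j) f x)%:C) y = (0 -i* (s * coord y j)) * FT s (fun x => (f x)%:C) y.
Proof.
move=> sf; apply: FT_derive; [by move=> x; exact: sch_differentiable|exact: sch_dominated|].
exact/sch_dominated/sch_derive.
Qed.

Lemma FT_sch_decay s f (m : nat) : s ^+ 2 = 1 -> sch f ->
  exists M, forall y, (1 + enorm y) ^+ m * cmodulus (FT s (fun x => (f x)%:C) y) <= M.
Proof.
move=> s1 sf.
have key n j g : sch g -> exists M, forall y, `|coord y j| ^+ n * cmodulus (FT s (fun x => (g x)%:C) y) <= M.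
  elim: n g => [|n IH] g sg.
    exists (\int[leb3]_x cmodulus (g x)%:C) => y; rewrite mul1r.
    exact/FT_bound/cL1_sch.
  have [M hM] := IH _ (sch_derive j sg); exists M => y.
  apply: le_trans (hM y); rewrite exprSr -mulrA FT_sch_derive// cmodulusM.
  rewrite (_ : cmodulus (0 -i* _) = `|coord y j|)//.
  rewrite /cmodulus/= expr0n add0r sqrrN exprMn s1 mul1r sqrtr_sqr//.
have [M0 h0] := key 0%N 0 f sf.
have [M1 h1] := key m 0 f sf; have [M2 h2] := key m 1 f sf; have [M3 h3] := key m 2%:R f sf.
exists (4 ^+ m * (M0 + M1 + M2 + M3)) => y.
apply: le_trans (ler_wpM2r (cmodulus_ge0 _) (pow_enorm_le m y)) _.
rewrite -mulrA ler_wpM2l ?exprn_ge0// !mulrDl.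
by rewrite !lerD//; have := h0 y; rewrite expr0.
Qed.

End fourier_integrals.

(** * Differentiation under the Fourier integral *)

Section differentiating_fourier_integrals.
Context {R : realType}.
Local Open Scope complex_scope.
Local Notation C := R[i].
Local Notation mR := (measurableTypeR R).
Local Notation E := (R * R * R)%type.
Local Notation mE := (mR * mR * mR)%type.
Local Notation coord := (@Defs.coord R).
Local Notation basis := (@Defs.basis R).
Implicit Types (a b : E -> R) (h : E -> C) (s : R) (x y v : E) (i j : 'I_3).

Lemma cos_sub1_le (t : R) : `|cos t - 1| <= `|t|.
Proof.
wlog t0 : t / 0 <= t.
  move=> H; have [/H//|t0] := leP 0 t; rewrite -cosN -[in leRHS]normrN; apply: H.
  by rewrite oppr_ge0 ltW.
have [|c _] := @MVT_segment R cos (fun t => - sin t) 0 t t0 _ _.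
  by apply: derivable_within_continuous => u _; exact: ex_derive.
rewrite cos0 subr0 => ->; rewrite normrM normrN ler_piMl//.
by rewrite ler_norml sin_geN1 sin_le1.
Qed.

Lemma sin_sub_le (t : R) : `|sin t - t| <= t ^+ 2.
Proof.
wlog t0 : t / 0 <= t.
  move=> H; have [/H//|t0] := leP 0 t; rewrite -sqrrN.
  rewrite (_ : `|sin t - t| = `|sin (- t) - - t|) ?H ?oppr_ge0 ?ltW//.
  by rewrite -normrN sinN; congr `|_|; ring.
have [|c] := @MVT_segment R (fun t => sin t - t) (fun t => cos t - 1) 0 t t0 _ _.
  by apply: derivable_within_continuous => u _; exact: ex_derive.
rewrite in_itv/= => /andP[c0 ct]; rewrite sin0 !subr0 => ->.
rewrite normrM expr2 (ger0_norm t0) ler_wpM2r// (le_trans (cos_sub1_le _))//.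
by rewrite ger0_norm.
Qed.

Lemma cos_sub1_sq (t : R) : `|cos t - 1| <= t ^+ 2.
Proof.
wlog t0 : t / 0 <= t.
  by move=> H; have [/H//|t0] := leP 0 t; rewrite -cosN -sqrrN; apply: H; rewrite oppr_ge0 ltW.
have [|c] := @MVT_segment R cos (fun t => - sin t) 0 t t0 _ _.
  by apply: derivable_within_continuous => u _; exact: ex_derive.
rewrite in_itv/= => /andP[c0 ct]; rewrite cos0 subr0 => ->.
rewrite normrM normrN expr2 (ger0_norm t0) ler_wpM2r//.
have [|d _] := @MVT_segment R sin cos 0 c c0 _ _.
  by apply: derivable_within_continuous => u _; exact: ex_derive.
rewrite sin0 !subr0 => ->; rewrite normrM (ger0_norm c0) (le_trans _ ct)//.
by rewrite ler_piMl// ler_norml cos_geN1 cos_le1.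
Qed.

Lemma trig_remainder (al be : R) :
  `|cos (al + be) - cos al + be * sin al| <= 2 * be ^+ 2 /\
  `|sin (al + be) - sin al - be * cos al| <= 2 * be ^+ 2.
Proof.
have c1 : `|cos al| <= 1 by rewrite ler_norml cos_geN1 cos_le1.
have s1 : `|sin al| <= 1 by rewrite ler_norml sin_geN1 sin_le1.
have aux (p q u w : R) : `|p| <= 1 -> `|q| <= 1 -> `|u| <= be ^+ 2 -> `|w| <= be ^+ 2 ->
    `|p * u + q * w| <= 2 * be ^+ 2.
  move=> p1 q1 hu hw; rewrite (le_trans (ler_normD _ _))// !normrM.
  have := ler_pM (normr_ge0 _) (normr_ge0 _) p1 hu.
  have := ler_pM (normr_ge0 _) (normr_ge0 _) q1 hw; lra.
split.
  rewrite cosD (_ : _ - _ + _ = cos al * (cos be - 1) + (- sin al) * (sin be - be)); last by ring.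
  by apply: aux; rewrite ?normrN//; [exact: cos_sub1_sq|exact: sin_sub_le].
rewrite sinD (_ : _ - _ - _ = sin al * (cos be - 1) + cos al * (sin be - be)); last by ring.
by apply: aux; rewrite ?normrN//; [exact: cos_sub1_sq|exact: sin_sub_le].
Qed.

(** Both the real and the imaginary part of [FT s h] have this shape ([FT_ReE], [FT_ImE]), as do
    their derivatives. *)
Definition trigint s a b y := \int[leb3]_(x in setT) (a x * cos (s * dot x y) + b x * sin (s * dot x y)).

(** Six powers make the function integrable ([decay_dominated]); two more absorb the factor |x|^2 of
    the second-order Taylor remainder. *)
Definition decay8 a := exists M, forall x, (1 + enorm x) ^+ 8 * `|a x| <= M.

Lemma coord_le_norm v i : `|coord v i| <= `|v|.
Proof.
elim/forall_ord3: i; rewrite coordE prod_normE/=.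
- by rewrite le_max prod_normE le_max lexx.
- by rewrite le_max prod_normE le_max lexx orbT.
- by rewrite le_max lexx orbT.
Qed.

Lemma dot_le x v : `|dot x v| <= 3 * (enorm x * `|v|).
Proof.
rewrite dotE (le_trans (ler_normD _ _))// (le_trans (lerD (ler_normD _ _) (lexx _)))// !normrM.
have h i := ler_pM (normr_ge0 _) (normr_ge0 _) (coord_le_enorm x i) (coord_le_norm v i).
by have := h 0; have := h 1; have := h 2%:R; rewrite !coordE; lra.
Qed.

Lemma decay8_dominated a (k : nat) : (k <= 2)%N -> decay8 a -> dominated (fun x => (1 + enorm x) ^+ k * a x).
Proof.
move=> k2 [M hM]; apply: (@decay_dominated _ _ M) => x; apply: le_trans (hM x).
have e0 : 0 <= 1 + enorm x by rewrite addr_ge0// enorm_ge0.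
rewrite normrM ger0_norm ?exprn_ge0// mulrA -exprD ler_wpM2r//.
by rewrite ler_weXn2l// ?lerDl ?enorm_ge0// (leq_trans (leq_add (leqnn 6) k2)).
Qed.

Lemma measurable_enorm : measurable_fun setT (enorm : mE -> R).
Proof.
apply: (measurableT_comp (continuous_measurable_fun (@sqrt_continuous R))).
under eq_fun do rewrite dotE.
by apply: measurable_funD; [apply: measurable_funD|]; apply: measurable_funM => //; apply: measurableT_comp.
Qed.

Lemma measurable_trig s y : measurable_fun setT (fun x : mE => cos (s * dot x y)) /\
  measurable_fun setT (fun x : mE => sin (s * dot x y)).
Proof. by have [/= ? ?] := cmeas_cis_dot s y. Qed.

Lemma dominated_le a b : dominated b -> (forall x, `|a x| <= `|b x|) -> dominated a.
Proof. by move=> [D hD] ab; exists D => x; rewrite (le_trans (ab x)). Qed.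

Lemma integrable_trig s a b y : measurable_fun setT (a : mE -> R) -> measurable_fun setT (b : mE -> R) ->
  dominated a -> dominated b ->
  leb3.-integrable setT (EFin \o (fun x : mE => a x * cos (s * dot x y) + b x * sin (s * dot x y))).
Proof.
move=> ma mb da db; have [mc ms] := measurable_trig s y.
apply: dominated_integrable.
  by apply: measurable_funD; exact: measurable_funM.
apply: dominatedD.
  by apply: (dominated_le da) => x; rewrite normrM ler_piMr// ler_norml cos_geN1 cos_le1.
by apply: (dominated_le db) => x; rewrite normrM ler_piMr// ler_norml sin_geN1 sin_le1.
Qed.

Lemma differentiable_quadratic (V W : normedModType R) (f : V -> W) (df : {linear V -> W})
    (z : V) (D : R) : 0 <= D -> continuous df ->
  (forall u : V, `|f (u + z) - (f z + df u)| <= D * `|u| ^+ 2) ->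
  differentiable f z /\ 'd f z = df :> (V -> W).
Proof.
move=> D0 cdf main.
have eqo : f \o shift z = cst (f z) + df +o_ 0 id.
  apply/eqaddoP => _/posnumP[e]; near=> v.
  rewrite /= -[(_ - _) v]/(f (v + z) - (f z + df v)).
  rewrite (le_trans (main v))// expr2 mulrA ler_wpM2r//.
  have : `|v| <= e%:num / (D + 1).
    near: v; apply/nbhs_normP; exists (e%:num / (D + 1)); first by rewrite /= divr_gt0// ltr_wpDl.
    by move=> u /=; rewrite sub0r normrN => /ltW.
  rewrite ler_pdivlMr ?ltr_wpDl// mulrDr mulr1 mulrC; have := normr_ge0 v; lra.
have dE := diff_unique cdf eqo.
by split => //; apply/diff_locallyP; rewrite dE; split.
Unshelve. all: by end_near. Qed.

(** [smooth] asks for differentiability in the full sense. The Taylor remainder of sine and cosine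
    is quadratic in dot x v, hence integrates to a multiple of |v|^2, and [differentiable_quadratic]
    applies to the candidate differential [df]. *)
Lemma trigint_diff s a b y :
  measurable_fun setT (a : mE -> R) -> measurable_fun setT (b : mE -> R) ->
  decay8 a -> decay8 b ->
  differentiable (trigint s a b) y /\
  forall j, 'D_(basis j) (trigint s a b) y =
    trigint s (fun x => s * coord x j * b x) (fun x => - (s * coord x j * a x)) y.
Proof.
move=> ma mb da db.
have mcoord := @measurable_coord R.
pose K j := trigint s (fun x => s * coord x j * b x) (fun x => - (s * coord x j * a x)) y.
pose df v := \sum_(j < 3) coord v j * K j.
have dflin : linear df.
  move=> r u w; rewrite /df !sum3 !coordD !coordZ /GRing.scale/=; ring.
pose F : {linear E -> R} := HB.pack df (GRing.isLinear.Build _ _ _ _ _ dflin).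
have cF : continuous F.
  move=> u; rewrite /F/= /df; under eq_fun do rewrite sum3.
  apply: cvgD; first apply: cvgD; apply: cvgM; do ?exact: coord_continuous; exact: cvg_cst.
have domX j (g : E -> R) : measurable_fun setT (g : mE -> R) -> decay8 g ->
  measurable_fun setT (fun x : mE => s * coord x j * g x) /\ dominated (fun x => s * coord x j * g x).
  move=> mg dg; split; first by do 2 apply: measurable_funM => //; exact: measurable_coord.
  apply: (@dominated_le _ (fun x => s * ((1 + enorm x) ^+ 1 * g x))).
    by apply: (@dominatedM_bounded _ _ (fun=> s) `|s|) => //; exact: decay8_dominated.
  move=> x; rewrite -mulrA !normrM ler_wpM2l// ler_wpM2r// expr1 [leRHS]ger0_norm ?addr_ge0 ?enorm_ge0//.
  by rewrite (le_trans (coord_le_enorm _ _))// lerDr.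
have d0 g : decay8 g -> dominated g.
  by move=> dg; apply: dominated_eq (@decay8_dominated g 0 isT dg) _ => x; rewrite expr0 mul1r.
pose T j x := s * coord x j * (b x * cos (s * dot x y) - a x * sin (s * dot x y)).
have jT j : leb3.-integrable setT (EFin \o (T j : mE -> R)).
  have := integrable_trig s y (domX j b mb db).1 (measurable_funN (domX j a ma da).1) (domX j b mb db).2.
  have dN : dominated (fun x => - (s * coord x j * a x)).
    by apply: (dominated_le (domX j a ma da).2) => x; rewrite normrN.
  move=> /(_ dN); congr (_.-integrable _ _); apply/funext => x /=; congr EFin.
  by rewrite /T; ring.
have KE j : K j = \int[leb3]_x T j x.
  by rewrite /K /trigint; apply: eq_Rintegral => x _; rewrite /T; ring.
pose S y x := a x * cos (s * dot x y) + b x * sin (s * dot x y).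
have jS u : leb3.-integrable setT (EFin \o (S u : mE -> R)) by apply: integrable_trig => //; exact: d0.
pose Q x := (1 + enorm x) ^+ 2 * (`|a x| + `|b x|).
have jQ : leb3.-integrable setT (EFin \o (Q : mE -> R)).
  have jq g : measurable_fun setT (g : mE -> R) -> decay8 g ->
      leb3.-integrable setT (EFin \o (fun x : mE => `|(1 + enorm x) ^+ 2 * g x|)).
    move=> mg dg; apply: (@integrable_norm _ _ _ _ setT (fun x : mE => (1 + enorm x) ^+ 2 * g x)).
    apply: dominated_integrable; last exact: decay8_dominated.
    apply: measurable_funM => //; apply: measurable_funX; apply: measurable_funD => //.
    exact: measurable_enorm.
  have := rintegrableD (jq a ma da) (jq b mb db).
  congr (_.-integrable _ _); apply/funext => x /=; congr EFin.
  have p : 0 <= (1 + enorm x) ^+ 2 by rewrite exprn_ge0 ?addr_ge0 ?enorm_ge0.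
  by rewrite /Q mulrDr (normrM _ (a x)) (normrM _ (b x)) (ger0_norm p).
(* The constant is 18 = 2 * 3^2: the 2 of [trig_remainder] and the squared 3 of [dot_le]. *)
pose D := 18 * s ^+ 2 * \int[leb3]_x Q x.
have D0 : 0 <= D.
  apply: mulr_ge0; first by rewrite mulr_ge0 ?sqr_ge0.
  by apply: Rintegral_ge0 => x _; rewrite /Q mulr_ge0 ?addr_ge0// sqr_ge0.
have main v : `|trigint s a b (v + y) - (trigint s a b y + df v)| <= D * `|v| ^+ 2.
  have jdf : leb3.-integrable setT (EFin \o (fun x : mE => coord v 0 * T 0 x + coord v 1 * T 1 x + coord v 2%:R * T 2%:R x)).
    by apply: rintegrableD; [apply: rintegrableD|]; apply: rintegrableZ.
  have -> : trigint s a b (v + y) - (trigint s a b y + df v) =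
      \int[leb3]_x (S (v + y) x - S y x - (coord v 0 * T 0 x + coord v 1 * T 1 x + coord v 2%:R * T 2%:R x)).
    rewrite RintegralB//; last exact: rintegrableB.
    rewrite [X in _ = _ - X]RintegralD//; [|by apply: rintegrableD; apply: rintegrableZ|exact: rintegrableZ].
    rewrite [X in _ = _ - (X + _)]RintegralD//; [|exact: rintegrableZ..]; rewrite !RintegralZl//.
    rewrite [X in _ = X - _]RintegralB// -/(trigint s a b (v + y)) -/(trigint s a b y) /df sum3 !KE.
    by ring.
  rewrite (le_trans (le_normr_Rintegral _ _))//; first by apply: rintegrableB => //; exact: rintegrableB.
  rewrite /D mulrC mulrA -RintegralZl//; apply: le_Rintegral => //.
  - by apply: integrable_norm; apply: rintegrableB => //; exact: rintegrableB.
  - exact: rintegrableZ.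
  move=> x _.
  have [hc hs] := trig_remainder (s * dot x y) (s * dot x v).
  have e : S (v + y) x - S y x - (coord v 0 * T 0 x + coord v 1 * T 1 x + coord v 2%:R * T 2%:R x) =
     a x * (cos (s * dot x y + s * dot x v) - cos (s * dot x y) + s * dot x v * sin (s * dot x y)) +
     b x * (sin (s * dot x y + s * dot x v) - sin (s * dot x y) - s * dot x v * cos (s * dot x y)).
    rewrite /S /T (_ : s * dot x (v + y) = s * dot x y + s * dot x v); last by rewrite !dotE/=; ring.
    by rewrite [dot x v]dotE !coordE; ring.
  rewrite e (le_trans (ler_normD _ _))// !normrM.
  have bd : 2 * (s * dot x v) ^+ 2 <= 18 * s ^+ 2 * `|v| ^+ 2 * (1 + enorm x) ^+ 2.
    have h := dot_le x v.
    have h2 : dot x v ^+ 2 <= 9 * ((1 + enorm x) ^+ 2 * `|v| ^+ 2).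
      rewrite -[dot x v ^+ 2]real_normK ?num_real//.
      have h3 : `|dot x v| <= 3 * ((1 + enorm x) * `|v|).
        rewrite (le_trans h)// ler_wpM2l// ler_wpM2r// lerDr//.
      rewrite (le_trans (lerXn2r 2 _ _ h3)) ?nnegrE ?mulr_ge0 ?addr_ge0 ?enorm_ge0//.
      by rewrite (_ : (_ * _) ^+ 2 = 9 * ((1 + enorm x) ^+ 2 * `|v| ^+ 2))//; ring.
    rewrite exprMn; have := ler_wpM2l (sqr_ge0 s) h2; lra.
  have ha := ler_wpM2l (normr_ge0 (a x)) (le_trans hc bd).
  have hb := ler_wpM2l (normr_ge0 (b x)) (le_trans hs bd).
  apply: le_trans (lerD ha hb) _; rewrite /Q -mulrDl.
  have -> : (`|a x| + `|b x|) * (18 * s ^+ 2 * `|v| ^+ 2 * (1 + enorm x) ^+ 2) =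
    `|v| ^+ 2 * (18 * s ^+ 2) * ((1 + enorm x) ^+ 2 * (`|a x| + `|b x|)) by ring.
  by [].
have [dd dE] := @differentiable_quadratic E R (trigint s a b) F y D D0 cF main.
split=> // j; rewrite deriveE// dE /= /F/= /df sum3 !coord_basis.
by elim/forall_ord3: j; rewrite /= !(mul1r, mul0r, add0r, addr0).
Qed.

End differentiating_fourier_integrals.

(** * Gaussians and their Fourier transform *)

Section gaussian.
Context {R : realType}.
Local Open Scope complex_scope.
Local Notation C := R[i].
Local Notation mR := (measurableTypeR R).
Local Notation E := (R * R * R)%type.
Local Notation mE := (mR * mR * mR)%type.
Local Notation coord := (@Defs.coord R).
Local Notation basis := (@Defs.basis R).
Implicit Types (a b f g : E -> R) (h : E -> C) (s c : R) (x y v : E) (i j : 'I_3).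

Definition gauss c x : R := expR (- c * enorm x ^+ 2).

Lemma eq_coord x y : (forall i, coord x i = coord y i) -> x = y.
Proof.
move=> e; move: (e 0) (e 1) (e 2%:R); rewrite !coordE.
by case: x {e} => -[p q] r; case: y => -[p' q'] r' /= -> -> ->.
Qed.

Lemma derive_dir f x v : differentiable f x -> 'D_v f x = \sum_(j < 3) coord v j * 'D_(basis j) f x.
Proof.
move=> df; rewrite sum3 !deriveE//.
have vE : v = coord v 0 *: basis 0 + coord v 1 *: basis 1 + coord v 2%:R *: basis 2%:R.
  apply: eq_coord => i; rewrite !coordD !coordZ !coord_basis.
  by elim/forall_ord3: i; rewrite /=; ring.
by rewrite [in LHS]vE !linearD !linearZ.
Qed.

Lemma differentiable_gauss c x : differentiable (gauss c) x /\
  forall j, 'D_(basis j) (gauss c) x = - (2 * c) * (coord x j * gauss c x).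
Proof.
pose Q y := - c * enorm y ^+ 2.
have QE : Q = (fun y => - c * (coord y 0 * coord y 0) + - c * (coord y 1 * coord y 1) + - c * (coord y 2%:R * coord y 2%:R)).
  by apply/funext => y; rewrite /Q enorm_sqr dotE !coordE; ring.
have d1 i : differentiable (fun y => - c * (coord y i * coord y i)) x.
  by apply: differentiableM; [exact: differentiable_cst|apply: differentiableM; exact: coord_differentiable].
have dQ : differentiable Q x by rewrite QE; apply: differentiableD => //; apply: differentiableD.
have DQ j : 'D_(basis j) Q x = - (2 * c) * coord x j.
  have e1 i : 'D_(basis j) (fun y => - c * (coord y i * coord y i)) x = - c * (2 * coord x i * (j == i)%:R).
    rewrite derive_mulE; [|exact: derivable_cst|by apply: diff_derivable; apply: differentiableM; exact: coord_differentiable].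
    rewrite derive_cst mulr0 addr0 derive_mulE; [|by apply: diff_derivable; exact: coord_differentiable..].
    by rewrite derive_coord coord_basis; ring.
  rewrite QE derive_addE; [|by apply: diff_derivable; apply: differentiableD|exact: diff_derivable].
  rewrite derive_addE; [|exact: diff_derivable..]; rewrite !e1.
  by clear e1; elim/forall_ord3: j; rewrite /=; ring.
have D v := @diff_comp1 _ Q expR expR x v dQ (is_derive_expR _).
split; first exact: (D 0).1.
by move=> j; rewrite (D (basis j)).2 DQ /gauss mulrC mulrA.
Qed.

(** Polynomials times a Gaussian, presented by closure rules: the class is stable under
    differentiation, so decay of all derivatives follows from one induction on the rules. *)
Inductive poly_gauss c : (E -> R) -> Prop :=
| PG_gauss : poly_gauss c (gauss c)
| PG_coordM j f : poly_gauss c f -> poly_gauss c (fun x => coord x j * f x)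
| PG_add f g : poly_gauss c f -> poly_gauss c g -> poly_gauss c (fun x => f x + g x)
| PG_scale r f : poly_gauss c f -> poly_gauss c (fun x => r * f x).

Lemma poly_gauss_derive c f : poly_gauss c f ->
  (forall x, differentiable f x) /\ forall j, poly_gauss c ('D_(basis j) f).
Proof.
elim=> [|j g pg [dg IH]|g g' pg [dg IH] pg' [dg' IH']|r g pg [dg IH]].
- split; first by move=> x; exact: (differentiable_gauss c x).1.
  move=> j; rewrite (funext (fun x => (differentiable_gauss c x).2 j)).
  by do 2 constructor; constructor.
- split; first by move=> x; apply: differentiableM => //; exact: coord_differentiable.
  move=> i; rewrite (_ : 'D_(basis i) _ = (fun x => coord x j * 'D_(basis i) g x + (i == j)%:R * g x)).
    by apply: PG_add; [exact: PG_coordM|exact: PG_scale].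
  apply/funext => x; rewrite derive_mulE; [|by apply: diff_derivable; exact: coord_differentiable|exact: diff_derivable].
  by rewrite derive_coord coord_basis mulrC [_%:R * _]mulrC mulrC.
- split; first by move=> x; exact: differentiableD.
  move=> i; rewrite (_ : 'D_(basis i) _ = (fun x => 'D_(basis i) g x + 'D_(basis i) g' x)).
    exact: PG_add.
  by apply/funext => x; rewrite derive_addE//; exact: diff_derivable.
- split; first by move=> x; apply: differentiableM => //; exact: differentiable_cst.
  move=> i; rewrite (_ : 'D_(basis i) _ = (fun x => r * 'D_(basis i) g x)).
    exact: PG_scale.
  apply/funext => x; rewrite derive_mulE; [|exact: derivable_cst|exact: diff_derivable].
  by rewrite derive_cst mulr0 addr0.
Qed.

Lemma one_enorm_ge0 x : 0 <= 1 + enorm x.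
Proof. by rewrite addr_ge0// enorm_ge0. Qed.

Lemma poly_gauss_decay c f : 0 < c -> poly_gauss c f ->
  forall m : nat, exists M, forall x, (1 + enorm x) ^+ m * `|f x| <= M.
Proof.
move=> c0; elim=> [|j g pg IH|g g' pg IH pg' IH'|r g pg IH] m.
(* The exponent is the maximum of m |x| - c |x|^2, since (1 + |x|)^m <= e^(m |x|). *)
- exists (expR (m%:R ^+ 2 / (4 * c))) => x; rewrite ger0_norm ?expR_ge0//.
  have h1 : (1 + enorm x) ^+ m <= expR (m%:R * enorm x).
    rewrite expRM_natl; apply: lerXn2r; rewrite ?nnegrE ?one_enorm_ge0 ?expR_ge0//.
    exact: expR_ge1Dx.
  rewrite (le_trans (ler_wpM2r _ h1)) ?expR_ge0// /gauss -expRD ler_expR.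
  rewrite -subr_ge0 (_ : _ - _ = c * (enorm x - m%:R / (2 * c)) ^+ 2).
    by rewrite mulr_ge0 ?sqr_ge0// ltW.
  by field; rewrite gt_eqF.
- have [M hM] := IH m.+1; exists M => x; apply: le_trans (hM x).
  rewrite exprSr normrM -!mulrA ler_wpM2l ?exprn_ge0 ?one_enorm_ge0//.
  by rewrite ler_wpM2r// (le_trans (coord_le_enorm _ _))// lerDr.
- have [M hM] := IH m; have [M' hM'] := IH' m; exists (M + M') => x.
  apply: le_trans (lerD (hM x) (hM' x)); rewrite -mulrDr.
  by rewrite ler_wpM2l ?exprn_ge0 ?one_enorm_ge0// ler_normD.
- have [M hM] := IH m; exists (`|r| * M) => x; rewrite normrM mulrCA.
  by rewrite ler_wpM2l.
Qed.

Lemma poly_gauss_sch c f : 0 < c -> poly_gauss c f -> sch f.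
Proof.
move=> c0 pf; have P t : poly_gauss c (pderivs t f).
  by elim: t => [//|i t IH] /=; exact: (poly_gauss_derive IH).2.
split; first by move=> t x; exact: (poly_gauss_derive (P t)).1.
by move=> t m; exact: poly_gauss_decay (P t) m.
Qed.

Lemma sch_gauss c : 0 < c -> sch (gauss c).
Proof. by move=> c0; apply: (poly_gauss_sch c0); constructor. Qed.

Lemma sch_decay8 f : sch f -> decay8 f.
Proof. by case=> _ /(_ [::] 8%N). Qed.

Lemma FT_ReE s h y : complex.Re (FT s h y) =
  trigint s (fun x => complex.Re (h x)) (fun x => - complex.Im (h x)) y.
Proof. by rewrite /= /trigint; apply: eq_Rintegral => x _; rewrite ReM/=; ring. Qed.

Lemma FT_ImE s h y : complex.Im (FT s h y) =
  trigint s (fun x => complex.Im (h x)) (fun x => complex.Re (h x)) y.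
Proof. by rewrite /= /trigint; apply: eq_Rintegral => x _; rewrite ImM/=; ring. Qed.

Definition cdecay8 h := decay8 (fun x => complex.Re (h x)) /\ decay8 (fun x => complex.Im (h x)).

Lemma decay8N a : decay8 a -> decay8 (fun x => - a x).
Proof. by move=> [M hM]; exists M => x; rewrite normrN. Qed.

Lemma FT_diff s h y : cmeas (h : mE -> C) -> cdecay8 h ->
  [/\ differentiable (fun y => complex.Re (FT s h y)) y,
      differentiable (fun y => complex.Im (FT s h y)) y &
      forall j, 'D_(basis j) (fun y => complex.Re (FT s h y)) y
        +i* 'D_(basis j) (fun y => complex.Im (FT s h y)) y =
        FT s (fun x => (0 +i* (s * coord x j)) * h x) y].
Proof.
move=> [mr mi] [dr di].
rewrite (funext (FT_ReE s h)) (funext (FT_ImE s h)).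
have [d1 e1] := trigint_diff s y mr (measurable_funN mi) dr (decay8N di).
have [d2 e2] := trigint_diff s y mi mr di dr.
split => // j; rewrite e1 e2; apply: eq_cplx.
  by rewrite FT_ReE; apply: eq_Rintegral => x _; rewrite ReM ImM/=; ring.
by rewrite FT_ImE; apply: eq_Rintegral => x _; rewrite ReM ImM/=; ring.
Qed.

(** The transform F satisfies grad F = -(y/2) F, because the gradient of the Gaussian is -2x times
    the Gaussian and [FT] exchanges the two operations. Hence F(t y) e^(t^2 |y|^2 / 4) has zero
    derivative in t, for the real and the imaginary part alike. *)
Lemma FT_gauss s y : s ^+ 2 = 1 ->
  FT s (fun x => (gauss 1 x)%:C) y = (gauss 4^-1 y)%:C * FT s (fun x => (gauss 1 x)%:C) 0.
Proof.
move=> s1; pose F := FT s (fun x => (gauss 1 x)%:C).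
have sg : sch (gauss 1) by exact: sch_gauss.
have mF : cmeas (fun x : mE => (gauss 1 x)%:C) by apply: cmeas_real; exact: sch_measurable.
have dF : cdecay8 (fun x => (gauss 1 x)%:C).
  by split; [exact: sch_decay8|exists 0 => x; rewrite normr0 mulr0].
have key z j : FT s (fun x => (0 +i* (s * coord x j)) * (gauss 1 x)%:C) z = (- (coord z j / 2))%:C * F z.
  have e : (fun x => (0 +i* (s * coord x j)) * (gauss 1 x)%:C) =
      (fun x => (0 -i* (s / 2)) * ('D_(basis j) (gauss 1) x)%:C).
    apply/funext => x; rewrite (differentiable_gauss 1 x).2.
    by apply: eq_cplx; rewrite ?ReM ?ImM/=; field.
  rewrite e FTZ; last exact/cL1_sch/sch_derive.
  rewrite FT_sch_derive// mulrA -/(F z); congr (_ * _).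
  apply: eq_cplx; rewrite ?ReM ?ImM/=; last by ring.
  rewrite (_ : _ - _ = - (s ^+ 2 * (coord z j / 2))); last by field.
  by rewrite s1 mul1r.
have const (p : C -> R) : (forall (r : R) z, p (r%:C * z) = r * p z) ->
    (forall z, differentiable (fun z => p (F z)) z) ->
    (forall z j, 'D_(basis j) (fun z => p (F z)) z = p ((- (coord z j / 2))%:C * F z)) ->
    p (F y) = gauss 4^-1 y * p (F 0).
  move=> pZ pd pD.
  pose U (t : R) := p (F (0 + t *: y)) * expR (t ^+ 2 * (dot y y / 4)).
  have dU (t : R) : is_derive t 1 U 0.
    have h1 : is_derive t 1 (fun t : R => p (F (0 + t *: y))) ('D_y (fun z => p (F z)) (0 + t *: y)).
      by apply: (@is_derive_line _ (fun z => p (F z))); exact: diff_derivable.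
    have h2 : is_derive t 1 (fun t : R => t ^+ 2 * (dot y y / 4)) (2 * t * (dot y y / 4)).
      by apply: is_derive_eq; rewrite /GRing.scale/=; ring.
    have h3 := @is_derive1_comp R expR (fun t : R => t ^+ 2 * (dot y y / 4)) t _ _ (is_derive_expR _) h2.
    apply: (is_derive_eq (is_deriveM h1 h3)).
    rewrite derive_dir// sum3 !pD !pZ /GRing.scale/= add0r !coordZ dotE !coordE; by field.
  have := is_derive_0_is_cst 1 0 dU.
  rewrite /U scale1r scale0r !add0r expr0n mul0r expR0 mulr1 expr1n mul1r => <-.
  rewrite /gauss enorm_sqr mulrCA -expRD (_ : _ + _ = 0) ?expR0 ?mulr1//; by field.
apply: eq_cplx.
  rewrite ReM/= mul0r subr0; apply: (const (@complex.Re R)).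
  - by move=> r z; rewrite ReM/= mul0r subr0.
  - by move=> z; have [] := FT_diff s z mF dF.
  - by move=> z j; have [_ _ /(_ j)] := FT_diff s z mF dF; rewrite key => <-.
rewrite ImM/= mul0r addr0; apply: (const (@complex.Im R)).
- by move=> r z; rewrite ImM/= mul0r addr0.
- by move=> z; have [] := FT_diff s z mF dF.
- by move=> z j; have [_ _ /(_ j)] := FT_diff s z mF dF; rewrite key => <-.
Qed.

End gaussian.

(** * Fourier inversion *)

Section fourier_inversion.
Context {R : realType}.
Local Open Scope complex_scope.
Local Notation C := R[i].
Local Notation mR := (measurableTypeR R).
Local Notation E := (R * R * R)%type.
Local Notation mE := (mR * mR * mR)%type.
Local Notation leb := (@lebesgue_measure R).
Implicit Types (m h k : E -> C) (s : R) (x y : E).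

Lemma affE (l : R) (a x : E) : aff l a x = l *: x + a.
Proof. by case: x => -[]. Qed.

Lemma integral_gauss : \int[leb3]_x gauss 1 x = Num.sqrt pi ^+ 3 :> R.
Proof.
have mg : measurable_fun setT (fun x : mE => (gauss 1 x)%:E).
  by apply/measurable_EFinP; apply: sch_measurable; exact: sch_gauss.
rewrite /Rintegral leb3_iter//; last by move=> x; rewrite lee_fin expR_ge0.
have e u v c : (gauss 1 (u, v, c))%:E = ((gauss_fun u * gauss_fun v)%:E * (gauss_fun c)%:E)%E.
  rewrite -EFinM /gauss /gauss_fun enorm_sqr dotE/= -!expRD; congr (expR _)%:E; ring.
have G0 (t : R) : (0 <= (gauss_fun t)%:E)%E by rewrite lee_fin gauss_fun_ge0.
have mG : measurable_fun setT (fun t : mR => (gauss_fun t)%:E).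
  by apply/measurable_EFinP; exact: measurable_gauss_fun.
have h1 u v : (\int[leb]_c (gauss 1 (u, v, c))%:E = ((gauss_fun u * Num.sqrt pi)%:E * (gauss_fun v)%:E)%E)%E.
  transitivity (\int[leb]_c ((gauss_fun u * gauss_fun v)%:E * (gauss_fun c)%:E))%E.
    by apply: eq_integral => c _; exact: e.
  rewrite (@ge0_integralZl _ _ _ leb setT measurableT)//; last by rewrite lee_fin mulr_ge0 ?gauss_fun_ge0.
  by rewrite integralT_gauss -!EFinM; congr EFin; ring.
have h2 u : (\int[leb]_v \int[leb]_c (gauss 1 (u, v, c))%:E = ((Num.sqrt pi ^+ 2)%:E * (gauss_fun u)%:E)%E)%E.
  transitivity (\int[leb]_v ((gauss_fun u * Num.sqrt pi)%:E * (gauss_fun v)%:E))%E.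
    by apply: eq_integral => v _; exact: h1.
  rewrite (@ge0_integralZl _ _ _ leb setT measurableT)//; last by rewrite lee_fin mulr_ge0 ?gauss_fun_ge0 ?sqrtr_ge0.
  by rewrite integralT_gauss -!EFinM; congr EFin; ring.
rewrite [X in fine X](_ : _ = (Num.sqrt pi ^+ 3)%:E)//.
transitivity (\int[leb]_u ((Num.sqrt pi ^+ 2)%:E * (gauss_fun u)%:E))%E.
  by apply: eq_integral => u _; exact: h2.
rewrite (@ge0_integralZl _ _ _ leb setT measurableT) ?lee_fin ?sqr_ge0//.
by rewrite integralT_gauss -!EFinM; congr EFin; ring.
Qed.

Lemma FT_gaussE s y : s ^+ 2 = 1 ->
  FT s (fun x => (gauss 1 x)%:C) y = (gauss 4^-1 y * Num.sqrt pi ^+ 3)%:C.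
Proof.
move=> s1; rewrite FT_gauss// -integral_gauss.
have -> : FT s (fun x => (gauss 1 x)%:C) 0 = cint leb3 (fun x : mE => (gauss 1 x)%:C).
  by apply: eq_cint => x; rewrite dotC (_ : dot 0 x = 0) ?mulr0 ?cis0 ?mulr1// dotE !mul0r !addr0.
by rewrite cint_real rmorphM.
Qed.

Lemma integral_gauss4 : \int[leb3]_x gauss 4^-1 x = 8 * Num.sqrt pi ^+ 3 :> R.
Proof.
have sg : sch (@gauss R 4^-1) by apply: sch_gauss; rewrite invr_gt0.
have [_ ->] := rint_affine 0 (ltr0n R 2) (sch_integrable sg).
rewrite -integral_gauss (_ : 2 ^+ 3 = 8 :> R); last by rewrite -natrX.
apply: (congr1 ( *%R 8)).
apply: eq_Rintegral => x _; rewrite affE addr0 /gauss !enorm_sqr dotZl dotC dotZl.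
congr expR; by field.
Qed.

(** Gaussian regularisation: the factor gauss(e x) makes the double integral absolutely convergent,
    Fubini turns it into an average of m around y on the scale e, and both sides have limits as e
    tends to 0. *)
Lemma FT_inversion s m (y : E) (M : R) : s ^+ 2 = 1 -> cL1 leb3 (m : mE -> C) ->
  (forall x, cmodulus (m x) <= M) ->
  (forall u : nat -> E, u @ \oo --> y -> (fun n => cmodulus (m (u n) - m y)) @ \oo --> (0 : R)) ->
  cL1 leb3 (FT s m : mE -> C) ->
  FT (- s) (FT s m) y = ((2 * pi) ^+ 3)%:C * m y.
Proof.
move=> s1 jm mM cm jk.
pose e n : R := n.+1%:R^-1.
have e0 n : 0 < e n by rewrite invr_gt0.
have ecvg : e @ \oo --> (0 : R) by exact: cvg_harmonic.
have sg : sch (@gauss R 1) by exact: sch_gauss.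
(* [A n] is the regularised inverse transform; [B n] is the same number after Fubini and the
   substitution xi = e x + y. *)
pose A n := cint leb3 (fun x : mE => (gauss 1 (e n *: x))%:C * (FT s m x * cis (- s * dot x y))).
pose B n := cint leb3 (fun x : mE => m (e n *: x + y) * (gauss 4^-1 x * Num.sqrt pi ^+ 3)%:C).
have mg (r : R) : measurable_fun setT (fun x : mE => gauss 1 (r *: x)).
  have := measurableT_comp (sch_measurable sg) (measurable_aff 0 r).
  by congr measurable_fun; apply/funext => x /=; rewrite affE addr0.
have jge n : leb3.-integrable setT (EFin \o (fun x : mE => gauss 1 (e n *: x))).
  have := (rint_affine 0 (e0 n) (sch_integrable sg)).1.
  by congr (_.-integrable _ _); apply/funext => x /=; rewrite affE addr0.
have scal n z : cint leb3 (fun x : mE => (gauss 1 (e n *: x))%:C * cis (s * dot x z)) =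
    (e n ^- 3)%:C * (gauss 4^-1 ((e n)^-1 *: z) * Num.sqrt pi ^+ 3)%:C.
  rewrite -(@FT_gaussE s)// /FT; have [_ ->] := cint_affine 0 (e0 n) (cL1_cis s ((e n)^-1 *: z) (cL1_sch sg)).
  rewrite mulrA -rmorphM/= mulVf ?expf_neq0 ?gt_eqF// mul1r.
  apply: eq_cint => x; rewrite affE addr0; congr (_ * cis (s * _)).
  by rewrite [RHS]dotZl [X in _ = _ * X]dotC dotZl mulrA mulfV ?gt_eqF// mul1r dotC.
have AB n : A n = B n.
  pose P (z : mE * mE) : C := m z.1 * ((gauss 1 (e n *: z.2))%:C * cis (s * dot z.2 (z.1 - y))).
  have mP : cmeas P.
    apply: cmeasM; first by apply: (cmeas_comp jm.1); exact: measurable_fst.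
    apply: cmeasM.
      by apply: cmeas_real; apply: (measurableT_comp (mg (e n))); exact: measurable_snd.
    apply: cmeas_cis; apply: measurable_funM => //.
    rewrite (_ : (fun z => _) = (fun z : mE * mE => dot z.1 z.2 - dot z.2 y)).
      apply: measurable_funB; first exact: measurable_dot2.
      by apply: (measurableT_comp (measurable_dot y)); exact: measurable_snd.
    by apply/funext => z; rewrite !dotE/=; ring.
  have jP : cL1 (prod_sf mu3 mu3) P.
    apply: (@cL1_prod_mul R _ _ _ _ mu3 mu3 P _ _ mP jm.2 (jge n)) => x x'.
    rewrite /P/= !cmodulusM cmodulus_cis mulr1 cmodulus_real ger0_norm//.
    exact: expR_ge0.
  transitivity (cint leb3 (fun x : mE => cint leb3 (fun xi : mE => P (xi, x)))).
    apply: eq_cint => x.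
    transitivity ((gauss 1 (e n *: x))%:C * cis (- s * dot x y) * FT s m x).
      by rewrite [FT s m x * _]mulrC mulrA.
    rewrite -cintZ; last exact: cL1_cis.
    apply: eq_cint => xi; rewrite /P/=.
    rewrite (_ : s * dot x (xi - y) = - s * dot x y + s * dot xi x); last by rewrite !dotE/=; ring.
    by rewrite cisD; ring.
  transitivity (cint leb3 (fun xi : mE => cint leb3 (fun x : mE => P (xi, x)))).
    by symmetry; exact: (@cint_fubini R _ _ _ _ mu3 mu3 P jP).
  pose G (xi : E) : C := m xi * ((e n ^- 3)%:C * (gauss 4^-1 ((e n)^-1 *: (xi - y)) * Num.sqrt pi ^+ 3)%:C).
  have jG : cL1 leb3 (G : mE -> C).
    have := @cL1_cint2 R _ _ _ _ mu3 mu3 P jP.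
    rewrite (_ : (fun xi => _) = G)//; apply/funext => xi.
    rewrite -[LHS]/(cint leb3 (fun x : mE => P (xi, x))) /P/= cintZ; last first.
      by apply: cL1_cis; apply: cL1_real; exact: jge.
    by rewrite scal.
  transitivity (cint leb3 (G : mE -> C)).
    apply: eq_cint => xi; rewrite /P/= cintZ; last first.
      by apply: cL1_cis; apply: cL1_real; exact: jge.
    by rewrite scal.
  have [_ ->] := cint_affine y (e0 n) jG.
  rewrite -cintZ; last by have [] := cint_affine y (e0 n) jG.
  apply: eq_cint => x; rewrite /G affE addrK scalerA mulVf ?gt_eqF// scale1r.
  have : (e n ^+ 3)%:C * (e n ^- 3)%:C = 1 :> C.
    by rewrite -rmorphM/= mulfV ?expf_neq0 ?gt_eqF.
  by move=> e1; rewrite mulrCA [X in _ * X]mulrA e1 mul1r.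
have Alim : (fun n => cmodulus (A n - FT (- s) (FT s m) y)) @ \oo --> (0 : R).
  have jky := cL1_cis (- s) y jk.
  apply: (cint_dominated _ _ jky.2).
  - by move=> n; apply: cmeasM; [apply: cmeas_real; exact: mg|exact: jky.1].
  - move=> x; set z := _ * cis _.
    rewrite (_ : (fun n => _) = (fun n => `|gauss 1 (e n *: x) - 1| * cmodulus z)); last first.
      by apply/funext => n; rewrite -[X in _ - X]mul1r -mulrBl cmodulusM -(rmorphB (real_complex R)) cmodulus_real.
    rewrite -[X in _ --> X](mul0r (cmodulus z)); apply: cvgM; last exact: cvg_cst.
    rewrite -(normr0 R); apply: cvg_norm; rewrite -(subrr (1 : R)); apply: cvgB; last exact: cvg_cst.
    rewrite /gauss -[X in _ --> X]expR0; apply: continuous_cvg; first exact: continuous_expR.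
    rewrite (_ : (fun n => _) = (fun n => - dot x x * (e n * e n))); last first.
      by apply/funext => n; rewrite enorm_sqr dotZl dotC dotZl; ring.
    by rewrite -[X in _ --> X](mulr0 (- dot x x)); apply: cvgM; [exact: cvg_cst|rewrite -[X in _ --> X](mulr0 0); exact: cvgM].
  - move=> n x; rewrite cmodulusM cmodulus_real ger0_norm ?expR_ge0//.
    by rewrite ler_piMl ?cmodulus_ge0// /gauss -[leRHS]expR0 ler_expR mulNr mul1r oppr_le0 sqr_ge0.
have Blim : (fun n => cmodulus (B n - ((2 * pi) ^+ 3)%:C * m y)) @ \oo --> (0 : R).
  have sg4 : sch (@gauss R 4^-1) by apply: sch_gauss; rewrite invr_gt0.
  pose K : R := Num.sqrt pi ^+ 3.
  have jK : leb3.-integrable setT (EFin \o (fun x : mE => K * gauss 4^-1 x)).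
    exact/rintegrableZ/sch_integrable.
  (* The constant is the mass 8 pi^(3/2) of [gauss 4^-1] times the pi^(3/2) from [FT_gaussE]. *)
  have -> : ((2 * pi) ^+ 3)%:C * m y = cint leb3 (fun x : mE => m y * (gauss 4^-1 x * K)%:C).
    rewrite cintZ; last first.
      by apply: cL1_real; apply: eq_integrable jK => // x _ /=; rewrite mulrC.
    rewrite cint_real mulrC; congr (_ * _%:C).
    under eq_Rintegral do rewrite mulrC.
    rewrite RintegralZl//; last exact: sch_integrable.
    rewrite integral_gauss4 /K mulrCA -exprMn -expr2 sqr_sqrtr ?pi_ge0// exprMn.
    by congr (_ * _); rewrite -natrX.
  apply: (cint_dominated _ _ (rintegrableZ M jK)).
  - move=> n; apply: cmeasM.
      have := cmeas_comp jm.1 (measurable_aff y (e n)).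
      by congr (measurable_fun _ _ /\ measurable_fun _ _); apply/funext => x; rewrite affE.
    apply: cmeas_real; apply: measurable_funM => //; exact: sch_measurable.
  - move=> x; rewrite (_ : (fun n => _) = (fun n => cmodulus (m (e n *: x + y) - m y) * cmodulus (gauss 4^-1 x * K)%:C)); last first.
      by apply/funext => n; rewrite -mulrBl cmodulusM.
    rewrite -[X in _ --> X](mul0r (cmodulus (gauss 4^-1 x * K)%:C)); apply: cvgM; last exact: cvg_cst.
    apply: (cm (fun n => e n *: x + y)).
    by rewrite -[X in _ --> X]add0r -(scale0r x); apply: cvgD; [apply: cvgZr_tmp|exact: cvg_cst].
  - move=> n x; rewrite cmodulusM cmodulus_real ger0_norm; last first.
      by rewrite mulr_ge0 ?expR_ge0 ?exprn_ge0 ?sqrtr_ge0.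
    by rewrite [K * _]mulrC ler_wpM2r// mulr_ge0 ?expR_ge0 ?exprn_ge0 ?sqrtr_ge0.
apply: (cvg_cmodulus_unique Alim).
by rewrite (_ : A = B)//; apply/funext.
Qed.

End fourier_inversion.

(** * Fourier multipliers *)

Section multipliers.
Context {R : realType}.
Local Open Scope complex_scope.
Local Notation C := R[i].
Local Notation mR := (measurableTypeR R).
Local Notation E := (R * R * R)%type.
Local Notation mE := (mR * mR * mR)%type.
Local Notation coord := (@Defs.coord R).
Local Notation basis := (@Defs.basis R).
Implicit Types (g h : E -> C) (m f : E -> R) (s : R) (x y : E) (j k : 'I_3).

Lemma fourierE g y : fourier g y = FT (-1) g y.
Proof. by apply: eq_cint => x; rewrite mulN1r. Qed.

Lemma inv_fourierE h x : inv_fourier h x = (((2 * pi) ^+ 3)^-1)%:C * FT 1 h x.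
Proof. by congr (_ * _); apply: eq_cint => xi; rewrite mul1r dotC. Qed.

Lemma twopi3_neq0 : ((2 * pi) ^+ 3 : R) != 0.
Proof. by rewrite expf_neq0// mulf_neq0// gt_eqF// pi_gt0. Qed.

Lemma cmeas_FT s h : cmeas (h : mE -> C) -> cmeas (FT s h : mE -> C).
Proof.
move=> mh; apply: (@cmeas_cint R _ _ _ _ mu3 (fun z : mE * mE => h z.2 * cis (s * dot z.2 z.1))).
apply: cmeasM; first by apply: (cmeas_comp mh); exact: measurable_snd.
apply: cmeas_cis; apply: measurable_funM => //.
by under eq_fun do rewrite dotC; exact: measurable_dot2.
Qed.

Lemma FT_real_split s h y : cL1 leb3 (h : mE -> C) ->
  FT s h y = FT s (fun x => (complex.Re (h x))%:C) y + 'i * FT s (fun x => (complex.Im (h x))%:C) y.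
Proof.
move=> jh; have jr := cL1_real (cL1_Re jh); have ji := cL1_real (cL1_Im jh).
rewrite -FTZ// -FTD//; last exact: cL1Z.
by congr FT; apply/funext => x; apply: eq_cplx; rewrite ?ReD ?ImD ?ReM ?ImM/=; ring.
Qed.

Definition csch h := sch (fun x => complex.Re (h x)) /\ sch (fun x => complex.Im (h x)).

Lemma csch_cL1 h : csch h -> cL1 leb3 (h : mE -> C).
Proof.
move=> [sr si]; apply: (le_cL1 (h := fun x : mE => `|complex.Re (h x)| + `|complex.Im (h x)|)).
- by split; exact: sch_measurable.
- by apply: rintegrableD; apply: integrable_norm; exact: sch_integrable.
- by move=> x; exact: cmodulus_le_ReIm.
Qed.

Lemma cmodulus_i : cmodulus ('i : C) = 1.
Proof. by rewrite /cmodulus/= expr0n expr1n add0r sqrtr1. Qed.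

Lemma FT_csch_decay s h (n : nat) : s ^+ 2 = 1 -> csch h ->
  exists M, forall y, (1 + enorm y) ^+ n * cmodulus (FT s h y) <= M.
Proof.
move=> s1 sh; have [sr si] := sh.
have [M hM] := FT_sch_decay n s1 sr; have [N hN] := FT_sch_decay n s1 si.
exists (M + N) => y; apply: le_trans (lerD (hM y) (hN y)).
rewrite -mulrDr ler_wpM2l ?exprn_ge0 ?one_enorm_ge0// FT_real_split; last exact: csch_cL1.
by rewrite (le_trans (cmodulusD _ _))// cmodulusM cmodulus_i mul1r.
Qed.

Lemma decay_cL1 h (M : R) : cmeas (h : mE -> C) ->
  (forall y, (1 + enorm y) ^+ 6 * cmodulus (h y) <= M) -> cL1 leb3 (h : mE -> C).
Proof.
move=> mh hM; split=> //; apply: dominated_integrable; first exact: cmeas_modulus.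
by apply: (@decay_dominated _ _ M) => x; rewrite ger0_norm ?cmodulus_ge0.
Qed.

Lemma cL1_FT_csch s h : s ^+ 2 = 1 -> csch h -> cL1 leb3 (FT s h : mE -> C).
Proof.
move=> s1 sh; have [M hM] := FT_csch_decay 6 s1 sh.
by apply: (decay_cL1 _ hM); apply: cmeas_FT; case: (csch_cL1 sh).
Qed.

Lemma csch_bounded h : csch h -> exists M, forall x, cmodulus (h x) <= M.
Proof.
move=> [[_ /(_ [::] 0%N)[M hM]] [_ /(_ [::] 0%N)[N hN]]]; exists (M + N) => x.
rewrite (le_trans (cmodulus_le_ReIm _))// lerD//.
  by have := hM x; rewrite expr0 mul1r.
by have := hN x; rewrite expr0 mul1r.
Qed.

Lemma csch_continuous h (u : nat -> E) y : csch h -> u @ \oo --> y ->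
  (fun n => cmodulus (h (u n) - h y)) @ \oo --> (0 : R).
Proof.
move=> [sr si] uy.
have cr : (fun n => complex.Re (h (u n))) @ \oo --> complex.Re (h y).
  apply: (@cvg_comp _ _ _ u (fun x => complex.Re (h x)) _ _ _ uy).
  exact: (differentiable_continuous (sch_differentiable _ _)).
have ci : (fun n => complex.Im (h (u n))) @ \oo --> complex.Im (h y).
  apply: (@cvg_comp _ _ _ u (fun x => complex.Im (h x)) _ _ _ uy).
  exact: (differentiable_continuous (sch_differentiable _ _)).
apply/cvgrPdist_le => e e0; near=> n.
rewrite sub0r normrN ger0_norm ?cmodulus_ge0// (le_trans (cmodulus_le_ReIm _))//.
rewrite ReD ImD [e]splitr lerD//.
  rewrite (_ : complex.Re (- h y) = - complex.Re (h y)); last by case: (h y).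
  by rewrite distrC; near: n; have /cvgrPdist_le := cr; apply; rewrite divr_gt0.
rewrite (_ : complex.Im (- h y) = - complex.Im (h y)); last by case: (h y).
by rewrite distrC; near: n; have /cvgrPdist_le := ci; apply; rewrite divr_gt0.
Unshelve. all: by end_near. Qed.

Lemma FT_csch_inversion s h y : s ^+ 2 = 1 -> csch h ->
  FT (- s) (FT s h) y = ((2 * pi) ^+ 3)%:C * h y.
Proof.
move=> s1 sh; have [M hM] := csch_bounded sh.
apply: (FT_inversion s1 (csch_cL1 sh) hM); last exact: cL1_FT_csch.
by move=> u; exact: csch_continuous.
Qed.

Lemma inv_fourier_fourier g : csch g -> inv_fourier (fourier g) = g.
Proof.
move=> sg; apply/funext => x; rewrite inv_fourierE (funext (fourierE g)).
have := @FT_csch_inversion (-1) g x _ sg; rewrite opprK sqrrN expr1n => ->//.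
by rewrite mulrA -rmorphM/= mulVf ?twopi3_neq0// mul1r.
Qed.

(* The symbols for which the multiplier acts by convolution with an integrable kernel. *)
Definition kernel_symbol m :=
  [/\ leb3.-integrable setT (EFin \o (m : mE -> R)),
      cL1 leb3 (inv_fourier (fun xi => (m xi)%:C) : mE -> C) &
      forall y, FT 1 (inv_fourier (fun xi => (m xi)%:C)) y = (m (- y))%:C].

Lemma FTN s h y : FT s h (- y) = FT (- s) h y.
Proof. by apply: eq_cint => x; rewrite dotC dotNl dotC mulrN mulNr. Qed.

Lemma pderivs0 (t : seq 'I_3) : pderivs t (fun=> 0 : R) = (fun=> 0).
Proof. by elim: t => //= i t ->; apply/funext => x; exact: derive_cst. Qed.

Lemma sch_csch f : sch f -> csch (fun x => (f x)%:C).
Proof.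
move=> sf; split => //; split => [t x|t n].
  by rewrite /= pderivs0; exact: differentiable_cst.
by exists 0 => x /=; rewrite pderivs0 normr0 mulr0.
Qed.

Lemma sch_kernel_symbol m : sch m -> kernel_symbol m.
Proof.
move=> sm; have cm := sch_csch sm; have s1 : (1 : R) ^+ 2 = 1 by rewrite expr1n.
have e : inv_fourier (fun xi => (m xi)%:C) = (fun x => (((2 * pi) ^+ 3)^-1)%:C * FT 1 (fun xi => (m xi)%:C) x).
  by apply/funext => x; rewrite inv_fourierE.
have j1 := cL1_FT_csch s1 cm.
split; first exact: sch_integrable.
  by rewrite e; exact: cL1Z.
move=> y; rewrite e FTZ// -[y in LHS]opprK FTN FT_csch_inversion//.
by rewrite mulrA -rmorphM/= mulVf ?twopi3_neq0// mul1r.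
Qed.

Lemma measurable_subr3 : measurable_fun setT (fun z : mE * mE => (z.2 - z.1 : mE)).
Proof.
apply/measurable_fun_pairP; split => /=.
  apply/measurable_fun_pairP; split => /=; apply: measurable_funB => //;
    do ?apply: measurableT_comp => //.
by apply: measurable_funB => //; do ?apply: measurableT_comp => //.
Qed.

(** The multiplier is convolution with the kernel k, so Fubini gives integrability and the product
    formula. The argument -y arises because [multiplier_fun] is built on [FT (-1)] while the
    statement uses [FT 1]. *)
Lemma multiplier_cL1 m g : kernel_symbol m -> cL1 leb3 (g : mE -> C) ->
  cL1 leb3 (multiplier_fun m g : mE -> C) /\
  forall y, FT 1 (multiplier_fun m g) y = (m (- y))%:C * FT 1 g y.
Proof.
move=> [jm jk hk] jg.
pose c0 : C := ((2 * pi) ^+ 3)%:C; pose ci : C := (((2 * pi) ^+ 3)^-1)%:C.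
have cic : ci * c0 = 1 by rewrite /ci /c0 -rmorphM/= mulVf ?twopi3_neq0.
pose k := inv_fourier (fun xi => (m xi)%:C).
have kE z : k z = ci * FT 1 (fun xi => (m xi)%:C) z by exact: inv_fourierE.
have jmC := cL1_real jm.
pose B := cmodulus ci * \int[leb3]_x cmodulus (m x)%:C.
have kB z : cmodulus (k z) <= B.
  by rewrite kE cmodulusM ler_wpM2l ?cmodulus_ge0//; exact: FT_bound.
have sub1 y : aff 1 (- y) = (fun x => x - y).
  by apply/funext => x; rewrite affE scale1r.
have jkx y : cL1 leb3 (fun x : mE => k (x - y)).
  by have := (cint_affine (- y) ltr01 jk).1; rewrite sub1.
have kint y : \int[leb3]_x cmodulus (k (x - y)) = \int[leb3]_x cmodulus (k x).
  have [_ ->] := rint_affine (- y) ltr01 jk.2; rewrite expr1n mul1r.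
  by apply: eq_Rintegral => x _; rewrite sub1.
pose P (z : mE * mE) : C := g z.1 * k (z.2 - z.1).
have mP : cmeas P.
  apply: cmeasM; first by apply: (cmeas_comp jg.1); exact: measurable_fst.
  exact: (cmeas_comp jk.1 measurable_subr3).
have jPx x : cL1 leb3 (fun y : mE => P (y, x)).
  rewrite /P/=; under eq_fun do rewrite mulrC.
  apply: (@cL1M_bounded _ _ _ _ _ _ B jg) => //.
  apply: (cmeas_comp jk.1).
  exact: (measurableT_comp measurable_subr3 (@measurable_pair2 _ _ mE mE x)).
(* Convolution form, by exchanging the frequency integral with the integral defining the transform
   of g; this uses only that m and g are integrable. *)
have conv x : multiplier_fun m g x = cint leb3 (fun y : mE => P (y, x)).
  pose Q (z : mE * mE) : C := (m z.1)%:C * (g z.2 * cis (dot z.1 (x - z.2))).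
  have mQ : cmeas Q.
    apply: cmeasM.
      apply: cmeas_real; apply: measurableT_comp; last exact: measurable_fst.
      by apply/measurable_EFinP; exact: measurable_int jm.
    apply: cmeasM; first by apply: (cmeas_comp jg.1); exact: measurable_snd.
    apply: cmeas_cis.
    rewrite (_ : (fun z => _) = (fun z : mE * mE => dot z.1 x - dot z.1 z.2)).
      apply: measurable_funB; last exact: measurable_dot2.
      by apply: (measurableT_comp (measurable_dot x)); exact: measurable_fst.
    by apply/funext => z; rewrite !dotE/=; ring.
  have jQ : cL1 (prod_sf mu3 mu3) Q.
    apply: (@cL1_prod_mul R _ _ _ _ mu3 mu3 Q _ _ mQ jmC.2 jg.2) => xi y.
    by rewrite /Q/= !cmodulusM cmodulus_cis mulr1.
  rewrite /multiplier_fun inv_fourierE -/ci.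
  transitivity (ci * cint leb3 (fun y : mE => cint leb3 (fun xi : mE => Q (xi, y)))).
    apply: (congr1 ( *%R ci)).
    transitivity (cint leb3 (fun xi : mE => cint leb3 (fun y : mE => Q (xi, y)))); last first.
      exact: (@cint_fubini R _ _ _ _ mu3 mu3 Q jQ).
    apply: eq_cint => xi; rewrite fourierE.
    transitivity ((m xi)%:C * cis (1 * dot xi x) * FT (-1) g xi).
      by rewrite -!mulrA [FT _ _ _ * _]mulrC.
    rewrite -cintZ; last exact: cL1_cis.
    apply: eq_cint => y; rewrite /Q/=.
    rewrite (_ : dot xi (x - y) = 1 * dot xi x + -1 * dot y xi); last by rewrite !dotE/=; ring.
    by rewrite cisD; ring.
  transitivity (ci * cint leb3 (fun y : mE => c0 * P (y, x))).
    apply: (congr1 ( *%R ci)); apply: eq_cint => y.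
    transitivity (g y * FT 1 (fun xi => (m xi)%:C) (x - y)).
      rewrite -cintZ; last exact: cL1_cis.
      by apply: eq_cint => xi; rewrite /Q/= mul1r mulrCA.
    by rewrite /P/= kE mulrCA (mulrA c0) [c0 * _]mulrC cic mul1r.
  by rewrite cintZ// mulrA cic mul1r.
have jP : cL1 (prod_sf mu3 mu3) P.
  pose K := \int[leb3]_x cmodulus (k x).
  apply: (@cL1_prod R _ _ _ _ mu3 mu3 P (fun y => K * cmodulus (g y)) mP).
    exact: (rintegrableZ K jg.2).
  move=> y; have j1 := (cL1Z (g y) (jkx y)).2.
  rewrite -[leLHS]fineK; last exact: (integrable_fin_num measurableT j1).
  rewrite lee_fin -/(Rintegral _ _ _).
  rewrite (_ : (fun x => _) = (fun x => cmodulus (g y) * cmodulus (k (x - y)))); last first.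
    by apply/funext => x; rewrite /P cmodulusM.
  by rewrite RintegralZl//; [rewrite kint mulrC|exact: (jkx y).2].
have ek : multiplier_fun m g = (fun x => cint leb3 (fun y : mE => P (y, x))) by apply/funext.
split; first by rewrite ek; exact: (@cL1_cint1 R _ _ _ _ mu3 mu3 P jP).
move=> z.
pose P2 (w : mE * mE) : C := cis (1 * dot w.2 z) * P w.
have jP2 : cL1 (prod_sf mu3 mu3) P2.
  apply: (@cL1M_bounded _ _ _ _ _ _ 1 jP) => [|w]; last by rewrite cmodulus_cis.
  by apply: (cmeas_comp (cmeas_cis_dot 1 z)); exact: measurable_snd.
transitivity (cint leb3 (fun x : mE => cint leb3 (fun y : mE => P2 (y, x)))).
  by apply: eq_cint => x; rewrite conv mulrC -cintZ.
transitivity (cint leb3 (fun y : mE => cint leb3 (fun x : mE => P2 (y, x)))).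
  by symmetry; exact: (@cint_fubini R _ _ _ _ mu3 mu3 P2 jP2).
rewrite -cintZ; last exact: cL1_cis.
apply: eq_cint => y; rewrite -hk /FT -/k.
have jkz := cL1_cis 1 z jk.
have [j2 ->] := cint_affine (- y) ltr01 jkz.
rewrite sub1 expr1n mul1r [RHS]mulrC mul1r -[RHS]cintZ; last by move: j2; rewrite sub1.
apply: eq_cint => x; rewrite /P2 /P/=.
rewrite (_ : 1 * dot x z = 1 * dot (x - y) z + 1 * dot y z); last by rewrite !dotE/=; ring.
by rewrite [1 * dot y z]mul1r cisD /k; ring.
Qed.

End multipliers.

(** * Dilations and superpositions of symbols *)

Section scaling.
Context {R : realType}.
Local Open Scope complex_scope.
Local Notation C := R[i].
Local Notation mR := (measurableTypeR R).
Local Notation E := (R * R * R)%type.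
Local Notation mE := (mR * mR * mR)%type.
Local Notation leb := (@lebesgue_measure R).
Local Notation coord := (@Defs.coord R).
Local Notation basis := (@Defs.basis R).
Implicit Types (g h : E -> C) (m f p : E -> R) (x y : E) (j k : 'I_3).

Lemma schwartz_csch g : schwartz g -> csch g.
Proof.
move=> [[sr si] dg]; split; split=> // t n; have [M hM] := dg t n; exists M => x;
  apply: le_trans (hM x); rewrite ler_wpM2l ?exprn_ge0 ?one_enorm_ge0//.
  exact: (norm_Re_le (cpderivs t g x)).
exact: (norm_Im_le (cpderivs t g x)).
Qed.

Lemma derive_scale (a : R) f x v : differentiable f (a *: x) ->
  differentiable (fun x => f (a *: x)) x /\
  'D_v (fun x => f (a *: x)) x = a * 'D_v f (a *: x).
Proof.
move=> df.
have di : differentiable (@id E) x by exact: ex_diff.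
have da : differentiable (a *: (@id E)) x by exact: differentiableZ.
have dc : differentiable (f \o (a *: (@id E))) x by apply: differentiable_comp.
split=> //; rewrite deriveE; last exact: dc.
rewrite [X in X v](diff_comp da df)/= diffZ//.
by rewrite /= diff_val deriveE// linearZ.
Qed.

Lemma smooth_scale (a : R) f : smooth f -> smooth (fun x => f (a *: x)) /\
  forall t, pderivs t (fun x => f (a *: x)) = (fun x => a ^+ size t * pderivs t f (a *: x)).
Proof.
move=> sf.
have H t : pderivs t (fun x => f (a *: x)) = (fun x => a ^+ size t * pderivs t f (a *: x)).
  elim: t => [|i t IH]; first by apply/funext => x /=; rewrite mul1r.
  rewrite /= -/(pderivs t _) IH; apply/funext => x.
  have [h1 h2] := @derive_scale a (pderivs t f) x (basis i) (sf t _).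
  rewrite derive_mulE; [|exact: derivable_cst|exact: diff_derivable].
  by rewrite h2 derive_cst mulr0 addr0 exprSr mulrA.
split=> // t x; rewrite H; apply: differentiableM; first exact: differentiable_cst.
exact: (@derive_scale a (pderivs t f) x 0 (sf t _)).1.
Qed.

Lemma enormZ (a : R) x : enorm (a *: x) = `|a| * enorm x.
Proof.
by rewrite /enorm dotZl dotC dotZl mulrA -expr2 sqrtrM ?sqr_ge0// sqrtr_sqr.
Qed.

Lemma sch_scale (a : R) f : 0 < a -> sch f -> sch (fun x => f (a *: x)).
Proof.
move=> a0 [sf df]; have [ss e] := smooth_scale a sf; split=> // t n.
have [M hM] := df t n; exists ((1 + a^-1) ^+ n * a ^+ size t * M) => x; rewrite e.
have h : 1 + enorm x <= (1 + a^-1) * (1 + enorm (a *: x)).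
  rewrite enormZ gtr0_norm// mulrDl !mulrDr !mul1r mulr1 mulrA mulVf ?gt_eqF// mul1r.
  have : 0 <= a^-1 by rewrite invr_ge0 ltW.
  have : 0 <= a * enorm x by rewrite mulr_ge0 ?enorm_ge0 ?ltW.
  lra.
have ai : 0 <= 1 + a^-1 by rewrite addr_ge0// invr_ge0 ltW.
rewrite normrM (ger0_norm (exprn_ge0 _ (ltW a0))).
apply: le_trans (ler_wpM2r _ (lerXn2r n _ _ h)) _; rewrite ?nnegrE ?mulr_ge0 ?exprn_ge0 ?one_enorm_ge0 ?(ltW a0)//.
rewrite exprMn -!mulrA ler_wpM2l ?exprn_ge0// mulrCA ler_wpM2l ?exprn_ge0 ?(ltW a0)//.
Qed.

Lemma enorm_continuous : continuous (enorm : E -> R).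
Proof.
move=> x; apply: (@continuous_comp _ _ _ (fun x : E => dot x x) Num.sqrt); last exact: sqrt_continuous.
apply: (@differentiable_continuous R _ _ x (fun x : E => dot x x)).
rewrite (_ : (fun x => _) = (fun x => coord x 0 * coord x 0 + coord x 1 * coord x 1 + coord x 2%:R * coord x 2%:R)).
  by apply: differentiableD; [apply: differentiableD|]; apply: differentiableM; exact: coord_differentiable.
by apply/funext => z; rewrite dotE !coordE.
Qed.

(** All derivatives vanish outside the ball as well, and on the cube [-r, r]^3 containing it they
    are bounded by compactness. *)
Lemma compact_support_sch f (r : R) : smooth f -> (forall x, r < enorm x -> f x = 0) -> sch f.
Proof.
move=> sf f0; split=> // t n.
have t0 x : r < enorm x -> pderivs t f x = 0.
  elim: t x => [|i t IH] x rx; first exact: f0.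
  rewrite /= -/(pderivs t f) (@near_eq_derive _ _ _ _ (cst 0)) ?derive_cst//.
  have o : open [set z : E | r < enorm z].
    apply: (@open_comp _ _ (enorm : E -> R) [set z | r < z]); last exact: open_gt.
    by move=> z _; exact: enorm_continuous.
  by apply: filterS (open_nbhs_nbhs (conj o rx)) => z; exact: IH.
pose K : set E := (`[- r, r] `*` `[- r, r]) `*` `[- r, r].
have cK : compact K by do !apply: compact_setX; exact: segment_compact.
have cI : compact (pderivs t f @` K).
  apply: continuous_compact => //; apply: continuous_subspaceT => x.
  exact: (differentiable_continuous (sf t x)).
have [M [_ hM]] := compact_bounded cI.
pose B := `|M| + 1.
have hB x : K x -> `|pderivs t f x| <= B.
  by move=> Kx; apply: (hM B); [rewrite (le_lt_trans (ler_norm _))// ltrDl|exists x].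
have r1 : 0 <= 1 + `|r| by rewrite addr_ge0.
exists ((1 + `|r|) ^+ n * B) => x.
have [xr|/t0 ->] := leP (enorm x) r; last by rewrite normr0 mulr0 mulr_ge0 ?exprn_ge0// addr_ge0.
apply: ler_pM; rewrite ?exprn_ge0 ?one_enorm_ge0//.
  by apply: lerXn2r; rewrite ?nnegrE ?one_enorm_ge0// lerD2l (le_trans xr)// ler_norm.
apply: hB; have c i : - r <= coord x i <= r.
  by rewrite -ler_norml (le_trans (coord_le_enorm _ _)).
have := c 0; have := c 1; have := c 2%:R; rewrite !coordE.
by split; [split|]; rewrite /= in_itv/=.
Qed.

Lemma kernel_symbol_lin (c : R) m m' : kernel_symbol m -> kernel_symbol m' ->
  kernel_symbol (fun x => m x + c * m' x).
Proof.
move=> [jm jk hk] [jm' jk' hk'].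
have e : inv_fourier (fun xi => (m xi + c * m' xi)%:C) =
    (fun x => inv_fourier (fun xi => (m xi)%:C) x + c%:C * inv_fourier (fun xi => (m' xi)%:C) x).
  apply/funext => x; rewrite !inv_fourierE.
  rewrite (_ : (fun xi => _) = (fun xi => (m xi)%:C + c%:C * (m' xi)%:C)); last first.
    by apply/funext => xi; rewrite rmorphD rmorphM.
  rewrite FTD ?FTZ; [by rewrite mulrDr mulrCA|exact: cL1_real..| |].
    exact: cL1_real.
  by apply: cL1Z; exact: cL1_real.
split; first by apply: rintegrableD => //; exact: rintegrableZ.
  by rewrite e; apply: cL1D => //; exact: cL1Z.
move=> y; rewrite e FTD//; last exact: cL1Z.
by rewrite [X in _ + X]FTZ// hk hk' rmorphD rmorphM.
Qed.

Lemma cint_eq0 d (T : measurableType d) (mu : {measure set T -> \bar R}) (u : T -> C) :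
  (forall t : T, u t = 0) -> cint mu u = 0.
Proof. by move=> u0; rewrite (eq_cint mu u0) cint0. Qed.

Lemma measurable_scale3 : measurable_fun setT (fun z : mR * mE => (z.1 *: (z.2 : E) : mE)).
Proof.
apply/measurable_fun_pairP; split => /=.
  apply/measurable_fun_pairP; split => /=; apply: measurable_funM => //;
    do ?apply: measurableT_comp => //.
by apply: measurable_funM => //; do ?apply: measurableT_comp => //.
Qed.

Lemma rint_EFin d (T : measurableType d) (mu : {measure set T -> \bar R}) (u : T -> R) :
  mu.-integrable setT (EFin \o u) -> (\int[mu]_x (u x)%:E = (\int[mu]_x u x)%:E)%E.
Proof. by move=> ju; rewrite /Rintegral fineK//; exact: (integrable_fin_num measurableT ju). Qed.

(** The inverse transform of a dilate p(s xi) has an L^1 norm independent of s ([N1int]). An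
    integrable superposition of dilates therefore has an integrable kernel even where the symbol is
    not smooth. The cutoff s >= s0 > 0 controls the L^1 norm of the symbols themselves, which grows
    like s^-3 as s tends to 0. *)
Lemma kernel_symbol_dilations p (a : R -> R) (s0 : R) (lam : E -> R) : 0 < s0 -> sch p ->
  leb.-integrable setT (EFin \o (a : mR -> R)) -> (forall s, s < s0 -> a s = 0) ->
  (forall xi, lam xi = \int[leb]_s (a s * p (s *: xi))) ->
  kernel_symbol lam.
Proof.
move=> s00 sp ja a0 lamE.
have /measurable_EFinP ma := measurable_int _ ja.
pose ci : C := (((2 * pi) ^+ 3)^-1)%:C.
pose f (z : mR * mE) : C := (a z.1 * p (z.1 *: (z.2 : E)))%:C.
have mp : measurable_fun setT (fun z : mR * mE => p (z.1 *: (z.2 : E))).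
  exact: (measurableT_comp (sch_measurable sp) measurable_scale3).
have ma1 : measurable_fun setT (fun z : mR * mE => a z.1).
  by apply: (measurableT_comp ma); exact: measurable_fst.
have mf : cmeas f by apply: cmeas_real; exact: measurable_funM.
pose N := \int[leb3]_x `|p x|.
have sps s : s0 <= s -> sch (fun x => p (s *: x)).
  by move=> ss; apply: sch_scale => //; exact: lt_le_trans ss.
have aff0 (s : R) : aff s 0 = (fun x : E => s *: x).
  by apply/funext => x; rewrite affE addr0.
have Nint s : s0 <= s -> leb3.-integrable setT (EFin \o (fun x : mE => `|p (s *: (x : E))|)) /\
    \int[leb3]_x `|p (s *: x)| = s ^- 3 * N.
  move=> ss; have sgt0 := lt_le_trans s00 ss.
  have [] := rint_affine 0 sgt0 (integrable_norm (sch_integrable sp)).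
  rewrite aff0 => h1 h2; split=> //.
  rewrite /N; apply: (@mulfI _ (s ^+ 3)); first by rewrite expf_neq0// gt_eqF.
  by rewrite mulrA mulfV ?expf_neq0 ?gt_eqF// mul1r h2.
have N0 : 0 <= N by apply: Rintegral_ge0 => x _.
have jf : cL1 (prod_sf leb mu3) f.
  apply: (@cL1_prod R _ _ _ _ leb mu3 f (fun s => (s0 ^- 3 * N) * `|a s|) mf).
    exact/rintegrableZ/integrable_norm.
  move=> s; have [ss|ss] := ltP s s0.
    rewrite a0// normr0 mulr0 (eq_integral (fun=> 0%E)) ?integral0// => x _.
    by rewrite /f/= a0// mul0r cmodulus0.
  have [h1 h2] := Nint s ss.
  rewrite (eq_integral (fun x : mE => (`|a s| * `|p (s *: (x : E))|)%:E)); last first.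
    by move=> x _; rewrite /f/= cmodulus_real normrM.
  rewrite rint_EFin; last exact: rintegrableZ.
  rewrite RintegralZl// h2 lee_fin mulrC ler_wpM2r// ler_wpM2r//.
  by rewrite lef_pV2 ?posrE ?exprn_gt0// ?(lt_le_trans s00 ss)// lerXn2r// nnegrE ltW// (lt_le_trans s00 ss).
have lamC : (fun xi => (lam xi)%:C) = (fun xi => cint leb (fun s : mR => f (s, xi))).
  by apply/funext => xi; rewrite lamE -cint_real.
have jlam : cL1 leb3 (fun xi : mE => (lam xi)%:C).
  by rewrite lamC; exact: (@cL1_cint1 R _ _ _ _ leb mu3 f jf).
pose kk (z : mR * mE) : C := ci * FT 1 (fun xi => (p (z.1 *: xi))%:C) z.2.
have mkk : cmeas kk.
  apply: cmeasM; first exact: cmeas_cst.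
  pose G (w : (mR * mE) * mE) : C := (p (w.1.1 *: (w.2 : E)))%:C * cis (1 * dot w.2 w.1.2).
  apply: (@cmeas_cint R _ _ _ _ mu3 G); apply: cmeasM.
    apply: cmeas_real.
    have mm : measurable_fun setT (fun w : (mR * mE) * mE => (w.1.1, w.2)).
      apply: measurable_fun_pair; last exact: measurable_snd.
      exact: (measurableT_comp (@measurable_fst _ _ mR mE) (@measurable_fst _ _ (mR * mE)%type mE)).
    exact: (measurableT_comp mp mm).
  apply: cmeas_cis; apply: measurable_funM => //.
  have mm : measurable_fun setT (fun w : (mR * mE) * mE => (w.2, w.1.2)).
    apply: measurable_fun_pair; first exact: measurable_snd.
    exact: (measurableT_comp (@measurable_snd _ _ mR mE) (@measurable_fst _ _ (mR * mE)%type mE)).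
  exact: (measurableT_comp (@measurable_dot2 R) mm).
have kkE (s : R) : (fun x => kk (s, x)) = inv_fourier (fun xi => (p (s *: xi))%:C).
  by apply/funext => x; rewrite inv_fourierE.
pose N1 := \int[leb3]_x cmodulus (inv_fourier (fun xi => (p xi)%:C) x).
have [_ jk1 _] := sch_kernel_symbol sp.
have N1int s : s0 <= s -> cL1 leb3 (fun x : mE => kk (s, x)) /\
    \int[leb3]_x cmodulus (kk (s, x)) = N1.
  move=> ss; have sgt0 := lt_le_trans s00 ss.
  have [_ jk _] := sch_kernel_symbol (sps _ ss).
  split; first by move: jk; rewrite -kkE.
  have si0 : 0 < s^-1 by rewrite invr_gt0.
  rewrite /N1 (rint_affine 0 si0 jk1.2).2 -RintegralZl//; last first.
    exact: (rint_affine 0 si0 jk1.2).1.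
  apply: eq_Rintegral => x _; rewrite aff0 inv_fourierE /kk -/ci/= !cmodulusM mulrCA.
  congr (_ * _); rewrite -[s^-1 ^+ 3]ger0_norm ?exprn_ge0 ?(ltW si0)// -cmodulus_real -cmodulusM.
  congr cmodulus; rewrite /FT.
  have [_ ->] := cint_affine 0 sgt0 (cL1_cis 1 (s^-1 *: x) (cL1_sch sp)).
  rewrite mulrA -rmorphM/= -exprMn mulVf ?gt_eqF// expr1n mul1r.
  apply: eq_cint => xi; rewrite aff0; congr (_ * cis (1 * _)).
  by rewrite [RHS]dotZl [X in _ = _ * X]dotC dotZl mulrA mulfV ?gt_eqF// mul1r dotC.
clearbody N1.
have [B hB] := csch_bounded (sch_csch sp).
have jaC : cL1 leb (fun s : mR => (a s)%:C) by exact: cL1_real.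
have jfx xi : cL1 leb (fun s : mR => f (s, xi)).
  rewrite (_ : (fun s => _) = (fun s : mR => (p (s *: xi))%:C * (a s)%:C)); last first.
    by apply/funext => s; rewrite /f/= -rmorphM/= mulrC.
  apply: (@cL1M_bounded _ _ _ _ _ _ B jaC) => [|s]; last exact: hB.
  apply: cmeas_real.
  have mm : measurable_fun setT (fun s : mR => (s, xi : mE)).
    by apply: measurable_fun_pair; [exact: measurable_id|exact: measurable_cst].
  exact: (measurableT_comp mp mm).
pose f2 (z : mR * mE) : C := (a z.1)%:C * kk z.
have mf2 : cmeas f2 by apply: cmeasM => //; exact: cmeas_real.
have jf2 : cL1 (prod_sf leb mu3) f2.
  apply: (@cL1_prod R _ _ _ _ leb mu3 f2 (fun s => N1 * `|a s|) mf2).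
    exact/rintegrableZ/integrable_norm.
  move=> s; have [ss|ss] := ltP s s0.
    rewrite a0// normr0 mulr0 (eq_integral (fun=> 0%E)) ?integral0// => x _.
    by rewrite /f2/= a0// mul0r cmodulus0.
  have [h1 h2] := N1int s ss.
  rewrite (eq_integral (fun x : mE => (`|a s| * cmodulus (kk (s, x)))%:E)); last first.
    by move=> x _; rewrite /f2/= cmodulusM cmodulus_real.
  rewrite rint_EFin; last exact: (rintegrableZ _ h1.2).
  have e : \int[leb3]_x (`|a s| * cmodulus (kk (s, x))) = N1 * `|a s|.
    rewrite (@RintegralZl _ _ _ leb3 setT (fun x => cmodulus (kk (s, x))) `|a s| measurableT h1.2).
    by rewrite h2 mulrC.
  by rewrite lee_fin le_eqVlt; apply/orP; left; apply/eqP; exact: e.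
pose fc x (z : mR * mE) : C := cis (1 * dot z.2 x) * f z.
have jfc x : cL1 (prod_sf leb mu3) (fc x).
  apply: (@cL1M_bounded _ _ _ _ _ _ 1 jf) => [|w]; last by rewrite cmodulus_cis.
  by apply: (cmeas_comp (cmeas_cis_dot 1 x)); exact: measurable_snd.
have fcE x s : cint leb3 (fun xi : mE => fc x (s, xi)) =
    (a s)%:C * FT 1 (fun xi => (p (s *: xi))%:C) x.
  have [ss|ss] := ltP s s0.
    by rewrite a0// mul0r cint_eq0// => xi; rewrite /fc /f/= a0// mul0r mulr0.
  rewrite -cintZ; last by apply: cL1_cis; apply: cL1_sch; exact: sps.
  by apply: eq_cint => xi; rewrite /fc /f/= rmorphM/=; ring.
have jf2x x : cL1 leb (fun s : mR => f2 (s, x)).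
  rewrite (_ : (fun s => _) = (fun s : mR => ci * cint leb3 (fun xi : mE => fc x (s, xi)))).
    apply: cL1Z; exact: (@cL1_cint2 R _ _ _ _ leb mu3 _ (jfc x)).
  by apply/funext => s; rewrite fcE /f2 /kk/= mulrCA.
have invE : inv_fourier (fun xi => (lam xi)%:C) = (fun x => cint leb (fun s : mR => f2 (s, x))).
  apply/funext => x; rewrite inv_fourierE -/ci.
  transitivity (ci * cint leb3 (fun xi : mE => cint leb (fun s : mR => fc x (s, xi)))).
    apply: (congr1 ( *%R ci)); apply: eq_cint => xi.
    by rewrite (congr1 (fun F => F xi) lamC) mulrC -cintZ.
  transitivity (ci * cint leb (fun s : mR => cint leb3 (fun xi : mE => fc x (s, xi)))).
    by apply: (congr1 ( *%R ci)); symmetry; exact: (@cint_fubini R _ _ _ _ leb mu3 _ (jfc x)).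
  rewrite -cintZ; last exact: (@cL1_cint2 R _ _ _ _ leb mu3 _ (jfc x)).
  by apply: eq_cint => s; rewrite fcE /f2 /kk/= mulrCA.
split.
- exact: cL1_Re jlam.
- by rewrite invE; exact: (@cL1_cint1 R _ _ _ _ leb mu3 f2 jf2).
move=> y; rewrite invE.
pose f3 (z : mR * mE) : C := cis (1 * dot z.2 y) * f2 z.
have jf3 : cL1 (prod_sf leb mu3) f3.
  apply: (@cL1M_bounded _ _ _ _ _ _ 1 jf2) => [|w]; last by rewrite cmodulus_cis.
  by apply: (cmeas_comp (cmeas_cis_dot 1 y)); exact: measurable_snd.
transitivity (cint leb3 (fun x : mE => cint leb (fun s : mR => f3 (s, x)))).
  by apply: eq_cint => x; rewrite mulrC -cintZ.
transitivity (cint leb (fun s : mR => cint leb3 (fun x : mE => f3 (s, x)))).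
  by symmetry; exact: (@cint_fubini R _ _ _ _ leb mu3 f3 jf3).
rewrite (congr1 (fun F => F (- y)) lamC); apply: eq_cint => s.
have [ss|ss] := ltP s s0.
  rewrite cint_eq0 => [|xi]; first by rewrite /f/= a0// mul0r.
  by rewrite /f3 /f2/= a0// mul0r mulr0.
have [_ _ hk] := sch_kernel_symbol (sps _ ss).
rewrite /f/= rmorphM/= -hk -kkE /FT -cintZ; last exact: (cL1_cis _ _ (N1int s ss).1).
by apply: eq_cint => x; rewrite /f3 /f2/=; ring.
Qed.

End scaling.

(** * The Leray symbol *)

Section leray_symbol.
Context {R : realType}.
Local Open Scope complex_scope.
Local Notation C := R[i].
Local Notation mR := (measurableTypeR R).
Local Notation E := (R * R * R)%type.
Local Notation mE := (mR * mR * mR)%type.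
Local Notation leb := (@lebesgue_measure R).
Local Notation coord := (@Defs.coord R).
Local Notation basis := (@Defs.basis R).
Implicit Types (g h : E -> C) (m f p : E -> R) (x y : E) (i j k : 'I_3) (s : R).

Lemma coordN x i : coord (- x) i = - coord x i.
Proof. by rewrite -scaleN1r coordZ mulN1r. Qed.

Lemma enormN x : enorm (- x) = enorm x.
Proof. by rewrite -scaleN1r enormZ normrN1 mul1r. Qed.

Lemma gaussE (c : R) x : gauss c x = expR (- c * enorm x ^+ 2).
Proof. by []. Qed.

(** With N = |xi|^2 this represents the singular quotient e^(-s0^2 |xi|^2) / |xi|^2 by Gaussians;
    the primitive is F(t) = -e^(-N t^2) / N. *)
Lemma gauss_tail_integral (N s0 : R) : 0 < N -> 0 < s0 ->
  (\int[leb]_(s in `[s0, +oo[) (2 * s * expR (- N * s ^+ 2))%:E = (expR (- N * s0 ^+ 2) / N)%:E)%E.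
Proof.
move=> N0 s00.
pose F (t : R) := - N^-1 * expR (- N * t ^+ 2).
have dF (t : R) : is_derive t 1 F (2 * t * expR (- N * t ^+ 2)).
  have h2 : is_derive t 1 (fun t : R => - N * t ^+ 2) (- N * (2 * t)).
    by apply: is_derive_eq; rewrite /GRing.scale/=; ring.
  have h3 := @is_derive1_comp R expR (fun t : R => - N * t ^+ 2) t _ _ (is_derive_expR _) h2.
  apply: (is_derive_eq (is_deriveM (is_derive_cst (- N^-1) t 1) h3)).
  by rewrite /GRing.scale/=; field; rewrite gt_eqF.
have cF (t : R) : {for t, continuous F}.
  by apply: differentiable_continuous; apply/derivable1_diffP; exact: ex_derive.
have cexp : continuous (fun t : R => expR (- N * t ^+ 2)).
  move=> t; apply: (@continuous_comp _ _ _ (fun t : R => - N * t ^+ 2) expR); last exact: continuous_expR.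
  by apply: cvgM; [exact: cvg_cst|exact: exprn_continuous].
rewrite (@ge0_continuous_FTC2y _ _ F s0 0).
- by rewrite -EFinB; congr EFin; rewrite /F; ring.
- move=> t st; rewrite mulr_ge0 ?expR_ge0// mulr_ge0// (le_trans _ st)// ltW//.
- apply: continuous_subspaceT => t; apply: cvgM; last exact: cexp.
  by apply: cvgM; [exact: cvg_cst|exact: cvg_id].
- apply/cvgrPdist_le => e e0; near=> t.
  have t1 : 1 <= t by near: t; apply: nbhs_pinfty_ge; rewrite num_real.
  have t2 : (N * N * e)^-1 <= t by near: t; apply: nbhs_pinfty_ge; rewrite num_real.
  have NNe : 0 < N * N * e by rewrite !mulr_gt0.
  have Ft : `|F t| = N^-1 * expR (- N * t ^+ 2).
    by rewrite /F normrM normrN (gtr0_norm (expR_gt0 _)) gtr0_norm ?invr_gt0.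
  rewrite sub0r normrN Ft.
  rewrite mulrC ler_pdivrMr// mulNr expRN.
  have h : e^-1 / N <= expR (N * t ^+ 2).
    rewrite (le_trans _ (expR_ge1Dx _))//.
    have q1 : N * (N * N * e)^-1 = e^-1 / N by field; rewrite !gt_eqF.
    have q2 := ler_wpM2l (ltW N0) t2; rewrite q1 in q2.
    have q3 : N * t <= N * t ^+ 2 by rewrite expr2 ler_pM2l// ler_peMl// (le_trans _ t1).
    lra.
  by rewrite -[e * N]invrK lef_pV2 ?posrE ?invr_gt0 ?mulr_gt0 ?expR_gt0// invfM.
- by move=> t _; exact: ex_derive.
- exact: cvg_at_right_filter (cF s0).
- by move=> t _; rewrite derive1E (@derive_val _ _ _ _ _ _ _ (dF t)).
Unshelve. all: by end_near. Qed.

(** Since e^(-s |xi|^2) / |xi|^2 is the integral of 2 t e^(-t^2 |xi|^2) over t >= sqrt s, the symbol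
    is a superposition of dilates of p(xi) = xi_k xi_i xi_j e^(-|xi|^2). The three coordinates
    contribute t^3 to p(t xi), which leaves the weight 2 t^-2, integrable at infinity; with two
    coordinates the weight would be 2/t. *)
Lemma cubic_symbol k i j s : 0 < s ->
  kernel_symbol (fun xi => coord xi k * coord xi i * coord xi j / enorm xi ^+ 2 * gauss s xi).
Proof.
move=> sgt0; pose s0 := Num.sqrt s.
have s00 : 0 < s0 by rewrite sqrtr_gt0.
have s0s : s0 ^+ 2 = s by rewrite sqr_sqrtr// ltW.
pose p xi := coord xi k * (coord xi i * (coord xi j * gauss 1 xi)).
have sp : sch p by do 3 apply: sch_coordM; exact: sch_gauss.
pose a (t : R) : R := if t < s0 then 0 else 2 * t `^ (- 2).
have mif (u : mR -> R) : measurable_fun setT u ->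
    measurable_fun setT (fun t : mR => if t < s0 then 0 else u t).
  move=> mu; apply: measurable_fun_ifT => //.
  by apply: measurable_fun_ltr; [exact: measurable_id|exact: measurable_cst].
have ma : measurable_fun setT (a : mR -> R).
  by apply: mif; apply: measurable_funM => //; exact: measurable_powR.
have aE (t : R) : s0 <= t -> a t = 2 * t ^- 2.
  move=> st; have t0 := lt_le_trans s00 st.
  by rewrite /a ltNge st/= powRN (powR_mulrn _ (ltW t0)).
have ja : leb.-integrable setT (EFin \o (a : mR -> R)).
  pose D : R := 2 * (1 + s0 ^- 2).
  have jD := rintegrableZ D (@integrable_oneDsqrV R).
  apply: (le_integrable measurableT _ _ jD); first exact/measurable_EFinP.
  move=> t _ /=; rewrite lee_fin [leRHS]ger0_norm; last first.
    by rewrite mulr_ge0 ?invr_ge0 ?(ltW (onesqr_gt0 _))// mulr_ge0// addr_ge0// invr_ge0 exprn_ge0// ltW.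
  have [st|st] := leP s0 t; last first.
    rewrite /a st normr0 mulr_ge0 ?invr_ge0 ?(ltW (onesqr_gt0 _))// mulr_ge0// addr_ge0// invr_ge0 exprn_ge0// ltW//.
  have t0 := lt_le_trans s00 st.
  rewrite aE// ger0_norm ?mulr_ge0 ?invr_ge0 ?exprn_ge0 ?(ltW t0)//.
  rewrite ler_pdivlMr ?onesqr_gt0// /D -!mulrA ler_wpM2l// mulrDr mulr1 mulVf ?expf_neq0 ?gt_eqF//.
  rewrite addrC lerD2l lef_pV2 ?posrE ?exprn_gt0// lerXn2r ?nnegrE ?(ltW t0) ?(ltW s00)//.
apply: (@kernel_symbol_dilations R p a s0) => //; first by move=> t ts; rewrite /a ts.
move=> xi; pose N := enorm xi ^+ 2.
(* At the origin both sides are 0 thanks to the coordinate factors; elsewhere the tail integral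
   applies. *)
have [N0|N0] := eqVneq N 0.
  have e0 : enorm xi = 0 by apply/eqP; rewrite -sqrf_eq0 -/N N0.
  have c0 l : coord xi l = 0.
    by apply/eqP; rewrite -normr_le0 -e0 coord_le_enorm.
  rewrite !c0 !mul0r /Rintegral integral0_eq// => t _.
  by rewrite /p coordZ c0 mulr0 mul0r mulr0.
have Ngt0 : 0 < N by rewrite lt_neqAle eq_sym N0 sqr_ge0.
pose u (t : R) : R := 2 * t * expR (- N * t ^+ 2).
pose b (t : R) : R := if t < s0 then 0 else u t.
have cu : continuous u.
  move=> t; apply: cvgM; first by apply: cvgM; [exact: cvg_cst|exact: cvg_id].
  apply: (@continuous_comp _ _ _ (fun t : R => - N * t ^+ 2) expR); last exact: continuous_expR.
  by apply: cvgM; [exact: cvg_cst|exact: exprn_continuous].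
have mb : measurable_fun setT (b : mR -> R) by apply: mif; exact: continuous_measurable_fun.
have b0 t : 0 <= b t.
  rewrite /b; case: ltP => // st; rewrite /u !mulr_ge0 ?expR_ge0//.
  exact: le_trans (ltW s00) st.
have bint : (\int[leb]_t (b t)%:E = (expR (- N * s0 ^+ 2) / N)%:E)%E.
  rewrite -gauss_tail_integral// [RHS]integral_mkcond; apply: eq_integral => t _.
  rewrite patchE; case: ifPn => [|]; rewrite ?inE ?notin_setE/= in_itv/= andbT /b.
    by move=> st; rewrite ltNge st.
  by move=> /negP; rewrite -ltNge => ->.
have jb : leb.-integrable setT (EFin \o (b : mR -> R)).
  apply/integrableP; split; first exact/measurable_EFinP.
  by under eq_integral do rewrite /= ger0_norm//; rewrite bint ltry.
transitivity (\int[leb]_t (coord xi k * coord xi i * coord xi j * b t)).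
  rewrite RintegralZl// [\int[leb]_x b x]/Rintegral bint/= s0s gaussE -/N.
  rewrite (_ : - N * s = - s * N); last by ring.
  by rewrite -!mulrA [N^-1 * _]mulrC.
apply: eq_Rintegral => t _; rewrite /b.
case: ltP => [ts|st]; first by rewrite /a ts mulr0 mul0r.
have t0 := lt_le_trans s00 st.
rewrite aE// /p /u !coordZ gaussE enormZ exprMn real_normK ?num_real//.
rewrite (_ : - N * t ^+ 2 = - 1 * (t ^+ 2 * enorm xi ^+ 2)); last by rewrite /N; ring.
by field; rewrite gt_eqF.
Qed.

Definition leray_symbol i j (xi : E) : R :=
  (i == j)%:R - coord xi i * coord xi j / enorm xi ^+ 2.

Lemma leray_symbol_kernel k i j s : 0 < s ->
  kernel_symbol (fun xi => coord xi k * leray_symbol i j xi * gauss s xi).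
Proof.
move=> s0.
have K1 := sch_kernel_symbol (sch_coordM k (sch_gauss s0)).
have K := kernel_symbol_lin ((i == j)%:R - 1) (kernel_symbol_lin (-1) K1 (cubic_symbol k i j s0)) K1.
move: K; congr kernel_symbol; apply/funext => xi; rewrite /leray_symbol; ring.
Qed.

Lemma leray_symbol_bounded i j xi : `|leray_symbol i j xi| <= 2.
Proof.
rewrite /leray_symbol (le_trans (ler_normB _ _))// -[leRHS]/(1 + 1); apply: lerD.
  by case: (i == j); rewrite ?normr0// normr1.
have [->|N0] := eqVneq (enorm xi) 0; first by rewrite expr0n/= invr0 mulr0 normr0.
have Ngt0 : 0 < enorm xi by rewrite lt_neqAle eq_sym N0 enorm_ge0.
rewrite normrM [`|_^-1|]ger0_norm ?invr_ge0 ?sqr_ge0// ler_pdivrMr ?exprn_gt0// mul1r normrM expr2.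
by apply: ler_pM => //; exact: coord_le_enorm.
Qed.

Lemma measurable_leray_symbol i j : measurable_fun setT (leray_symbol i j : mE -> R).
Proof.
apply: measurable_funB => //; apply: measurable_funM.
  by apply: measurable_funM; exact: measurable_coord.
rewrite (_ : (fun x => _) = (fun x : mE => (enorm (x : E) ^+ 2) `^ (-1))).
  apply: (measurableT_comp (measurable_powR (-1))).
  by apply: measurable_funX; exact: measurable_enorm.
by apply/funext => x; rewrite powR_inv1// sqr_ge0.
Qed.

Lemma decay_cdecay8 h (M : R) : (forall x, (1 + enorm x) ^+ 8 * cmodulus (h x) <= M) -> cdecay8 h.
Proof.
move=> hM; split; exists M => x; apply: le_trans (hM x);
  rewrite ler_wpM2l ?exprn_ge0 ?one_enorm_ge0//; [exact: norm_Re_le|exact: norm_Im_le].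
Qed.

Lemma heat_kernel_symbol s : 0 < s -> kernel_symbol (fun xi : E => expR (- s * enorm xi ^+ 2)).
Proof. by move=> s0; exact: sch_kernel_symbol (sch_gauss s0). Qed.

Lemma fourier_multiplier m g xi : kernel_symbol m -> cL1 leb3 (g : mE -> C) ->
  fourier (multiplier_fun m g) xi = (m xi)%:C * fourier g xi.
Proof.
move=> km jg; have [_ h] := multiplier_cL1 km jg.
by rewrite !fourierE -!FTN h opprK.
Qed.

(* The derivative is what makes the kernel of the Leray projection integrable. *)
Lemma leray_heat_derivative g s k i j : csch g -> 0 < s ->
  let psi := multiplier_fun (leray_symbol i j)
    (multiplier_fun (fun xi => expR (- s * enorm xi ^+ 2)) g) in
  cL1 leb3 (cpderivs [:: k] psi : mE -> C) /\
  forall y, FT 1 (cpderivs [:: k] psi) y =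
    (0 -i* (coord y k * leray_symbol i j y * gauss s y)) * FT 1 g y.
Proof.
move=> sg s0 psi; have jg := csch_cL1 sg.
pose m := leray_symbol i j; pose c : C := (((2 * pi) ^+ 3)^-1)%:C.
pose a xi : C := c * ((m xi)%:C * ((gauss s xi)%:C * fourier g xi)).
have mm : measurable_fun setT (m : mE -> R) by exact: measurable_leray_symbol.
have mF : cmeas (fourier g : mE -> C).
  by rewrite (funext (fourierE g)); apply: cmeas_FT; case: jg.
have mgs : measurable_fun setT (gauss s : mE -> R) by exact: (sch_measurable (sch_gauss s0)).
have ma0 : cmeas (fun xi : mE => (m xi)%:C * ((gauss s xi)%:C * fourier g xi)).
  by apply: cmeasM; [exact: cmeas_real|apply: cmeasM => //; exact: cmeas_real].
have ma : cmeas (a : mE -> C) by apply: cmeasM => //; exact: cmeas_cst.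
have s1 : (-1 : R) ^+ 2 = 1 by rewrite sqrrN expr1n.
have bnd xi : cmodulus ((m xi)%:C * ((gauss s xi)%:C * fourier g xi)) <= 2 * cmodulus (FT (-1) g xi).
  rewrite fourierE !cmodulusM !cmodulus_real; apply: ler_pM => //.
  - by rewrite mulr_ge0 ?cmodulus_ge0.
  - exact: leray_symbol_bounded.
  - rewrite ler_piMl ?cmodulus_ge0// ger0_norm ?expR_ge0// gaussE -[leRHS]expR0 ler_expR.
    by rewrite mulNr oppr_le0 mulr_ge0 ?sqr_ge0// ltW.
have [M hM] := FT_csch_decay 8 s1 sg.
have da : cdecay8 a.
  apply: (@decay_cdecay8 _ (cmodulus c * (2 * M))) => xi.
  rewrite cmodulusM mulrCA ler_wpM2l ?cmodulus_ge0//.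
  apply: le_trans (ler_wpM2l _ (bnd xi)) _; first by rewrite exprn_ge0 ?one_enorm_ge0.
  by rewrite mulrCA ler_wpM2l.
(* [psi] is in general not integrable, but it is the Fourier integral of the rapidly decaying [a]
   and can be differentiated under the integral sign. *)
have psiE : psi = FT 1 a.
  apply/funext => x; rewrite [LHS]inv_fourierE -/c -FTZ.
    congr FT; apply/funext => xi; rewrite /a fourier_multiplier//; exact: heat_kernel_symbol.
  rewrite (_ : (fun x => _) = (fun xi => (m xi)%:C * ((gauss s xi)%:C * fourier g xi))); last first.
    by apply/funext => xi; rewrite fourier_multiplier//; exact: heat_kernel_symbol.
  have [M' hM'] := FT_csch_decay 6 s1 sg.
  apply: (@decay_cL1 _ _ (2 * M')) => // xi.
  apply: le_trans (ler_wpM2l _ (bnd xi)) _; first by rewrite exprn_ge0 ?one_enorm_ge0.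
  by rewrite mulrCA ler_wpM2l.
pose kap xi := coord xi k * m xi * gauss s xi.
have kk : kernel_symbol kap by exact: leray_symbol_kernel.
have [jk hk] := multiplier_cL1 kk jg.
have dE : cpderivs [:: k] psi = (fun x => 'i * multiplier_fun kap g x).
  apply/funext => x; rewrite psiE; have [_ _ /(_ k)] := FT_diff 1 x ma da.
  rewrite /cpderivs/= => ->; rewrite [in RHS]/multiplier_fun inv_fourierE -/c mulrA -FTZ; last first.
    have [jkap _ _] := kk.
    under eq_fun do rewrite mulrC.
    apply: (@cL1M_bounded _ _ _ _ _ _ (\int[leb3]_x cmodulus (g x)) (cL1_real jkap)) => // xi.
    by rewrite fourierE; exact: FT_bound.
  congr FT; apply/funext => xi; rewrite /a /kap !rmorphM/= mul1r.
  rewrite (_ : 0 +i* coord xi k = 'i * (coord xi k)%:C); last by apply: eq_cplx; rewrite ?ReM ?ImM/=; ring.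
  by ring.
split; first by rewrite dE; exact: cL1Z.
move=> y; rewrite dE FTZ// hk mulrA; congr (_ * _).
rewrite /kap /m /leray_symbol gaussE !coordN !enormN gaussE.
by apply: eq_cplx; rewrite ?ReM ?ImM/=; ring.
Qed.

End leray_symbol.

(** * Plane waves *)

Section waves.
Context {R : realType}.
Local Open Scope complex_scope.
Local Notation C := R[i].
Local Notation mR := (measurableTypeR R).
Local Notation E := (R * R * R)%type.
Local Notation mE := (mR * mR * mR)%type.
Local Notation leb := (@lebesgue_measure R).
Local Notation coord := (@Defs.coord R).
Local Notation basis := (@Defs.basis R).
Implicit Types (F G g h : E -> C) (m f p b : E -> R) (x y z : E) (i j k : 'I_3) (s th : R).

Lemma cmodulus_sum (I : Type) (s : seq I) (u : I -> C) :
  cmodulus (\sum_(q <- s) u q) <= \sum_(q <- s) cmodulus (u q).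
Proof.
elim: s => [|q s IH]; first by rewrite !big_nil cmodulus0.
by rewrite !big_cons (le_trans (cmodulusD _ _))// lerD2l.
Qed.

Definition wave z th x : R := cos (dot x z - th).

Definition wave_coef F z th : C := cint leb3 (fun x : mE => (wave z th x)%:C * F x).

Lemma wave_le1 z th x : `|wave z th x| <= 1.
Proof. by rewrite ler_norml cos_geN1 cos_le1. Qed.

Lemma measurable_wave z th : measurable_fun setT (wave z th : mE -> R).
Proof.
apply: (measurableT_comp (continuous_measurable_fun (@continuous_cos R))).
by apply: measurable_funB => //; exact: measurable_dot.
Qed.

Lemma cL1_bounded_mul b F (M : R) : measurable_fun setT (b : mE -> R) ->
  (forall x, `|b x| <= M) -> cL1 leb3 (F : mE -> C) -> cL1 leb3 (fun x : mE => (b x)%:C * F x).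
Proof.
move=> mb bM jF; apply: (@cL1M_bounded _ _ _ _ _ _ M jF); first exact: cmeas_real.
by move=> x; rewrite cmodulus_real.
Qed.

Lemma cL1_wave z th F : cL1 leb3 (F : mE -> C) -> cL1 leb3 (fun x : mE => (wave z th x)%:C * F x).
Proof. exact: cL1_bounded_mul (measurable_wave z th) (wave_le1 z th). Qed.

(** Euler's formula: testing against a wave is evaluating the transform at z and -z. All later
    statements about waves reduce to this. *)
Lemma wave_coefE F z th : cL1 leb3 (F : mE -> C) ->
  wave_coef F z th = (2^-1)%:C * (cis (- th) * FT 1 F z + cis th * FT 1 F (- z)).
Proof.
move=> jF; have j1 := cL1_cis 1 z jF; have j2 := cL1_cis 1 (- z) jF.
rewrite -!cintZ// -cintD; [|exact: cL1Z..].
rewrite -cintZ; last by apply: cL1D; exact: cL1Z.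
apply: eq_cint => x; rewrite dotC [dot x (- z)]dotC dotNl /wave dotC /cis !mul1r cosB cosN sinN.
rewrite ![F x * _]mulrC !mulrA -!mulrDl mulrA; congr (_ * F x).
by rewrite cosN sinN; apply: eq_cplx; rewrite ?ReM ?ImM ?ReD ?ImD ?ReM ?ImM/=; field.
Qed.

Lemma wave_coef_le F z th : cL1 leb3 (F : mE -> C) ->
  cmodulus (wave_coef F z th) <= \int[leb3]_x cmodulus (F x).
Proof.
move=> jF; have jw := cL1_wave z th jF.
rewrite (le_trans (cmodulus_cint_le jw))//; apply: le_Rintegral => //.
- exact: jw.2.
- exact: jF.2.
- by move=> x _; rewrite cmodulusM cmodulus_real ler_piMl ?cmodulus_ge0// wave_le1.
Qed.

Lemma wave_coef_multiplier m g z th : kernel_symbol m -> cL1 leb3 (g : mE -> C) ->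
  m (- z) = m z -> wave_coef (multiplier_fun m g) z th = (m z)%:C * wave_coef g z th.
Proof.
move=> km jg mz; have [j e] := multiplier_cL1 km jg.
by rewrite !wave_coefE// !e opprK mz; ring.
Qed.

Lemma wave_coef_odd F g z th (r : E -> R) : cL1 leb3 (g : mE -> C) -> cL1 leb3 (F : mE -> C) ->
  (forall y, FT 1 F y = (0 -i* r y) * FT 1 g y) -> r (- z) = - r z ->
  wave_coef F z th = (r z)%:C * wave_coef g z (th + pi / 2).
Proof.
move=> jg jF e rz; rewrite !wave_coefE// !e rz opprK.
have -> : cis (th + pi / 2) = cis th * (0 +i* 1).
  by rewrite cisD; congr (_ * _); rewrite /cis cos_pihalf sin_pihalf.
have -> : cis (- (th + pi / 2)) = cis (- th) * (0 -i* 1).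
  by rewrite opprD cisD; congr (_ * _); rewrite /cis cosN sinN cos_pihalf sin_pihalf.
rewrite (_ : 0 -i* r z = (0 -i* 1) * (r z)%:C); last by apply: eq_cplx; rewrite ?ReM ?ImM/=; ring.
rewrite (_ : 0 +i* r z = (0 +i* 1) * (r z)%:C); last by apply: eq_cplx; rewrite ?ReM ?ImM/=; ring.
by ring.
Qed.

Lemma cint_wave_sum (I : Type) (s : seq I) (c : I -> R) (z : I -> E) (th : I -> R) F :
  cL1 leb3 (F : mE -> C) ->
  cint leb3 (fun x : mE => (\sum_(q <- s) c q * wave (z q) (th q) x)%:C * F x) =
  \sum_(q <- s) (c q)%:C * wave_coef F (z q) (th q).
Proof.
move=> jF.
have jq q : cL1 leb3 (fun x : mE => (c q)%:C * ((wave (z q) (th q) x)%:C * F x)).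
  by apply: cL1Z; exact: cL1_wave.
have [_ e] := cint_sum s jq.
transitivity (cint leb3 (fun x : mE => \sum_(q <- s) (c q)%:C * ((wave (z q) (th q) x)%:C * F x))); last first.
  by rewrite e; apply: eq_bigr => q _; rewrite cintZ//; exact: cL1_wave.
by apply: eq_cint => x; rewrite rmorph_sum mulr_suml; apply: eq_bigr => q _; rewrite rmorphM/= mulrA.
Qed.

(* Multiplication by such a [b] only sees the Fourier transform on [D]. *)
Definition annihilates (D : set E) b :=
  [/\ measurable_fun setT (b : mE -> R), exists M, forall x, `|b x| <= M &
    forall F, cL1 leb3 (F : mE -> C) -> (forall z, D z -> FT 1 F z = 0) ->
      cint leb3 (fun x : mE => (b x)%:C * F x) = 0].

Lemma annihilates_wave (D : set E) z th : D z -> D (- z) -> annihilates D (wave z th).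
Proof.
move=> Dz DNz; split; [exact: measurable_wave|by exists 1 => x; exact: wave_le1|].
by move=> F jF F0; rewrite -/(wave_coef F z th) wave_coefE// !F0// !mulr0 addr0 mulr0.
Qed.

Lemma annihilates0 (D : set E) : annihilates D (fun=> 0).
Proof.
split; first exact: measurable_cst; first by exists 0 => x; rewrite normr0.
by move=> F _ _; apply: cint_eq0 => x; rewrite mul0r.
Qed.

Lemma annihilatesD (D : set E) b b' : annihilates D b -> annihilates D b' ->
  annihilates D (fun x => b x + b' x).
Proof.
move=> [mb [M hM] hb] [mb' [M' hM'] hb']; split; first exact: measurable_funD.
  by exists (M + M') => x; rewrite (le_trans (ler_normD _ _))// lerD.
move=> F jF F0; transitivity (cint leb3 (fun x : mE => (b x)%:C * F x + (b' x)%:C * F x)); last first.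
  by rewrite cintD ?hb ?hb' ?addr0//; [exact: cL1_bounded_mul hM _|exact: cL1_bounded_mul hM' _].
by apply: eq_cint => x; rewrite rmorphD mulrDl.
Qed.

(** The transform of b' F at z in D is b' tested against F cis(z . x), whose transform is that of F
    shifted by z; closure of D under addition keeps it zero on D. *)
Lemma annihilatesM (D : set E) b b' : (forall y z, D y -> D z -> D (y + z)) ->
  annihilates D b -> annihilates D b' -> annihilates D (fun x => b x * b' x).
Proof.
move=> DD [mb [M hM] hb] [mb' [M' hM'] hb']; split; first exact: measurable_funM.
  exists (M * M') => x; rewrite normrM; exact: ler_pM.
move=> F jF F0; have jG := cL1_bounded_mul mb' hM' jF.
transitivity (cint leb3 (fun x : mE => (b x)%:C * ((b' x)%:C * F x))); last first.
  apply: hb => // z Dz; rewrite /FT.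
  have jFz := cL1_cis 1 z jF.
  under eq_cint do rewrite -mulrA.
  apply: hb' => // z' Dz'; rewrite -[RHS](F0 _ (DD _ _ Dz Dz')).
  apply: eq_cint => x; rewrite -mulrA -cisD; congr (_ * cis _).
  by rewrite !dotE/=; ring.
by apply: eq_cint => x; rewrite rmorphM/= mulrA.
Qed.

(** For [wsum], an infinite sum of waves: uniformly bounded pointwise limits pass through the
    integral by dominated convergence. *)
Lemma annihilates_lim (D : set E) (bn : nat -> E -> R) b (M : R) :
  (forall n, annihilates D (bn n)) -> (forall n x, `|bn n x| <= M) ->
  (forall x, (fun n => bn n x) @ \oo --> b x) -> annihilates D b.
Proof.
move=> an hM bnb.
have mb : measurable_fun setT (b : mE -> R).
  by apply: (@measurable_fun_cvg _ _ _ _ bn) => [n|x _]; [have [] := an n|exact: bnb].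
split=> //.
  exists M => x; apply: (ler_cvg_to (cvg_norm (bnb x)) (cvg_cst M)); exact: nearW.
move=> F jF F0.
have jMF := rintegrableZ M jF.2.
have mn n : cmeas (fun x : mE => (bn n x)%:C * F x).
  by apply: cmeasM; [apply: cmeas_real; have [] := an n|case: jF].
have cn x : (fun n => cmodulus ((bn n x)%:C * F x - (b x)%:C * F x)) @ \oo --> (0 : R).
  rewrite (_ : (fun n => _) = (fun n => `|bn n x - b x| * cmodulus (F x))); last first.
    by apply/funext => n; rewrite -mulrBl -(rmorphB (real_complex R)) cmodulusM cmodulus_real.
  rewrite -[X in _ --> X](mul0r (cmodulus (F x))); apply: cvgM; last exact: cvg_cst.
  rewrite -(normr0 R); apply: cvg_norm; rewrite -(subrr (b x)).
  by apply: cvgB; [exact: bnb|exact: cvg_cst].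
have bd n x : cmodulus ((bn n x)%:C * F x) <= M * cmodulus (F x).
  by rewrite cmodulusM cmodulus_real ler_wpM2r ?cmodulus_ge0.
have := cint_dominated mn cn jMF bd.
rewrite (_ : (fun n => _) = (fun n : nat => cmodulus (0 - cint leb3 (fun x : mE => (b x)%:C * F x)))); last first.
  by apply/funext => n; have [_ _ ->] := an n.
move=> h; apply: (@cvg_cmodulus_unique R (fun=> 0)); first by move: h.
by rewrite subrr cmodulus0; exact: cvg_cst.
Qed.

Lemma annihilates_sum (I : Type) (s : seq I) (D : set E) (b : I -> E -> R) :
  (forall q, annihilates D (b q)) -> annihilates D (fun x => \sum_(q <- s) b q x).
Proof.
move=> ab; elim: s => [|i s IH].
  by under eq_fun do rewrite big_nil; exact: annihilates0.
by under eq_fun do rewrite big_cons; exact: annihilatesD.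
Qed.

Lemma annihilatesZ (D : set E) (c : R) b : annihilates D b -> annihilates D (fun x => c * b x).
Proof.
move=> [mb [M hM] hb]; split; first exact: measurable_funM.
  by exists (`|c| * M) => x; rewrite normrM ler_wpM2l.
move=> F jF F0; transitivity (cint leb3 (fun x : mE => c%:C * ((b x)%:C * F x))); last first.
  by rewrite cintZ ?hb ?mulr0//; exact: cL1_bounded_mul hM _.
by apply: eq_cint => x; rewrite rmorphM/= mulrA.
Qed.

End waves.

(** * The shear flow *)

Section shear_flow.
Context {R : realType}.
Local Open Scope complex_scope.
Local Notation C := R[i].
Local Notation mR := (measurableTypeR R).
Local Notation E := (R * R * R)%type.
Local Notation mE := (mR * mR * mR)%type.
Local Notation leb := (@lebesgue_measure R).
Local Notation coord := (@Defs.coord R).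
Local Notation basis := (@Defs.basis R).
Implicit Types (x y z : E) (t nu : R) (n : nat).

Definition freq n : R := 2 ^+ n.

Lemma freq_gt0 n : 0 < freq n. Proof. exact: exprn_gt0. Qed.

Variables (m r : nat) (A : R).
Hypothesis A0 : 0 <= A.

Definition kvec n : E := (0, freq n, 0).
Definition zvec nu : E := (1, nu, 0).
(* Each Picard iterate is shifted by pi/2, the effect of differentiating in the first variable:
   with this choice all coefficients are nonnegative. *)
Definition phase (j : nat) : R := (j%:R - 1) * (pi / 2).

Definition vcoef n t := A * freq n * expR (- freq n ^+ 2 * t).

Definition vel t x := \sum_(n <- iota m r) vcoef n t * wave (kvec n) 0 x.

(* A plane wave [mcoef t * cos (x1 + mfreq * x2 - phase j)] of the [j]-th Picard iterate. *)
Record mode := Mode {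
  mcoef : R -> R; mfreq : R; mbound : R;
  mcoef_measurable : measurable_fun setT (mcoef : mR -> R);
  mcoef_le : forall t, 0 <= mcoef t <= mbound }.

(** Cut off at negative times, where the exponential is unbounded: [mcoef_le] asks for a bound at
    every real t. *)
Definition coef0 n t : R := if t < 0 then 0 else A * freq n * expR (- (1 + freq n ^+ 2) * t).

Lemma expR_decay_le1 (a t : R) : 0 <= a -> 0 <= t -> expR (- a * t) <= 1.
Proof. by move=> a0 t0; rewrite -expR0 ler_expR mulNr oppr_le0 mulr_ge0. Qed.

Lemma measurable_expR_affine (a b : R) : measurable_fun setT (fun t : mR => expR (a * t + b)).
Proof.
apply: (measurableT_comp (continuous_measurable_fun (@continuous_expR R))).
by apply: measurable_funD => //; apply: measurable_funM.
Qed.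

Lemma coef0_measurable n : measurable_fun setT (coef0 n : mR -> R).
Proof.
apply: measurable_fun_ifT => //.
  by apply: measurable_fun_ltr; [exact: measurable_id|exact: measurable_cst].
apply: measurable_funM => //.
by have := measurable_expR_affine (- (1 + freq n ^+ 2)) 0; under eq_fun do rewrite addr0.
Qed.

Lemma coef0_le n t : 0 <= coef0 n t <= A * freq n.
Proof.
have Af : 0 <= A * freq n by rewrite mulr_ge0// ltW ?freq_gt0.
rewrite /coef0; case: ltP => [|t0]; first by rewrite lexx Af.
by rewrite mulr_ge0 ?expR_ge0//= ler_piMr// expR_decay_le1// addr_ge0// sqr_ge0.
Qed.

Definition mode0 n := Mode (freq n) (coef0_measurable n) (coef0_le n).

(** The factor 1/2 comes from writing a product of cosines as a sum, and 1 + nu^2 is |zvec nu|^2.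
    The endpoint tau = t is excluded because no heat smoothing is left there; extension by 0 makes
    it a function on the whole line. *)
Definition duhamel_integrand n nu (c : R -> R) t (tau : R) : R :=
  if (0 <= tau) && (tau < t) then
    2^-1 * vcoef n tau * expR (- (1 + nu ^+ 2) * (t - tau)) * c tau else 0.

Definition duhamel n nu c t : R := \int[leb]_tau duhamel_integrand n nu c t tau.

Lemma vcoef_ge0 n t : 0 <= vcoef n t.
Proof. by rewrite /vcoef mulr_ge0 ?expR_ge0// mulr_ge0// ltW ?freq_gt0. Qed.

Lemma vcoef_le n t : 0 <= t -> vcoef n t <= A * freq n.
Proof.
move=> t0; rewrite ler_piMr ?expR_decay_le1 ?sqr_ge0//.
by rewrite mulr_ge0// ltW ?freq_gt0.
Qed.

Lemma vcoef_measurable n : measurable_fun setT (vcoef n : mR -> R).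
Proof.
apply: measurable_funM => //.
by have := measurable_expR_affine (- freq n ^+ 2) 0; under eq_fun do rewrite addr0.
Qed.

Lemma duhamel_integrand_measurable2 n nu c : measurable_fun setT (c : mR -> R) ->
  measurable_fun setT (fun z : mR * mR => duhamel_integrand n nu c z.1 z.2).
Proof.
move=> mc.
have m1 : measurable_fun setT (fun z : mR * mR => z.1) by exact: measurable_fst.
have m2 : measurable_fun setT (fun z : mR * mR => z.2) by exact: measurable_snd.
apply: measurable_fun_ifT => //.
  apply: measurable_and; first by apply: measurable_fun_ler => //; exact: measurable_cst.
  exact: measurable_fun_ltr.
apply: measurable_funM; last exact: (measurableT_comp mc m2).
apply: measurable_funM.
  by apply: measurable_funM => //; exact: (measurableT_comp (vcoef_measurable n) m2).
apply: (measurableT_comp (continuous_measurable_fun (@continuous_expR R))).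
by apply: measurable_funM => //; exact: measurable_funB.
Qed.

Lemma duhamel_integrand_measurable n nu c t : measurable_fun setT (c : mR -> R) ->
  measurable_fun setT (duhamel_integrand n nu c t : mR -> R).
Proof.
move=> mc; exact: (measurable_fun_pair2 t (duhamel_integrand_measurable2 n nu mc)).
Qed.

Lemma duhamel_integrand_bounds n nu c t tau K : (forall t, 0 <= c t <= K) ->
  0 <= duhamel_integrand n nu c t tau <=
    (if (0 <= tau) && (tau < t) then 2^-1 * vcoef n tau * K else 0).
Proof.
move=> cK; rewrite /duhamel_integrand; case: ifP => [/andP[t0 tt]|_]; last by rewrite lexx.
have /andP[c0 c1] := cK tau; have v0 : 0 <= 2^-1 * vcoef n tau by rewrite mulr_ge0 ?vcoef_ge0.
rewrite mulr_ge0 ?(mulr_ge0 v0 (expR_ge0 _))//=.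
apply: ler_pM => //; first by rewrite mulr_ge0 ?expR_ge0.
rewrite ler_piMr//; apply: expR_decay_le1; first by rewrite addr_ge0 ?sqr_ge0.
by rewrite subr_ge0 ltW.
Qed.

(** The decay of v alone gives integrability in time: A f e^(-f^2 tau), with f = 2^n, is A/f times
    the exponential density of rate f^2. The heat factor of w is only bounded by 1. Hence one Picard
    step gains A/f instead of costing A f. *)
Lemma duhamel_integrand_le n nu c t tau K : (forall t, 0 <= c t <= K) ->
  duhamel_integrand n nu c t tau <= (2^-1 * A / freq n * K) * exponential_pdf (freq n ^+ 2) tau.
Proof.
move=> cK; have K0 : 0 <= K by have /andP[] := cK 0; exact: le_trans.
have f0 := freq_gt0 n.
have /andP[_] := duhamel_integrand_bounds n nu t tau cK; move=> /le_trans; apply.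
case: ifP => [/andP[t0 _]|_].
  rewrite exponential_pdfE// le_eqVlt; apply/orP; left; apply/eqP.
  by rewrite /vcoef; field; rewrite gt_eqF.
apply: mulr_ge0; last by rewrite exponential_pdf_ge0// exprn_ge0// ltW.
by rewrite mulr_ge0// divr_ge0 ?mulr_ge0// ltW.
Qed.

Lemma duhamel_integrable n nu c t K : measurable_fun setT (c : mR -> R) ->
  (forall t, 0 <= c t <= K) ->
  leb.-integrable setT (EFin \o (duhamel_integrand n nu c t : mR -> R)).
Proof.
move=> mc cK; have f20 : 0 < freq n ^+ 2 by rewrite exprn_gt0 ?freq_gt0.
have jE := rintegrableZ (2^-1 * A / freq n * K) (integrable_exponential_pdf f20).
apply: (le_integrable measurableT _ _ jE).
  by apply/measurable_EFinP; exact: duhamel_integrand_measurable.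
move=> tau _ /=; rewrite lee_fin ger0_norm; last by have /andP[] := duhamel_integrand_bounds n nu t tau cK.
by rewrite (le_trans (duhamel_integrand_le n nu t tau cK))// ler_norm.
Qed.

Lemma duhamel_le n nu c K : measurable_fun setT (c : mR -> R) ->
  (forall t, 0 <= c t <= K) -> forall t, 0 <= duhamel n nu c t <= 2^-1 * A / freq n * K.
Proof.
move=> mc cK t; have f20 : 0 < freq n ^+ 2 by rewrite exprn_gt0 ?freq_gt0.
have jx := integrable_exponential_pdf f20.
apply/andP; split.
  by apply: Rintegral_ge0 => tau _; have /andP[] := duhamel_integrand_bounds n nu t tau cK.
have -> : 2^-1 * A / freq n * K =
    \int[leb]_tau ((2^-1 * A / freq n * K) * exponential_pdf (freq n ^+ 2) tau).
  by rewrite RintegralZl// /(\int[leb]_x exponential_pdf _ x) /Rintegral integral_exponential_pdf// mulr1.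
apply: le_Rintegral => //.
- exact: (duhamel_integrable _ _ _ mc cK).
- exact: rintegrableZ.
- by move=> tau _; exact: duhamel_integrand_le.
Qed.

Lemma duhamel_measurable n nu c : measurable_fun setT (c : mR -> R) ->
  measurable_fun setT (duhamel n nu c : mR -> R).
Proof.
by move=> mc; exact: (@measurable_rint R _ _ mR mR leb _ (duhamel_integrand_measurable2 n nu mc)).
Qed.

Definition shifted_freq n (b : bool) nu := if b then nu - freq n else nu + freq n.

(* The product of [cos (2^n x2)] with the wave [p] consists of two waves, of frequencies
   [mfreq p + 2^n] and [mfreq p - 2^n]. *)
Definition child n b p :=
  let nu := shifted_freq n b (mfreq p) in
  @Mode (duhamel n nu (mcoef p)) nu _ (duhamel_measurable n nu (@mcoef_measurable p))
    (duhamel_le n nu (@mcoef_measurable p) (@mcoef_le p)).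

(** Modes of equal frequency are not merged: the list is the tree of all interactions, so sums over
    it split by parent ([sum_levelS]). *)
Fixpoint level (j : nat) : seq mode :=
  if j is j'.+1 then
    flatten [seq flatten [seq [:: child n false p; child n true p] | n <- iota m r] | p <- level j']
  else map mode0 (iota m r).

Lemma sum_level0 (V : nmodType) (G : mode -> V) :
  \sum_(p <- level 0) G p = \sum_(n <- iota m r) G (mode0 n).
Proof. by rewrite /= big_map. Qed.

Lemma sum_levelS (V : nmodType) j (G : mode -> V) :
  \sum_(p <- level j.+1) G p =
  \sum_(p <- level j) \sum_(n <- iota m r) (G (child n false p) + G (child n true p)).
Proof.
rewrite /= big_flatten/= big_map; apply: eq_bigr => p _.
rewrite big_flatten/= big_map; apply: eq_bigr => n _.
by rewrite !big_cons big_nil addr0.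
Qed.

Definition eps := \sum_(n <- iota m r) A / freq n.
Definition amp := \sum_(n <- iota m r) A * freq n.

Lemma eps_ge0 : 0 <= eps.
Proof. by apply: sumr_ge0 => n _; rewrite mulr_ge0// invr_ge0 ltW ?freq_gt0. Qed.

Lemma amp_ge0 : 0 <= amp.
Proof. by apply: sumr_ge0 => n _; rewrite mulr_ge0// ltW ?freq_gt0. Qed.

(** Each of the two children of a mode under 2^n carries half of A / 2^n times the parent's bound,
    so summation over both and over n multiplies the total by [eps]. *)
Lemma level_bound j : \sum_(p <- level j) mbound p = eps ^+ j * amp.
Proof.
elim: j => [|j IH]; first by rewrite sum_level0 expr0 mul1r.
rewrite sum_levelS exprS -mulrA -IH mulr_sumr; apply: eq_bigr => p _.
rewrite /eps mulr_suml; apply: eq_bigr => n _ /=.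
by field; rewrite gt_eqF ?freq_gt0.
Qed.

Definition wlev j t x := \sum_(p <- level j) mcoef p t * wave (zvec (mfreq p)) (phase j) x.

Lemma wlev_le j t x : `|wlev j t x| <= eps ^+ j * amp.
Proof.
rewrite -level_bound (le_trans (ler_norm_sum _ _ _))//; apply: ler_sum => p _.
have /andP[c0 cK] := mcoef_le p t.
by rewrite normrM (ger0_norm c0) (le_trans _ cK)// ler_piMr// wave_le1.
Qed.

Definition wpart n t x := \sum_(0 <= j < n) wlev j t x.

Definition wsum t x : R := limn (fun n => wpart n t x).

Hypothesis eps_half : eps <= 2^-1.

Lemma wpart_cvg t x : (fun n => wpart n t x) @ \oo --> wsum t x.
Proof.
suff : cvgn (series (fun j => wlev j t x)) by [].
apply: normed_cvg; apply: (@series_le_cvg _ _ (geometric amp eps)) => //=.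
- by move=> n; rewrite mulr_ge0 ?amp_ge0// exprn_ge0// eps_ge0.
- by move=> n; rewrite mulrC; exact: wlev_le.
- apply: is_cvg_geometric_series; rewrite ger0_norm ?eps_ge0// (le_lt_trans eps_half)//.
  by rewrite invf_lt1// ltr1n.
Qed.

Lemma geometric_tail n k : \sum_(n <= j < n + k) eps ^+ j * amp <= 2 * eps ^+ n * amp.
Proof.
(* The induction on k needs the deficit 2 * 2^-k; it is filled by the next term because eps <=
   1/2. *)
suff h : \sum_(n <= j < n + k) eps ^+ j * amp <= (2 - 2 * 2^-1 ^+ k) * eps ^+ n * amp.
  apply: le_trans h _; rewrite -!mulrA ler_wpM2r ?mulr_ge0 ?amp_ge0 ?exprn_ge0 ?eps_ge0//.
  by rewrite gerBl mulr_ge0// exprn_ge0.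
elim: k => [|k IH].
  by rewrite addn0 big_geq// expr0 mulr1 subrr !mul0r.
rewrite addnS big_nat_recr ?leq_addr//=; apply: le_trans (lerD IH (lexx _)) _.
have h : eps ^+ (n + k) * amp <= 2^-1 ^+ k * eps ^+ n * amp.
  rewrite ler_wpM2r ?amp_ge0// exprD mulrC ler_wpM2r ?exprn_ge0 ?eps_ge0//.
  by apply: lerXn2r; rewrite ?nnegrE ?eps_ge0.
apply: le_trans (lerD (lexx _) h) _; rewrite exprS.
by rewrite le_eqVlt; apply/orP; left; apply/eqP; field.
Qed.

Lemma wpart_tail n k t x : `|wpart (n + k) t x - wpart n t x| <= 2 * eps ^+ n * amp.
Proof.
have -> : wpart (n + k) t x - wpart n t x = \sum_(n <= j < n + k) wlev j t x.
  by rewrite [wpart (n + k) t x](big_cat_nat (leq0n n) (leq_addr k n))/= addrAC subrr add0r.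
rewrite (le_trans (ler_norm_sum _ _ _))// (le_trans _ (geometric_tail n k))//.
by apply: ler_sum => j _; exact: wlev_le.
Qed.

Lemma wsum_tail n t x : `|wsum t x - wpart n t x| <= 2 * eps ^+ n * amp.
Proof.
have h : (fun k => `|wpart k t x - wpart n t x|) @ \oo --> `|wsum t x - wpart n t x|.
  by apply: cvg_norm; apply: cvgB; [exact: wpart_cvg|exact: cvg_cst].
apply: (ler_cvg_to h (cvg_cst (2 * eps ^+ n * amp))); near=> k.
have nk : (n <= k)%N by near: k; exact: nbhs_infty_ge.
by rewrite -(subnKC nk); exact: wpart_tail.
Unshelve. all: by end_near. Qed.

Lemma wpart_le n t x : `|wpart n t x| <= 2 * amp.
Proof.
have := wpart_tail 0 n t x.
by rewrite add0n [wpart 0 t x]/wpart big_geq// subr0 expr0 mulr1.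
Qed.

Lemma wsum_le t x : `|wsum t x| <= 2 * amp.
Proof. by have := wsum_tail 0 t x; rewrite [wpart 0 t x]/wpart big_geq// subr0 expr0 mulr1. Qed.

Lemma vel_le t x : 0 <= t -> `|vel t x| <= amp.
Proof.
move=> t0; rewrite (le_trans (ler_norm_sum _ _ _))//; apply: ler_sum => n _.
rewrite normrM (ger0_norm (vcoef_ge0 _ _)) (le_trans _ (vcoef_le n t0))//.
by rewrite ler_piMr ?vcoef_ge0// wave_le1.
Qed.

Definition flow t (i : 'I_3) : E -> R := nth (fun=> 0) [:: vel t; (fun=> 0); wsum t] i.

Lemma flowE t : (flow t 0 = vel t) * (flow t 1 = (fun=> 0)) * (flow t 2%:R = wsum t).
Proof. by []. Qed.

Lemma measurable_wave2 z th : measurable_fun setT (fun u : mR * mE => wave z th u.2).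
Proof. exact: (measurableT_comp (measurable_wave z th) (@measurable_snd _ _ mR mE)). Qed.

Lemma flow_measurable i : measurable_fun setT (fun z : mR * mE => flow z.1 i z.2).
Proof.
have m1 : measurable_fun setT (fun z : mR * mE => z.1) by exact: measurable_fst.
elim/forall_ord3: i.
- under eq_fun do rewrite flowE; apply: measurable_sum => n.
  apply: measurable_funM; last exact: measurable_wave2.
  exact: (measurableT_comp (vcoef_measurable n) m1).
- by under eq_fun do rewrite flowE; exact: measurable_cst.
- under eq_fun do rewrite flowE.
  apply: (@measurable_fun_cvg _ _ _ _ (fun n (z : mR * mE) => wpart n z.1 z.2)) => [n|z _]; last exact: wpart_cvg.
  apply: measurable_sum => j; apply: measurable_sum => p.
  apply: measurable_funM; last exact: measurable_wave2.
  exact: (measurableT_comp (@mcoef_measurable p) m1).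
Qed.

Lemma flow_le t i x : 0 <= t -> `|flow t i x| <= 2 * amp.
Proof.
move=> t0; elim/forall_ord3: i; rewrite flowE.
- by rewrite (le_trans (vel_le _ t0))// ler_peMl ?amp_ge0// ler1n.
- by rewrite normr0 mulr_ge0 ?amp_ge0.
- exact: wsum_le.
Qed.

Definition plane i : set E := [set z | coord z i = 0].

Lemma planeD i y z : plane i y -> plane i z -> plane i (y + z).
Proof. by rewrite /plane/= coordD => -> ->; rewrite addr0. Qed.

Lemma planeN i y : plane i y -> plane i (- y).
Proof. by rewrite /plane/= coordN => ->; rewrite oppr0. Qed.

(** The frequencies of v lie on the second axis, hence in both the planes xi_1 = 0 and xi_3 = 0. *)
Lemma vel_annihilates t i : i != 1 -> annihilates (plane i) (vel t).
Proof.
move=> i1; apply: annihilates_sum => n; apply: annihilatesZ.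
have h : plane i (kvec n) by elim/forall_ord3: i i1.
by apply: annihilates_wave => //; exact: planeN.
Qed.

Lemma wpart_annihilates n t : annihilates (plane 2%:R) (wpart n t).
Proof.
apply: annihilates_sum => j; apply: annihilates_sum => p; apply: annihilatesZ.
have h : plane 2%:R (zvec (mfreq p)) by [].
by apply: annihilates_wave => //; exact: planeN.
Qed.

Lemma wsum_annihilates t : annihilates (plane 2%:R) (wsum t).
Proof.
apply: (@annihilates_lim R _ (fun n => wpart n t) _ (2 * amp)) => [n|n x|x].
- exact: wpart_annihilates.
- exact: wpart_le.
- exact: wpart_cvg.
Qed.

Lemma FT_csch_derive (g : E -> C) k : csch g ->
  cL1 leb3 (cpderivs [:: k] g : mE -> C) /\
  forall y, FT 1 (cpderivs [:: k] g) y = (0 -i* coord y k) * FT 1 g y.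
Proof.
move=> sg; have [sr si] := sg.
have jd : cL1 leb3 (cpderivs [:: k] g : mE -> C).
  by apply: csch_cL1; split; exact: sch_derive.
split=> // y; rewrite FT_real_split// [in RHS]FT_real_split; last exact: csch_cL1.
by rewrite /= !FT_sch_derive// mul1r; ring.
Qed.

(** The i-th component has all its frequencies in the plane xi_i = 0, where the symbol of the i-th
    derivative vanishes. *)
Lemma flow_div_free t : 0 <= t -> div_free (of_field (flow t)).
Proof.
move=> t0 g /schwartz_csch sg.
have z i b : annihilates (plane i) b ->
    cintegral (fun x => (b x)%:C * cpderivs [:: i] g x) = 0.
  move=> [_ _ h]; have [j e] := FT_csch_derive i sg.
  by apply: h => // y; rewrite /plane/= => yi; rewrite e yi oppr0 mul0r.
have h i : cintegral (fun x => (flow t i x)%:C * cpderivs [:: i] g x) = 0.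
  elim/forall_ord3: i.
  - exact: (z 0 (vel t) (vel_annihilates t (i := 0) isT)).
  - exact: (z 1 (fun=> 0) (annihilates0 _)).
  - exact: (z 2%:R (wsum t) (wsum_annihilates t)).
by apply: big1 => i _; exact: etrans (congr1 -%R (h i)) (oppr0 _).
Qed.

(** At t = 0 the symbol is the constant 1, which is not a [kernel_symbol]; Fourier inversion for
    Schwartz functions handles that case. *)
Lemma wave_coef_heat t (g : E -> C) z th : csch g -> 0 <= t ->
  wave_coef (multiplier_fun (fun xi => expR (- t * enorm xi ^+ 2)) g) z th =
  (gauss t z)%:C * wave_coef g z th.
Proof.
rewrite le_eqVlt => sg /orP[/eqP <-|t0]; last first.
  apply: wave_coef_multiplier; [exact: heat_kernel_symbol|exact: csch_cL1|].
  by rewrite enormN.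
rewrite gaussE oppr0 mul0r expR0 mul1r; congr wave_coef.
rewrite -[RHS](inv_fourier_fourier sg); congr inv_fourier; apply/funext => xi.
by rewrite mul0r expR0 mul1r.
Qed.

(** The integrand is identified only for tau < t, since at tau = t the heat smoothing behind
    [leray_heat_derivative] is absent. The single point is a null set, and the time integral becomes
    one over the whole line. *)
Lemma bilinear_eq (u : R -> 'I_3 -> E -> R) t i g (k : R -> C) : 0 <= t -> cmeas (k : mR -> C) ->
  (forall tau, 0 <= tau -> tau < t ->
     heat (t - tau) (leray (advection (u tau) (u tau)) i) g = k tau) ->
  (forall tau, ~~ ((0 <= tau) && (tau < t)) -> k tau = 0) ->
  Defs.bilinear u u t i g = cint leb (k : mR -> C).
Proof.
move=> t0 [mkr mki] hk k0.
have main (P : C -> R) (h : R -> C) : P 0 = 0 -> measurable_fun setT (fun tau : mR => P (k tau)) ->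
    (forall tau, 0 <= tau -> tau < t -> h tau = k tau) ->
    \int[leb]_(tau in `[0, t]) P (h tau) = \int[leb]_tau P (k tau).
  move=> P0 mP e; rewrite /Rintegral; congr fine; rewrite integral_mkcond.
  pose f (tau : mR) := if tau == t then P (h t) else P (k tau).
  transitivity (\int[leb]_tau (f tau)%:E)%E.
    apply: eq_integral => tau _; rewrite patchE /f; case: ifPn => [|]; rewrite ?inE ?notin_setE/= in_itv/=.
      move=> /andP[a b]; have [->//|nt] := eqVneq tau t.
      by rewrite e// lt_neqAle nt b.
    have [->|nt] := eqVneq tau t; first by rewrite lexx t0.
    move=> H; have -> : k tau = 0; last by rewrite P0.
    by apply: k0; apply/negP => /andP[a b]; apply: H; rewrite a ltW.
  apply: ae_eq_integral => //.
  - apply/measurable_EFinP; apply: measurable_fun_ifT => //.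
    by apply: measurable_fun_eqr; [exact: measurable_id|exact: measurable_cst].
  - exact/measurable_EFinP.
  - exists [set t]; split=> //; first exact: lebesgue_measure_set1.
    move=> tau/= ntau; apply: contrapT => nt; apply: ntau => _.
    by rewrite /f ifF//; apply/eqP.
apply: eq_cplx; rewrite /Defs.bilinear/=.
  exact: (main (@complex.Re R)).
exact: (main (@complex.Im R)).
Qed.

(** What the advection term is tested against once the heat flow for time s and the Leray entry have
    been transposed onto g. *)
Definition kernel_of g (i j : 'I_3) s : E -> C :=
  multiplier_fun (leray_symbol i j)
    (multiplier_fun (fun xi => expR (- s * enorm xi ^+ 2)) g).

(* The factors of each product other than [v w] in the [w] equation are supported, in Fourier
   variables, on a plane where the relevant entry of the Leray symbol vanishes. *)
Lemma nonlinear_term (g : E -> C) t tau i : csch g -> 0 <= tau -> tau < t ->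
  heat (t - tau) (leray (advection (flow tau) (flow tau)) i) g =
  if i == 2%:R then - cint leb3 (fun x : mE =>
    (vel tau x * wsum tau x)%:C * cpderivs [:: 0] (kernel_of g 2%:R 2%:R (t - tau)) x) else 0.
Proof.
move=> sg tau0 taut; have s0 : 0 < t - tau by rewrite subr_gt0.
pose T j k := - cint leb3 (fun x : mE =>
  (flow tau k x * flow tau j x)%:C * cpderivs [:: k] (kernel_of g i j (t - tau)) x).
(* [T j k] pairs the product u_k u_j with the k-th derivative of the (i, j) entry; the minus sign is
   that of the transposed derivative. *)
transitivity (\sum_(j < 3) \sum_(k < 3) T j k) => //.
have K j k := leray_heat_derivative k i j sg s0.
have z k j b (D : set E) : annihilates D b ->
    (forall y, D y -> coord y k * leray_symbol i j y = 0) ->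
    cint leb3 (fun x : mE => (b x)%:C * cpderivs [:: k] (kernel_of g i j (t - tau)) x) = 0.
  move=> [_ _ h] D0; have [j1 e] := K j k.
  by apply: h => // y Dy; rewrite e D0// mul0r oppr0 mul0r.
have v0 := vel_annihilates tau (i := 0) isT; have v2 := vel_annihilates tau (i := 2%:R) isT.
have w2 := wsum_annihilates tau.
have T1k k : T 1 k = 0.
  by rewrite /T cint_eq0 ?oppr0// => x; rewrite flowE mulr0 mul0r.
have Tj1 j : T j 1 = 0.
  by rewrite /T cint_eq0 ?oppr0// => x; rewrite flowE !mul0r.
have T00 : T 0 0 = 0.
  rewrite /T !flowE (z 0 0 _ _ (annihilatesM (@planeD 0) v0 v0)) ?oppr0// => y.
  by rewrite /plane/= => ->; rewrite mul0r.
have T02 : T 0 2%:R = 0.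
  rewrite /T !flowE (z 2%:R 0 _ _ (annihilatesM (@planeD 2%:R) w2 v2)) ?oppr0// => y.
  by rewrite /plane/= => ->; rewrite mul0r.
have T22 : T 2%:R 2%:R = 0.
  rewrite /T !flowE (z 2%:R 2%:R _ _ (annihilatesM (@planeD 2%:R) w2 w2)) ?oppr0// => y.
  by rewrite /plane/= => ->; rewrite mul0r.
have T20 : T 2%:R 0 = if i == 2%:R then - cint leb3 (fun x : mE =>
    (vel tau x * wsum tau x)%:C * cpderivs [:: 0] (kernel_of g 2%:R 2%:R (t - tau)) x) else 0.
  case: eqP => [i2|/eqP i2]; first by rewrite /T i2 !flowE.
  rewrite /T !flowE (z 0 2%:R _ _ (annihilatesM (@planeD 2%:R) v2 w2)) ?oppr0// => y.
  by rewrite /plane/= /leray_symbol (negbTE i2) => ->; rewrite mulr0 mul0r subrr mulr0.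
rewrite -T20; move: (T) T1k Tj1 T00 T02 T22 => T' T1k Tj1 T00 T02 T22.
by rewrite !sum3 !T1k !Tj1 T00 T02 T22 !addr0 !add0r.
Qed.

Lemma wave_mul n nu th x : wave (kvec n) 0 x * wave (zvec nu) th x =
  2^-1 * (wave (zvec (nu + freq n)) th x + wave (zvec (nu - freq n)) th x).
Proof.
rewrite /wave !dotE/= !mulr0 !add0r !addr0 subr0 mulr1.
set a := x.1.2 * freq n; set b := x.1.1 + x.1.2 * nu - th.
rewrite (_ : x.1.1 + x.1.2 * (nu + freq n) - th = b + a); last by rewrite /a /b; ring.
rewrite (_ : x.1.1 + x.1.2 * (nu - freq n) - th = b - a); last by rewrite /a /b; ring.
by rewrite cosD cosB; field.
Qed.

Definition term_of (g : E -> C) t j tau n b p : C :=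
  let nu := shifted_freq n b (mfreq p) in
  (duhamel_integrand n nu (mcoef p) t tau)%:C * wave_coef g (zvec nu) (phase j.+1).

Definition level_term (g : E -> C) t j tau : C :=
  \sum_(p <- level j) \sum_(n <- iota m r)
    (term_of g t j tau n false p + term_of g t j tau n true p).

Lemma phaseS j : phase j.+1 = phase j + pi / 2.
Proof. by rewrite /phase -natr1; ring. Qed.

(** One Picard step at fixed tau. At (1, nu, 0) the symbol of d_1 has real factor 1 and the (3, 3)
    Leray entry equals 1, so each product wave merely acquires the heat factor and the phase shift
    pi/2. *)
Lemma level_termE (g : E -> C) t tau j : csch g -> 0 <= tau -> tau < t ->
  cint leb3 (fun x : mE => (vel tau x * wlev j tau x)%:C *
    cpderivs [:: 0] (kernel_of g 2%:R 2%:R (t - tau)) x) = level_term g t j tau.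
Proof.
move=> sg tau0 taut; have s0 : 0 < t - tau by rewrite subr_gt0.
have [jP eP] := leray_heat_derivative 0 2%:R 2%:R sg s0.
set Psi := cpderivs _ _ in jP eP *.
have wP nu th : wave_coef Psi (zvec nu) th =
    (expR (- (1 + nu ^+ 2) * (t - tau)))%:C * wave_coef g (zvec nu) (th + pi / 2).
  rewrite (wave_coef_odd th (csch_cL1 sg) jP eP); last first.
    by rewrite /leray_symbol gaussE !coordN !enormN gaussE; ring.
  rewrite /leray_symbol !coordE/= mul0r mul0r subr0 !mul1r gaussE enorm_sqr dotE/=.
  by congr ((expR _)%:C * _); ring.
pose c n p : R := 2^-1 * vcoef n tau * mcoef p tau.
pose G n b p (x : mE) : C :=
  (c n p)%:C * ((wave (zvec (shifted_freq n b (mfreq p))) (phase j) x)%:C * Psi x).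
have jG n b p : cL1 leb3 (G n b p) by apply: cL1Z; exact: cL1_wave.
have iG n b p : cint leb3 (G n b p) = term_of g t j tau n b p.
  rewrite cintZ; last exact: cL1_wave.
  rewrite -/(wave_coef _ _ _) wP -phaseS /term_of /duhamel_integrand tau0 taut/= /c !rmorphM/=.
  by ring.
transitivity (cint leb3 (fun x : mE => \sum_(p <- level j) \sum_(n <- iota m r) (G n false p x + G n true p x))).
  apply: eq_cint => x; rewrite /wlev mulr_sumr rmorph_sum mulr_suml; apply: eq_bigr => p _.
  rewrite /vel mulr_suml rmorph_sum mulr_suml; apply: eq_bigr => n _.
  rewrite /G /shifted_freq mulrA -[_ * wave _ _ _ * _]mulrA -mulrA.
  rewrite (_ : _ * _ = c n p * (wave (zvec (mfreq p + freq n)) (phase j) x +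
     wave (zvec (mfreq p - freq n)) (phase j) x)).
    by rewrite rmorphM rmorphD; ring.
  rewrite (_ : _ * _ = vcoef n tau * mcoef p tau * (wave (kvec n) 0 x * wave (zvec (mfreq p)) (phase j) x)).
    by rewrite wave_mul /c; ring.
  by ring.
have jn p n : cL1 leb3 (fun x : mE => G n false p x + G n true p x) by exact: cL1D.
have [_ ->] := @cint_sum R _ _ leb3 _ (level j) _ (fun p => (cint_sum (iota m r) (jn p)).1).
apply: eq_bigr => p _; have [_ ->] := cint_sum (iota m r) (jn p).
by apply: eq_bigr => n _; rewrite cintD// !iG.
Qed.

Lemma level_term_cvg (g : E -> C) t tau : csch g -> 0 <= tau -> tau < t ->
  (fun n => cmodulus (\sum_(0 <= j < n) level_term g t j tau -
     cint leb3 (fun x : mE => (vel tau x * wsum tau x)%:C *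
       cpderivs [:: 0] (kernel_of g 2%:R 2%:R (t - tau)) x))) @ \oo --> (0 : R).
Proof.
move=> sg tau0 taut; have s0 : 0 < t - tau by rewrite subr_gt0.
have [jP eP] := leray_heat_derivative 0 2%:R 2%:R sg s0.
set Psi := cpderivs _ _ in jP eP *.
have [mv _ _] := vel_annihilates tau (i := 0) isT.
have [mw _ _] := wsum_annihilates tau.
have mlev j : measurable_fun setT (wlev j tau : mE -> R).
  by apply: measurable_sum => p; apply: measurable_funM => //; exact: measurable_wave.
have vw j x : `|vel tau x * wlev j tau x| <= amp * (eps ^+ j * amp).
  by rewrite normrM; apply: ler_pM => //; [exact: vel_le|exact: wlev_le].
have jvw j : cL1 leb3 (fun x : mE => (vel tau x * wlev j tau x)%:C * Psi x).
  by apply: cL1_bounded_mul (vw j) jP; exact: measurable_funM.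
have e n : \sum_(0 <= j < n) level_term g t j tau =
    cint leb3 (fun x : mE => (vel tau x * wpart n tau x)%:C * Psi x).
  have [_ h] := cint_sum (index_iota 0 n) jvw.
  transitivity (\sum_(0 <= j < n) cint leb3 (fun x : mE => (vel tau x * wlev j tau x)%:C * Psi x)).
    by apply: eq_bigr => j _; rewrite level_termE.
  rewrite -h; apply: eq_cint => x.
  by rewrite /wpart mulr_sumr rmorph_sum mulr_suml.
under eq_fun do rewrite e.
have bd n x : cmodulus ((vel tau x * wpart n tau x)%:C * Psi x) <= amp * (2 * amp) * cmodulus (Psi x).
  rewrite cmodulusM cmodulus_real ler_wpM2r ?cmodulus_ge0// normrM.
  by apply: ler_pM => //; [exact: vel_le|exact: wpart_le].
apply: (cint_dominated _ _ (rintegrableZ (amp * (2 * amp)) jP.2) bd) => [n|x].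
  apply: cmeasM; last by case: jP.
  apply: cmeas_real; apply: measurable_funM => //.
  by have [] := wpart_annihilates n tau.
rewrite (_ : (fun n => _) = (fun n => `|vel tau x * wpart n tau x - vel tau x * wsum tau x| * cmodulus (Psi x))); last first.
  by apply/funext => n; rewrite -mulrBl -(rmorphB (real_complex R)) cmodulusM cmodulus_real.
rewrite -[X in _ --> X](mul0r (cmodulus (Psi x))); apply: cvgM; last exact: cvg_cst.
rewrite -(normr0 R); apply: cvg_norm; rewrite -(subrr (vel tau x * wsum tau x)).
apply: cvgB; last exact: cvg_cst.
by apply: cvgM; [exact: cvg_cst|exact: wpart_cvg].
Qed.

Lemma cvg_cmodulus_ReIm (u : nat -> C) (a : C) :
  (fun n => cmodulus (u n - a)) @ \oo --> (0 : R) ->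
  (fun n => complex.Re (u n)) @ \oo --> complex.Re a /\
  (fun n => complex.Im (u n)) @ \oo --> complex.Im a.
Proof.
move=> ua; split; apply/cvgrPdist_le => e e0; have /cvgrPdist_le/(_ _ e0) := ua;
  apply: filterS => n; rewrite sub0r normrN ger0_norm ?cmodulus_ge0// => h1;
  rewrite distrC (le_trans _ h1)//.
  by rewrite (le_trans _ (norm_Re_le _))// ReD; case: (a).
by rewrite (le_trans _ (norm_Im_le _))// ImD; case: (a).
Qed.

(** Integration in tau turns the coefficients into the Duhamel coefficients of the children: the
    j-th term of the nonlinearity reproduces level j+1. *)
Lemma level_term_integral (g : E -> C) t j : csch g ->
  cL1 leb (level_term g t j : mR -> C) /\
  cint leb (level_term g t j : mR -> C) = cint leb3 (fun x : mE => (wlev j.+1 t x)%:C * g x).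
Proof.
move=> sg.
have jd n b p : leb.-integrable setT (EFin \o (duhamel_integrand n (shifted_freq n b (mfreq p)) (mcoef p) t : mR -> R)).
  exact: (duhamel_integrable _ _ _ (@mcoef_measurable p) (@mcoef_le p)).
have jt n b p : cL1 leb (fun tau : mR => term_of g t j tau n b p).
  rewrite /term_of; under eq_fun do rewrite mulrC.
  by apply: cL1Z; exact: cL1_real.
have it n b p : cint leb (fun tau : mR => term_of g t j tau n b p) =
    (mcoef (child n b p) t)%:C * wave_coef g (zvec (mfreq (child n b p))) (phase j.+1).
  rewrite /term_of; under eq_cint do rewrite mulrC.
  rewrite cintZ; last exact: cL1_real.
  by rewrite cint_real mulrC.
have jn p n : cL1 leb (fun tau : mR => term_of g t j tau n false p + term_of g t j tau n true p).
  exact: cL1D.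
have [j2 e2] := @cint_sum R _ _ leb _ (level j) _ (fun p => (cint_sum (iota m r) (jn p)).1).
split=> //; rewrite [LHS]e2.
rewrite [RHS](cint_wave_sum _ _ _ _ (csch_cL1 sg)) sum_levelS; apply: eq_bigr => p _.
have [_ ->] := cint_sum (iota m r) (jn p).
by apply: eq_bigr => n _; rewrite cintD// !it.
Qed.

Lemma level_term0 (g : E -> C) t j tau : ~~ ((0 <= tau) && (tau < t)) -> level_term g t j tau = 0.
Proof.
move=> h; rewrite /level_term big1// => p _; rewrite big1// => n _.
by rewrite /term_of /duhamel_integrand (negbTE h) !mul0r addr0.
Qed.

(** The factor e^t times the standard exponential density is an integrable function of tau that is
    at least 1 on [0, t). It serves as majorant for dominated convergence in time, while eps^j makes
    the bound summable in j. *)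
Lemma level_term_le (g : E -> C) t j tau : csch g ->
  cmodulus (level_term g t j tau) <=
  eps ^+ j * amp * (amp * \int[leb3]_x cmodulus (g x) * expR t * exponential_pdf 1 tau).
Proof.
move=> sg; set N := \int[leb3]_x _.
have N0 : 0 <= N by apply: Rintegral_ge0 => x _; exact: cmodulus_ge0.
have [h|h] := boolP ((0 <= tau) && (tau < t)); last first.
  rewrite level_term0// cmodulus0 mulr_ge0 ?mulr_ge0 ?amp_ge0 ?exprn_ge0 ?eps_ge0 ?expR_ge0//.
  exact: exponential_pdf_ge0.
have /andP[t0 tt] := h.
have K1 : 1 <= expR t * exponential_pdf 1 tau.
  by rewrite exponential_pdfE// mul1r mulN1r -expRD -[leLHS]expR0 ler_expR subr_ge0 ltW.
rewrite -(mulrA (amp * N)) (@le_trans _ _ (eps ^+ j * amp * (amp * N)))//; last first.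
  by rewrite ler_wpM2l ?mulr_ge0 ?amp_ge0 ?exprn_ge0 ?eps_ge0// ler_peMr// mulr_ge0 ?amp_ge0.
have tb n b p : cmodulus (term_of g t j tau n b p) <= 2^-1 * (A * freq n) * mbound p * N.
  rewrite /term_of cmodulusM cmodulus_real.
  have /andP[d0 d1] := duhamel_integrand_bounds n (shifted_freq n b (mfreq p)) t tau (@mcoef_le p).
  rewrite (ger0_norm d0); apply: ler_pM => //; first exact: cmodulus_ge0.
    rewrite (le_trans d1)// h; have /andP[c0 c1] := mcoef_le p 0.
    rewrite ler_wpM2r ?(le_trans c0)// ler_wpM2l// vcoef_le//.
  exact: wave_coef_le (csch_cL1 sg).
rewrite -level_bound mulr_suml (le_trans (cmodulus_sum _ _))//; apply: ler_sum => p _.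
rewrite /amp mulr_suml mulr_sumr (le_trans (cmodulus_sum _ _))//; apply: ler_sum => n _.
rewrite (le_trans (cmodulusD _ _))// (le_trans (lerD (tb _ _ _) (tb _ _ _)))//.
by rewrite le_eqVlt; apply/orP; left; apply/eqP; field.
Qed.

Lemma wlev_measurable j t : measurable_fun setT (wlev j t : mE -> R).
Proof.
by apply: measurable_sum => p; apply: measurable_funM => //; exact: measurable_wave.
Qed.

(** The reindexing f allows the shift n + 1: the first n terms of the nonlinearity produce the
    levels 1 to n, that is [wpart (n + 1)] minus level 0. *)
Lemma wpart_test_cvg (g : E -> C) t (f : nat -> nat) : cL1 leb3 (g : mE -> C) -> f @ \oo --> \oo ->
  (fun n => cmodulus (cint leb3 (fun x : mE => (wpart (f n) t x)%:C * g x) -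
     cint leb3 (fun x : mE => (wsum t x)%:C * g x))) @ \oo --> (0 : R).
Proof.
move=> jg foo.
have bd n x : cmodulus ((wpart (f n) t x)%:C * g x) <= 2 * amp * cmodulus (g x).
  by rewrite cmodulusM cmodulus_real ler_wpM2r ?cmodulus_ge0// wpart_le.
apply: (cint_dominated _ _ (rintegrableZ (2 * amp) jg.2) bd) => [n|x].
  apply: cmeasM; last by case: jg.
  by apply: cmeas_real; have [] := wpart_annihilates (f n) t.
rewrite (_ : (fun n => _) = (fun n => `|wpart (f n) t x - wsum t x| * cmodulus (g x))); last first.
  by apply/funext => n; rewrite -mulrBl -(rmorphB (real_complex R)) cmodulusM cmodulus_real.
rewrite -[X in _ --> X](mul0r (cmodulus (g x))); apply: cvgM; last exact: cvg_cst.
rewrite -(normr0 R); apply: cvg_norm; rewrite -(subrr (wsum t x)).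
apply: cvgB; last exact: cvg_cst.
exact: (cvg_comp f _ foo (wpart_cvg (t := t) (x := x))).
Qed.

Lemma wlev_test_sum (g : E -> C) t n : cL1 leb3 (g : mE -> C) ->
  cint leb3 (fun x : mE => (wpart n t x)%:C * g x) =
  \sum_(0 <= j < n) cint leb3 (fun x : mE => (wlev j t x)%:C * g x).
Proof.
move=> jg.
have jw j : cL1 leb3 (fun x : mE => (wlev j t x)%:C * g x).
  by apply: cL1_bounded_mul (wlev_le j t) jg; exact: wlev_measurable.
have [_ <-] := cint_sum (index_iota 0 n) jw.
by apply: eq_cint => x; rewrite /wpart rmorph_sum mulr_suml.
Qed.

(** The sum telescopes: integrated in time, the first n level terms give [wpart (n + 1)] minus level
    0. Dominated convergence in tau and in x lets n tend to infinity, and the sign of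
    [nonlinear_term] gives the minus in front of the bilinear term. *)
Lemma mild_w (g : E -> C) t : csch g -> 0 <= t ->
  cint leb3 (fun x : mE => (wsum t x)%:C * g x) =
  cint leb3 (fun x : mE => (wlev 0 t x)%:C * g x) - Defs.bilinear flow flow t 2%:R g.
Proof.
move=> sg t0.
pose k (tau : R) : C := if (0 <= tau) && (tau < t) then
  cint leb3 (fun x : mE => (vel tau x * wsum tau x)%:C *
    cpderivs [:: 0] (kernel_of g 2%:R 2%:R (t - tau)) x) else 0.
pose H (n : nat) (tau : R) := \sum_(0 <= j < n) level_term g t j tau.
have jH n : cL1 leb (H n : mR -> C).
  by have [] := cint_sum (index_iota 0 n) (fun j => (level_term_integral t j sg).1).
have Hk tau : (fun n => cmodulus (H n tau - k tau)) @ \oo --> (0 : R).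
  rewrite /k; case: ifPn => [/andP[a b]|h]; first exact: level_term_cvg.
  rewrite (_ : (fun n => _) = (fun=> 0)); first exact: cvg_cst.
  by apply/funext => n; rewrite /H big1 ?subr0 ?cmodulus0// => j _; exact: level_term0.
have mk : cmeas (k : mR -> C).
  split.
    apply: (@measurable_fun_cvg _ _ _ _ (fun n (tau : mR) => complex.Re (H n tau))) => [n|tau _].
      exact: (jH n).1.1.
    exact: (cvg_cmodulus_ReIm (Hk tau)).1.
  apply: (@measurable_fun_cvg _ _ _ _ (fun n (tau : mR) => complex.Im (H n tau))) => [n|tau _].
    exact: (jH n).1.2.
  exact: (cvg_cmodulus_ReIm (Hk tau)).2.
pose N := \int[leb3]_x cmodulus (g x).
have N0 : 0 <= N by apply: Rintegral_ge0 => x _; exact: cmodulus_ge0.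
pose D (tau : R) := 2 * amp * (amp * N * expR t) * exponential_pdf 1 tau.
have jD : leb.-integrable setT (EFin \o (D : mR -> R)).
  by have jx := @integrable_exponential_pdf R 1 ltr01; exact: (rintegrableZ _ jx).
have HD n tau : cmodulus (H n tau) <= D tau.
  rewrite (le_trans (cmodulus_sum _ _))// (le_trans (ler_sum _ (fun j _ => level_term_le t j tau sg)))//.
  rewrite -mulr_suml /D -[leRHS]mulrA ler_wpM2r//.
    rewrite mulr_ge0 ?expR_ge0 ?exponential_pdf_ge0// mulr_ge0 ?expR_ge0// mulr_ge0 ?amp_ge0//.
  by have := geometric_tail 0 n; rewrite add0n expr0 mulr1.
have lim1 := cint_dominated (fun n => (jH n).1) Hk jD HD.
have jg := csch_cL1 sg.
have lim2 := wpart_test_cvg t jg (@cvg_addnr 1).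
pose c0 := cint leb3 (fun x : mE => (wlev 0 t x)%:C * g x).
have e n : cint leb (H n : mR -> C) = cint leb3 (fun x : mE => (wpart (n + 1) t x)%:C * g x) - c0.
  have [_ ->] := cint_sum (index_iota 0 n) (fun j => (level_term_integral t j sg).1).
  rewrite wlev_test_sum// addn1 big_nat_recl//= -/c0 addrC addKr.
  by apply: eq_bigr => j _; exact: (level_term_integral t j sg).2.
have ek : cint leb (k : mR -> C) = cint leb3 (fun x : mE => (wsum t x)%:C * g x) - c0.
  apply: (cvg_cmodulus_unique lim1).
  apply: cvg_trans lim2; apply: near_eq_cvg; apply: nearW => n; rewrite e; congr cmodulus.
  by ring.
have jk : cL1 leb (k : mR -> C).
  apply: (le_cL1 mk jD) => tau.
  have := (cvg_cmodulus_ReIm (Hk tau)); move=> [c1 c2].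
  have c3 : (fun n => cmodulus (H n tau)) @ \oo --> cmodulus (k tau).
    apply: (@continuous_cvg _ _ _ _ _ _ (fun r : R => Num.sqrt r)); first exact: sqrt_continuous.
    by apply: cvgD; [rewrite !expr2; exact: cvgM|rewrite !expr2; exact: cvgM].
  by apply: (ler_cvg_to c3 (cvg_cst (D tau))); apply: nearW => n.
have -> : Defs.bilinear flow flow t 2%:R g = - cint leb (k : mR -> C).
  rewrite -mulN1r -cintZ//; apply: bilinear_eq => //.
  - by apply: cmeasM => //; exact: cmeas_cst.
  - by move=> tau a b; rewrite nonlinear_term//= /k a b mulN1r.
  - by move=> tau h; rewrite /k (negbTE h) mulr0.
by rewrite ek opprK -/c0; ring.
Qed.

Lemma cL1_heat t (g : E -> C) : csch g -> 0 <= t ->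
  cL1 leb3 (multiplier_fun (fun xi => expR (- t * enorm xi ^+ 2)) g : mE -> C).
Proof.
move=> sg; rewrite le_eqVlt => /orP[/eqP <-|t0]; last first.
  exact: (multiplier_cL1 (heat_kernel_symbol t0) (csch_cL1 sg)).1.
rewrite (_ : multiplier_fun _ g = g); first exact: csch_cL1.
rewrite -[RHS](inv_fourier_fourier sg); congr inv_fourier; apply/funext => xi.
by rewrite oppr0 mul0r expR0 mul1r.
Qed.

Lemma wsum0 x : wsum 0 x = wlev 0 0 x.
Proof.
have h n : wpart n.+1 0 x = wlev 0 0 x.
  rewrite /wpart big_nat_recl// big1 ?addr0// => j _.
  rewrite /wlev sum_levelS big1// => p _; rewrite big1// => n' _ /=.
  (* At t = 0 the interval [0, t) is empty, so every level above 0 vanishes. *)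
  have d0 nu : duhamel n' nu (mcoef p) 0 = 0.
    rewrite /duhamel /Rintegral integral0_eq// => tau _; rewrite /duhamel_integrand.
    by case: ltP; rewrite ?andbT ?andbF//; case: ltP.
  by rewrite !d0 !mul0r addr0.
have c : (fun n => wpart n.+1 0 x) @ \oo --> wsum 0 x.
  by rewrite (cvg_shiftS (fun n => wpart n 0 x)); exact: wpart_cvg.
by rewrite -(cvg_lim (@Rhausdorff R) c) (funext h) lim_cst.
Qed.

Lemma heat_wave_sum (I : Type) (s : seq I) (c c0 : I -> R) (z : I -> E) (th : I -> R) t (g : E -> C) :
  csch g -> 0 <= t -> (forall q, c q = c0 q * gauss t (z q)) ->
  cint leb3 (fun x : mE => (\sum_(q <- s) c q * wave (z q) (th q) x)%:C * g x) =
  cint leb3 (fun x : mE => (\sum_(q <- s) c0 q * wave (z q) (th q) x)%:C *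
    multiplier_fun (fun xi => expR (- t * enorm xi ^+ 2)) g x).
Proof.
move=> sg t0 e; rewrite !cint_wave_sum//; [|exact: cL1_heat|exact: csch_cL1].
by apply: eq_bigr => q _; rewrite wave_coef_heat// e rmorphM/= mulrA.
Qed.

Lemma flow_solution T : navier_stokes_solution T (of_field (flow 0)) flow.
Proof.
split.
- by move=> i; apply: measurable_funTS; exact: flow_measurable.
- by exists (2 * amp) => t i x /andP[t0 _]; exact: flow_le.
- by move=> t /andP[t0 _]; exact: flow_div_free.
move=> t i g /andP[t0 _] /schwartz_csch sg.
have B0 (j : 'I_3) : j != 2%:R -> Defs.bilinear flow flow t j g = 0.
  move=> j2; rewrite (@bilinear_eq flow t j g (fun=> 0))//; first by rewrite cint0.
  by move=> tau a b; rewrite nonlinear_term// (negbTE j2).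
elim/forall_ord3: i.
- rewrite B0// subr0; apply: heat_wave_sum => // n.
  rewrite /vcoef mulr0 expR0 mulr1 gaussE enorm_sqr dotE/=; congr (_ * expR _); ring.
- rewrite B0// subr0 [LHS]cint_eq0 => [|x]; last by rewrite flowE mul0r.
  by rewrite [RHS]cint_eq0// => x; rewrite flowE mul0r.
rewrite [LHS]mild_w//; congr (_ - _).
transitivity (cint leb3 (fun x : mE => (wlev 0 0 x)%:C *
    multiplier_fun (fun xi => expR (- t * enorm xi ^+ 2)) g x)); last first.
  by apply: eq_cint => x; rewrite flowE wsum0.
rewrite /wlev.
under eq_cint do rewrite sum_level0; under [RHS]eq_cint do rewrite sum_level0.
apply: heat_wave_sum => // n /=.
rewrite /coef0 ltxx ltNge t0/= mulr0 expR0 mulr1 gaussE enorm_sqr dotE/=; congr (_ * expR _); ring.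
Qed.

End shear_flow.

(** * Norm estimates *)

Section triebel_lizorkin.
Context {R : realType}.
Local Open Scope complex_scope.
Local Notation C := R[i].
Local Notation mR := (measurableTypeR R).
Local Notation E := (R * R * R)%type.
Local Notation mE := (mR * mR * mR)%type.
Local Notation leb := (@lebesgue_measure R).
Local Notation coord := (@Defs.coord R).
Local Notation basis := (@Defs.basis R).
Implicit Types (g h : E -> C) (b : E -> R) (x y z : E) (n N : nat).

Lemma integrable_decay6 :
  leb3.-integrable setT (EFin \o (fun x : mE => ((1 + enorm (x : E)) ^+ 6)^-1 : R)).
Proof.
have e0 x : 0 <= (1 + enorm x : R) ^+ 6 by rewrite exprn_ge0 ?one_enorm_ge0.
apply: dominated_integrable.
  rewrite (_ : (fun x => _) = (fun x : mE => ((1 + enorm (x : E)) ^+ 6) `^ (-1))).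
    apply: (measurableT_comp (measurable_powR (-1))).
    by apply: measurable_funX; apply: measurable_funD => //; exact: measurable_enorm.
  by apply/funext => x; rewrite powR_inv1.
apply: (@decay_dominated _ _ 1) => x.
rewrite ger0_norm ?invr_ge0// mulfV// expf_neq0// gt_eqF// ltr_wpDr ?enorm_ge0//.
Qed.

Lemma of_fun_tempered b (M : R) : measurable_fun setT (b : mE -> R) -> (forall x, `|b x| <= M) ->
  tempered (of_fun (fun x => (b x)%:C)).
Proof.
move=> mb bM; have J g : schwartz g -> cL1 leb3 (fun x : mE => (b x)%:C * g x).
  by move=> /schwartz_csch sg; exact: cL1_bounded_mul mb bM (csch_cL1 sg).
have M0 : 0 <= M by exact: le_trans (normr_ge0 _) (bM 0).
split.
  move=> a g h sg sh; rewrite -[a * of_fun _ g]cintZ; last exact: J.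
  rewrite -cintD; [|exact/cL1Z/J|exact: J].
  by apply: eq_cint => x; ring.
exists (M * \int[leb3]_x ((1 + enorm (x : E)) ^+ 6)^-1), 6%N => g D sg gD.
rewrite (le_trans (cmodulus_cint_le (J _ sg)))//.
rewrite mulrAC -RintegralZl//; last exact: integrable_decay6.
apply: le_Rintegral => //; first exact: (J _ sg).2.
  exact: (rintegrableZ (M * D) integrable_decay6).
move=> x _; rewrite cmodulusM cmodulus_real -mulrA; apply: ler_pM => //; first exact: cmodulus_ge0.
have := gD [::] x isT; rewrite (_ : cpderivs [::] g x = g x); last exact: eq_cplx.
by move=> h; rewrite ler_pdivlMr ?exprn_gt0 ?ltr_wpDr ?enorm_ge0// mulrC.
Qed.

Lemma exp2z_nat n : (2 : R) ^ (- n%:Z) = 2 ^- n.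
Proof. by rewrite -exprnN. Qed.

(** The decompositions below vanish on negative blocks, so the sum over Z becomes a series over the
    naturals and its partial sums suffice. *)
Lemma tl_size_le (q S : R) (fk : int -> E -> C) : 0 < q -> 0 <= S ->
  (forall n x, fk (Negz n) x = 0) ->
  (forall N x, \sum_(0 <= n < N) (2 ^- n * cmodulus (fk n%:Z x)) `^ q <= S) ->
  (tl_size q fk <= (S `^ q^-1)%:E)%E.
Proof.
move=> q0 S0 fN fS; apply/ess_supP; apply: nearW => x.
rewrite -poweR_EFin; apply: gt0_ler_poweR; rewrite ?invr_ge0 ?(ltW q0)//.
- by rewrite in_itv/= leey andbT; apply: esum_ge0 => k _; rewrite lee_fin powR_ge0.
- by rewrite in_itv/= leey andbT lee_fin.
pose a (k : int) : \bar R := ((2 ^ (- k) * cmodulus (fk k x)) `^ q)%:E.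
have a0 k : (0 <= a k)%E by rewrite lee_fin powR_ge0.
have inj : set_inj [set: nat] Posz by move=> i j _ _ [].
have -> : (\esum_(k in [set: int]) a k = \esum_(k in Posz @` [set: nat]) a k)%E.
  rewrite [RHS]esum_mkcond; apply: eq_esum => -[n|n] _.
    by rewrite ifT// inE; exists n.
  case: ifP => // _; rewrite /a fN cmodulus0 mulr0 powR0 ?gt_eqF//.
rewrite (esum_image _ _ a inj) -nneseries_esumT//.
apply: lime_le; first by apply: is_cvg_nneseries => n _ _.
apply: nearW => N; rewrite (eq_bigr (fun n : nat => ((2 ^- n * cmodulus (fk n%:Z x)) `^ q)%:E)).
  by rewrite sumEFin lee_fin.
by move=> n _; rewrite /a exp2z_nat.
Qed.

Variable phi : E -> R.
Hypothesis hphi : littlewood_paley phi.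

Lemma phi_support xi : phi xi != 0 -> 5 / 8 <= enorm xi <= 7 / 4.
Proof. by have [_ _ _ h _] := hphi => p0; apply: h; exact: subset_closure. Qed.

Lemma phi_sch : sch phi.
Proof.
have [sp _ _ _ _] := hphi; apply: (compact_support_sch (r := 7 / 4)) => // x x74.
apply/eqP; apply: contraTT x74 => /phi_support/andP[_ h].
by rewrite -leNgt.
Qed.

Definition block (k : int) xi : R := phi ((2 : R) ^ (- k) *: xi).

Lemma exp2z_gt0 (k : int) : 0 < (2 : R) ^ k.
Proof. exact: exprz_gt0. Qed.

Lemma block_sch k : sch (block k).
Proof. by apply: sch_scale => //; [exact: exp2z_gt0|exact: phi_sch]. Qed.

Lemma block_symbol k : kernel_symbol (block k).
Proof. exact/sch_kernel_symbol/block_sch. Qed.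

Lemma blockN k z : block k (- z) = block k z.
Proof. by have [_ _ h _ _] := hphi; apply: h; rewrite scalerN enormN. Qed.

Lemma block_ge0 k z : 0 <= block k z.
Proof. by have [_ h _ _ _] := hphi; exact: h. Qed.

Lemma wave_coef_block k g z th : cL1 leb3 (g : mE -> C) ->
  wave_coef (multiplier_fun (block k) g) z th = (block k z)%:C * wave_coef g z th.
Proof. by move=> jg; apply: wave_coef_multiplier => //; [exact: block_symbol|exact: blockN]. Qed.

Lemma cL1_block k g : cL1 leb3 (g : mE -> C) ->
  cL1 leb3 (multiplier_fun (block k) g : mE -> C).
Proof. by move=> jg; exact: (multiplier_cL1 (block_symbol k) jg).1. Qed.

Lemma zsums_to_halfline (a : int -> C) (l : C) : (forall n, a (- n.+1%:Z) = 0) ->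
  (fun N => cmodulus (\sum_(0 <= k < N) a k%:Z - l)) @ \oo --> (0 : R) -> zsums_to a l.
Proof.
move=> aN ac; rewrite /zsums_to.
rewrite (_ : (fun MN : nat * nat => _) = (fun N => cmodulus (\sum_(0 <= k < N) a k%:Z - l)) \o fst).
  by apply: cvg_comp ac; exact: cvg_fst.
apply/funext => -[N1 N2] /=; congr (cmodulus (_ - _)).
by rewrite [X in _ + X]big1 ?addr0// => k _.
Qed.

Lemma of_fun_real_wave_sum (s : seq nat) (c : nat -> R) (z : nat -> E) th g : cL1 leb3 (g : mE -> C) ->
  of_fun (fun x => (\sum_(n <- s) c n * wave (z n) th x)%:C) g =
  \sum_(n <- s) (c n)%:C * wave_coef g (z n) th.
Proof. by move=> jg; exact: (cint_wave_sum s c z (fun=> th) jg). Qed.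

(** The n-th wave itself serves as f_n: its frequency lies in the shell where the n-th block symbol
    is 1. At each point at most r terms of the l^q sum are nonzero, each at most A^q. *)
Lemma wave_sum_tl (q : R) (m r : nat) (A : R) (c : nat -> R) (z : nat -> E) th :
  2 < q -> 0 <= A -> (forall n, `|c n| <= A * 2 ^+ n) ->
  (forall n, (m <= n)%N -> 7 / 8 * 2 ^+ n <= enorm (z n) <= 5 / 4 * 2 ^+ n) ->
  let f := of_fun (fun x => (\sum_(n <- iota m r) c n * wave (z n) th x)%:C) in
  in_tl phi q f /\ (tl_norm phi q f <= (r%:R `^ q^-1 * A)%:E)%E.
Proof.
move=> q2 A0 cA zA f; have q0 : 0 < q by exact: lt_trans q2.
pose fk (k : int) x : C := match k with
  | Posz n => if (m <= n < m + r)%N then (c n * wave (z n) th x)%:C else 0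
  | Negz _ => 0 end.
have mw n : measurable_fun setT (fun x : mE => c n * wave (z n) th x).
  by apply: measurable_funM => //; exact: measurable_wave.
have tf : tempered f.
  apply: (@of_fun_tempered _ (\sum_(n <- iota m r) `|c n|)).
    by apply: measurable_sum => n; exact: mw.
  move=> x; rewrite (le_trans (ler_norm_sum _ _ _))//; apply: ler_sum => n _.
  by rewrite normrM ler_piMr// wave_le1.
have S : (tl_size q fk <= (r%:R `^ q^-1 * A)%:E)%E.
  have SA : 0 <= r%:R * A `^ q by rewrite mulr_ge0// powR_ge0.
  apply: le_trans (tl_size_le q0 SA _ _) _ => [//|N x|].
    have le1 n : (2 ^- n * cmodulus (fk n x)) `^ q <= if (m <= n < m + r)%N then A `^ q else 0.
      rewrite /fk; case: ifP => _; last by rewrite cmodulus0 mulr0 powR0// gt_eqF.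
      rewrite cmodulus_real; apply: ge0_ler_powR; rewrite ?nnegrE ?(ltW q0)//.
      rewrite mulrC ler_pdivrMr ?exprn_gt0// (le_trans _ (cA n))// normrM.
      by rewrite ler_piMr// wave_le1.
    rewrite (le_trans (ler_sum _ (fun n _ => le1 n)))// -big_mkcond/= big_const_seq iter_addr_0.
    rewrite -[leLHS]mulr_natl ler_wpM2r ?powR_ge0// ler_nat -size_filter.
    rewrite -[X in (_ <= X)%N](size_iota m r).
    apply: uniq_leq_size; first by rewrite filter_uniq// iota_uniq.
    by move=> n; rewrite mem_filter mem_iota => /andP[].
  rewrite lee_fin powRM ?powR_ge0// -powRrM mulfV ?gt_eqF// powRr1//.
have dec : tl_decomposition phi f fk.
  split.
    case=> [n|n]; last by split; exact: measurable_cst.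
    case mn : (m <= n < m + r)%N; rewrite /fk mn; first by apply: cmeas_real; exact: mw.
    by split; exact: measurable_cst.
  move=> g [/schwartz_csch/csch_cL1 jg _].
  have dn n : dyadic_block phi n (of_fun (fk n)) g =
      if (m <= n < m + r)%N then (c n)%:C * wave_coef g (z n) th else 0.
    rewrite /dyadic_block /multiplier /of_fun -/(block n) /fk; case: ifP => mnr; last first.
      by apply: cint_eq0 => x; rewrite mul0r.
    transitivity ((c n)%:C * wave_coef (multiplier_fun (block n) g) (z n) th).
      rewrite -cintZ; last by apply: cL1_wave; exact: cL1_block.
      by apply: eq_cint => x; rewrite rmorphM/= mulrA.
    rewrite wave_coef_block// (_ : block n (z n) = 1) ?mul1r//.
    have [_ _ _ _ [one _]] := hphi; apply: one.
    have /andP[z1 z2] := zA n (andP mnr).1.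
    rewrite enormZ exp2z_nat ger0_norm ?invr_ge0 ?exprn_ge0// [2 ^- n * _]mulrC.
    by rewrite ler_pdivlMr ?exprn_gt0// ler_pdivrMr ?exprn_gt0// z1 z2.
  apply: zsums_to_halfline.
    by move=> n; apply: cint_eq0 => x; rewrite mul0r.
  apply: cvg_near_cst; near=> N.
  have mrN : (m + r <= N)%N by near: N; exact: nbhs_infty_ge.
  rewrite (eq_bigr _ (fun n _ => dn n)) /f of_fun_real_wave_sum//.
  rewrite (big_cat_nat (n := m + r)) ?mrN//= (big_cat_nat (n := m)) ?leq_addr//=.
  rewrite big_nat_cond big1 ?add0r; last first.
    by move=> n; rewrite andbT => /andP[_ nm]; rewrite leqNgt nm.
  have -> : \sum_(m + r <= n < N) (if (m <= n < m + r)%N then (c n)%:C * wave_coef g (z n) th else 0) = 0 :> C.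
    rewrite big_nat_cond big1// => n; rewrite andbT => /andP[nm _].
    by rewrite [X in _ && X]ltnNge nm andbF.
  rewrite addr0.
  rewrite (_ : \sum_(m <= n < m + r) _ = \sum_(n <- iota m r) (c n)%:C * wave_coef g (z n) th).
    by rewrite subrr cmodulus0.
  rewrite /index_iota addKn big_seq [RHS]big_seq; apply: eq_bigr => n.
  by rewrite mem_iota => ->.
have Sfin : (tl_size q fk < +oo)%E by rewrite (le_lt_trans S)// ltry.
split; first by split=> //; exists fk.
by apply: le_trans S; apply: ereal_inf_lbound; exists fk.
Unshelve. all: by end_near. Qed.

Lemma sch_opp (f : E -> R) : sch f -> sch (fun x => - f x).
Proof.
move=> [sf df].
have e t : pderivs t (fun x => - f x) = (fun x => - pderivs t f x).
  elim: t => [//|i t IH]; rewrite /= -/(pderivs t _) IH; apply/funext => x.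
  by rewrite -[RHS]deriveN//; exact/diff_derivable/sf.
split=> t; first by move=> x; rewrite e; apply: differentiableN; exact: sf.
by move=> n; have [M hM] := df t n; exists M => x; rewrite e normrN.
Qed.

(** The operation on h that corresponds to differentiating [FT 1 h]; the factor 1 is the sign s of
    [FT_diff]. *)
Definition icoordM (j : 'I_3) (h : E -> C) (x : E) : C := (0 +i* (1 * coord x j)) * h x.

Lemma csch_icoordM j h : csch h -> csch (icoordM j h).
Proof.
move=> [sr si]; split.
  rewrite (_ : (fun x => _) = (fun x => - (coord x j * complex.Im (h x)))).
    exact/sch_opp/sch_coordM.
  by apply/funext => x; rewrite /icoordM ReM/= mul0r mul1r sub0r.
rewrite (_ : (fun x => _) = (fun x => coord x j * complex.Re (h x))); first exact: sch_coordM.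
by apply/funext => x; rewrite /icoordM ImM/= mul0r mul1r add0r.
Qed.

Lemma csch_cdecay8 h : csch h -> cdecay8 h.
Proof. by move=> [sr si]; split; exact: sch_decay8. Qed.

Lemma FT_csch_schwartz h : csch h -> schwartz (FT 1 h).
Proof.
move=> sh; pose D t := foldr icoordM h t.
have sD t : csch (D t) by elim: t => [//|i t IH]; exact: csch_icoordM.
have d t y := FT_diff 1 y (csch_cL1 (sD t)).1 (csch_cdecay8 (sD t)).
have e t : (pderivs t (fun y => complex.Re (FT 1 h y)) = (fun y => complex.Re (FT 1 (D t) y))) /\
    (pderivs t (fun y => complex.Im (FT 1 h y)) = (fun y => complex.Im (FT 1 (D t) y))).
  elim: t => [//|i t [IH1 IH2]]; rewrite /= -/(pderivs t _) -/(pderivs t _) IH1 IH2.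
  split; apply/funext => y; have [_ _ /(_ i)] := d t y.
    by move=> /(congr1 (@complex.Re R)).
  by move=> /(congr1 (@complex.Im R)).
split.
  by split=> t y; rewrite ?(e t).1 ?(e t).2; have [] := d t y.
move=> t n; have [M hM] := FT_csch_decay n (expr1n _ _) (sD t); exists M => y.
apply: le_trans (hM y); rewrite (_ : cpderivs t (FT 1 h) y = FT 1 (D t) y)//.
by apply: eq_cplx; rewrite /cpderivs/= ?(e t).1 ?(e t).2.
Qed.

Lemma sch_vanish_derive (f : E -> R) (s : R) j : (forall x, enorm x < s -> f x = 0) ->
  forall x, enorm x < s -> 'D_(basis j) f x = 0.
Proof.
move=> f0 x xs; rewrite (@near_eq_derive _ _ _ _ (cst 0)) ?derive_cst//.
have o : open [set z : E | enorm z < s].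
  apply: (@open_comp _ _ (enorm : E -> R) [set z | z < s]); last exact: open_lt.
  by move=> z _; exact: enorm_continuous.
by apply: filterS (open_nbhs_nbhs (conj o xs)) => z; exact: f0.
Qed.

(** Moments of a transform are derivatives of f at 0, up to constants, and f vanishes near 0. In the
    induction each factor y_j is traded for a derivative: [H] is an iterated derivative of f and [c]
    a power of i. *)
Lemma FT_moments (t : seq 'I_3) (f : E -> R) (s : R) : 0 < s -> sch f ->
  (forall x, enorm x < s -> f x = 0) ->
  cint leb3 (fun y : mE => (\prod_(j <- t) coord (y : E) j)%:C * FT 1 (fun x => (f x)%:C) y) = 0.
Proof.
move=> s0 sf f0.
suff [H [c [sH H0 e]]] : exists H : E -> R, exists c : C, [/\ sch H, H 0 = 0 &
    forall y, (\prod_(j <- t) coord y j)%:C * FT 1 (fun x => (f x)%:C) y = c * FT 1 (fun x => (H x)%:C) y].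
  transitivity (cint leb3 (fun y : mE => c * FT 1 (fun x => (H x)%:C) y)).
    by apply: eq_cint => y; exact: e.
  rewrite cintZ; last by apply: cL1_FT_csch; [rewrite expr1n|exact: sch_csch].
  rewrite (_ : cint _ _ = FT (- 1) (FT 1 (fun x => (H x)%:C)) 0); last first.
    by apply: eq_cint => y; rewrite dotC (_ : dot 0 y = 0) ?mulr0 ?cis0 ?mulr1// dotE !mul0r !addr0.
  by rewrite FT_csch_inversion ?expr1n ?H0 ?mulr0//; exact: sch_csch.
elim: t f sf f0 => [|j t IH] f sf f0.
  exists f, 1; split=> //; last by move=> y; rewrite big_nil.
  by apply: f0; rewrite (_ : enorm 0 = 0)// /enorm dotE !mul0r !addr0 sqrtr0.
have [H [c [sH H0 e]]] := IH _ (sch_derive j sf) (sch_vanish_derive j f0).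
exists H, ('i * c); split=> // y; rewrite big_cons -mulrA -e FT_sch_derive//.
rewrite rmorphM/= mul1r (_ : 0 -i* coord y j = - 'i * (coord y j)%:C); last first.
  by apply: eq_cplx; rewrite ?ReM ?ImM/=; ring.
have ii : 'i * 'i = -1 :> C by rewrite -expr2 sqr_i.
transitivity (- ('i * 'i) * ((coord y j)%:C * (\prod_(j <- t) coord y j)%:C * FT 1 (fun x => (f x)%:C) y)).
  by rewrite ii opprK mul1r.
by ring.
Qed.

(** An admissible test function for classes modulo polynomials, because phi vanishes near the
    origin. *)
Definition probe : E -> C := inv_fourier (fun xi => (phi xi)%:C).

Lemma phi_csch : csch (fun xi => (phi xi)%:C).
Proof. exact/sch_csch/phi_sch. Qed.

Lemma csch_realZ (a : R) (f : E -> R) : sch f -> sch (fun x => a * f x).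
Proof.
move=> [sf df].
have e t : pderivs t (fun x => a * f x) = (fun x => a * pderivs t f x).
  elim: t => [//|i t IH]; rewrite /= -/(pderivs t _) IH; apply/funext => x.
  rewrite derive_mulE; [|exact: derivable_cst|exact/diff_derivable/sf].
  by rewrite derive_cst mulr0 addr0.
split=> t; first by move=> x; rewrite e; apply: differentiableM => //; exact: sf.
move=> n; have [M hM] := df t n; exists (`|a| * M) => x; rewrite e normrM mulrCA.
by rewrite ler_wpM2l.
Qed.

Lemma probeE : probe = FT 1 (fun xi => (((2 * pi) ^+ 3)^-1 * phi xi)%:C).
Proof.
apply/funext => x; rewrite /probe inv_fourierE -FTZ; last exact: csch_cL1 phi_csch.
by congr FT; apply/funext => xi; rewrite rmorphM.
Qed.

Lemma probe_schwartz : schwartz_mod_poly probe.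
Proof.
have sp := csch_realZ (((2 * pi) ^+ 3)^-1) phi_sch.
split; first by rewrite probeE; apply: FT_csch_schwartz; exact: sch_csch.
(* The list repeats the index i exactly a i times, which turns the monomial into the product over a
   list used by [FT_moments]. *)
move=> a; pose t := nseq (a 0) (0 : 'I_3) ++ nseq (a 1) (1 : 'I_3) ++ nseq (a 2%:R) (2%:R : 'I_3).
have z x : enorm x < 5 / 8 -> ((2 * pi) ^+ 3)^-1 * phi x = 0.
  move=> x58; have [->|/phi_support/andP[h _]] := eqVneq (phi x) 0; first by rewrite mulr0.
  by move: x58; rewrite ltNge h.
rewrite -[RHS](FT_moments t _ sp z) ?divr_gt0// probeE; apply: eq_cint => y; congr (_%:C * _).
have pn n (j : 'I_3) : \prod_(i <- nseq n j) coord y i = coord y j ^+ n.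
  by elim: n => [|n IH]; rewrite ?big_nil//= big_cons IH exprS.
rewrite /t !big_cat/= !pn !big_ord_recl big_ord0 mulr1.
by congr (_ * (_ * _)); congr (coord _ _ ^+ a _); exact: val_inj.
Qed.

Lemma probe_csch : csch probe.
Proof. by have [/schwartz_csch] := probe_schwartz. Qed.

Lemma fourier_probe xi : fourier probe xi = (phi xi)%:C.
Proof.
have sp := sch_csch (csch_realZ (((2 * pi) ^+ 3)^-1) phi_sch).
rewrite fourierE probeE FT_csch_inversion ?expr1n// -rmorphM/= mulrA mulfV ?mul1r//.
exact: twopi3_neq0.
Qed.

(** The probe is even in frequency, hence the factor cos th: level 0, of phase -pi/2, is invisible,
    and level 1, of phase 0, is seen in full. *)
Lemma wave_coef_probe z th : wave_coef probe z th = (phi z * cos th)%:C.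
Proof.
rewrite wave_coefE; last exact: csch_cL1 probe_csch.
have F1 w : FT 1 probe w = (phi w)%:C.
  rewrite -[w in LHS]opprK FTN -fourierE fourier_probe; congr _%:C.
  by have [_ _ h _ _] := hphi; apply: h; rewrite enormN.
have ev : phi (- z) = phi z by have [_ _ h _ _] := hphi; apply: h; rewrite enormN.
rewrite !F1 ev.
by apply: eq_cplx; rewrite /cis ?cosN ?sinN ?ReM ?ImM ?ReD ?ImD ?ReM ?ImM/=; field.
Qed.

(** The radii 5/8 and 7/4 of the support have ratio 14/5 < 4, so a dilation by a factor of at least
    4 separates the shell from itself. *)
Lemma block_probe0 k : (2 <= k) || (k <= -2) -> multiplier_fun (block k) probe = (fun=> 0).
Proof.
move=> hk; apply/funext => x; rewrite /multiplier_fun /inv_fourier (_ : cintegral _ = 0) ?mulr0//.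
apply: cint_eq0 => xi.
rewrite fourier_probe -rmorphM/=; suff -> : block k xi * phi xi = 0 by rewrite mul0r.
apply/eqP; rewrite mulf_eq0 -[_ || _]negbK negb_or; apply/negP => /andP[].
move=> /phi_support + /phi_support; rewrite enormZ gtr0_norm ?exp2z_gt0//.
have mono (a b : int) : a <= b -> (2 : R) ^ a <= 2 ^ b.
  by move=> ab; apply: ler_weXz2l => //; rewrite ler1n.
have p4 : (2 : R) ^+ 2 = 4 by rewrite -natrX.
move=> /andP[h1 h2] /andP[h3 h4]; case/orP: hk => hk.
  have h5 : (2 : R) ^ (- k) <= 2 ^ (- 2%:Z) by apply: mono; rewrite lerN2.
  rewrite exp2z_nat p4 in h5; have := ler_pM (ltW (exp2z_gt0 (- k))) (enorm_ge0 xi) h5 h4.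
  lra.
have h5 : 4 <= (2 : R) ^ (- k) by rewrite -p4; apply: (mono 2%:Z); rewrite lerNr.
have := ler_pM (ler0n R 4) (_ : 0 <= 5 / 8) h5 h3; rewrite divr_ge0// => /(_ isT); lra.
Qed.

Lemma cvg0_le (u v : nat -> R) : (forall n, 0 <= u n <= v n) -> v @ \oo --> (0 : R) ->
  u @ \oo --> (0 : R).
Proof.
move=> uv v0; apply: (@squeeze_cvgr _ _ _ _ (fun=> 0) v); last exact: v0; last exact: cvg_cst.
by apply: nearW => n; exact: uv.
Qed.

Lemma cmodulus_sum_cvg0 (I : Type) (s : seq I) (u : I -> nat -> C) :
  (forall i, (fun n => cmodulus (u i n)) @ \oo --> (0 : R)) ->
  (fun n => cmodulus (\sum_(i <- s) u i n)) @ \oo --> (0 : R).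
Proof.
move=> u0; apply: (@cvg0_le _ (fun n => \sum_(i <- s) cmodulus (u i n))) => [n|].
  by rewrite cmodulus_ge0 cmodulus_sum.
elim: s => [|i s IH]; first by under eq_fun do rewrite big_nil; exact: cvg_cst.
rewrite (_ : (fun n => _) = (fun n => cmodulus (u i n) + \sum_(i <- s) cmodulus (u i n))).
  by rewrite -[X in _ --> X](addr0 (0 : R)); exact: (cvgD (u0 i) IH).
by apply/funext => n; rewrite big_cons.
Qed.

Definition block_sum N z : R := \sum_(0 <= k < N) block k%:Z z.

(** For |z| >= 1 the blocks of negative index vanish at z, as 2 |z| > 7/4: the nonnegative blocks
    already form a partition of unity there. *)
Lemma block_sum_cvg z : 1 <= enorm z -> (fun N => block_sum N z) @ \oo --> (1 : R).
Proof.
move=> z1; have [_ _ _ _ [_ h]] := hphi.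
have z0 : z != 0.
  by apply: contraTneq z1 => ->; rewrite (_ : enorm 0 = 0) ?ler10// /enorm dotE !mul0r !addr0 sqrtr0.
have hz := h z z0.
have c : (fun N : nat => (N, N)) @ \oo --> filter_prod \oo \oo.
  move=> P [[P1 P2] [/= h1 h2] hP]; apply: filterS (filterI h1 h2) => N [a b].
  exact: (hP (N, N)).
have := cvg_comp _ _ c hz.
have neg n : phi ((2 : R) ^ (- - n.+1%:Z) *: z) = 0.
  apply/eqP/negP => /negP/phi_support/andP[_].
  rewrite opprK enormZ ger0_norm ?exprn_ge0// leNgt => /negP; apply.
  have p : 2 <= (2 : R) ^+ n.+1 by rewrite exprS ler_peMr// exprn_ege1// ler1n.
  have := ler_pM (ler0n R 2) ler01 p z1; rewrite -exprnP; lra.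
have e N : cmodulus (\sum_(0 <= k < N) (block k%:Z z)%:C + \sum_(0 <= k < N) (phi ((2 : R) ^ (- - k.+1%:Z) *: z))%:C - 1)
    = `|block_sum N z - 1|.
  have -> : \sum_(0 <= k < N) (phi ((2 : R) ^ (- - k.+1%:Z) *: z))%:C = 0 :> C.
    by apply: big1 => k _; rewrite neg.
  rewrite addr0.
  by rewrite -rmorph_sum -(rmorphB (real_complex R) _ 1) cmodulus_real.
move=> hc; apply/cvgrPdist_le => d d0; have /cvgrPdist_le/(_ _ d0) := hc.
apply: filterS => N /=; rewrite sub0r normrN.
by rewrite -[X in `|cmodulus X|]/(\sum_(0 <= k < N) (block k%:Z z)%:C + \sum_(0 <= k < N) (phi ((2 : R) ^ (- - k.+1%:Z) *: z))%:C - 1) e normr_id distrC.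
Qed.

Lemma block_sum_le1 N z : 1 <= enorm z -> 0 <= block_sum N z <= 1.
Proof.
move=> z1; apply/andP; split; first by apply: sumr_ge0 => k _; exact: block_ge0.
have nd : nondecreasing_seq (fun N => block_sum N z).
  apply/nondecreasing_seqP => n; rewrite /block_sum big_nat_recr//= lerDl; exact: block_ge0.
have c := block_sum_cvg z1.
have cv : cvgn (fun N => block_sum N z) by apply/cvg_ex; exists 1.
by have := nondecreasing_cvgn_le nd cv N; rewrite (cvg_lim (@Rhausdorff R) c).
Qed.

(** Replacing h by 0 where it exceeds c changes it on a null set only and makes the bound hold
    everywhere. *)
Lemma cint_ae_bounded h g (c : R) : 0 <= c -> cmeas (h : mE -> C) ->
  {ae leb3, forall x : mE, cmodulus (h x) <= c} -> cL1 leb3 (g : mE -> C) ->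
  cmodulus (cint leb3 (fun x : mE => h x * g x)) <= c * \int[leb3]_x cmodulus (g x).
Proof.
move=> c0 mh hc jg.
pose h' x : C := if cmodulus (h x) <= c then h x else 0.
have mb : measurable_fun setT (fun x : mE => cmodulus (h x) <= c).
  by apply: measurable_fun_ler; [exact: cmeas_modulus|exact: measurable_cst].
have mh' : cmeas (h' : mE -> C).
  split.
    rewrite (_ : (fun x => _) = (fun x : mE => if cmodulus (h x) <= c then complex.Re (h x) else 0)).
      by apply: measurable_fun_ifT => //; case: mh.
    by apply/funext => x; rewrite /h'; case: ifP.
  rewrite (_ : (fun x => _) = (fun x : mE => if cmodulus (h x) <= c then complex.Im (h x) else 0)).
    by apply: measurable_fun_ifT => //; case: mh.
  by apply/funext => x; rewrite /h'; case: ifP.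
have h'c x : cmodulus (h' x) <= c by rewrite /h'; case: ifP => //; rewrite cmodulus0.
have jh := cL1M_bounded jg mh' h'c.
have mhg := cmeasM mh jg.1; have mhg' := cmeasM mh' jg.1.
have -> : cint leb3 (fun x : mE => h x * g x) = cint leb3 (fun x : mE => h' x * g x).
  apply: eq_cplx; rewrite /= /Rintegral; congr fine.
    apply: ae_eq_integral => //; [by apply/measurable_EFinP; case: mhg|by apply/measurable_EFinP; case: mhg'|].
    by apply: filterS hc => x hx _ /=; rewrite /h' hx.
  apply: ae_eq_integral => //; [by apply/measurable_EFinP; case: mhg|by apply/measurable_EFinP; case: mhg'|].
  by apply: filterS hc => x hx _ /=; rewrite /h' hx.
rewrite (le_trans (cmodulus_cint_le jh))// -RintegralZl//; last exact: jg.2.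
apply: le_Rintegral => //; first exact: jh.2.
  exact: (rintegrableZ c jg.2).
by move=> x _; rewrite cmodulusM ler_wpM2r ?cmodulus_ge0.
Qed.

Definition probe_mass (k : int) : R := \int[leb3]_x cmodulus (multiplier_fun (block k) probe x).

(* Only the blocks -1, 0, 1 meet the support of [phi]; the weights are [2^k]. *)
Definition probe_const : R := probe_mass 0 + 2 * probe_mass 1 + 2^-1 * probe_mass (-1).

Lemma probe_const_ge0 : 0 <= probe_const.
Proof.
have h k : 0 <= probe_mass k by apply: Rintegral_ge0 => x _; exact: cmodulus_ge0.
by rewrite !addr_ge0 ?mulr_ge0.
Qed.

(** Valid for every decomposition, hence for the infimum defining the norm: only three blocks see
    the probe, and each contributes at most the sup bound 2^k s on f_k times the L^1 norm of the
    block of the probe. The maximum with 0 supplies the sign of s. *)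
Lemma tl_size_ge_probe (q : R) f fk : 0 < q -> tl_decomposition phi f fk ->
  (tl_size q fk < +oo)%E -> cmodulus (f probe) <= probe_const * Num.max 0 (fine (tl_size q fk)).
Proof.
move=> q0 [mfk dec] Soo; set S := tl_size q fk in Soo *; pose s := Num.max 0 (fine S).
have s0 : 0 <= s by rewrite /s le_max lexx.
pose a k := dyadic_block phi k (of_fun (fk k)) probe.
have jp := csch_cL1 probe_csch.
have ae_fk k : {ae leb3, forall x : mE, cmodulus (fk k x) <= 2 ^ k * s}.
  have := @ess_sup_ge _ _ _ leb3 (fun x => ((\esum_(k in [set: int])
     ((2 ^ (- k) * cmodulus (fk k x)) `^ q)%:E) `^ q^-1)%E).
  apply: filterS => x; rewrite -/(tl_size q fk) -/S => hx.
  have c0 : 0 <= 2 ^ (- k) * cmodulus (fk k x) by rewrite mulr_ge0 ?cmodulus_ge0// ltW// exp2z_gt0.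
  have h : ((2 ^ (- k) * cmodulus (fk k x))%:E <= S)%E.
    apply: le_trans hx; rewrite -[X in (X%:E <= _)%E](@powRr1 _ _ c0) -(mulfV (lt0r_neq0 q0)) powRrM -poweR_EFin.
    apply: gt0_ler_poweR; rewrite ?invr_ge0 ?(ltW q0)//.
    - by rewrite in_itv/= leey andbT lee_fin powR_ge0.
    - by rewrite in_itv/= leey andbT; apply: esum_ge0 => i _; rewrite lee_fin powR_ge0.
    apply: esum_ge; exists [set k]; last by rewrite fsbig_set1.
    by split => //; exact: finite_set1.
  have {h} h : 2 ^ (- k) * cmodulus (fk k x) <= s.
    by rewrite /s le_max; apply/orP; right; move: h Soo; case: (S) => [u| |]//=; rewrite lee_fin.
  rewrite -invr_expz in h; move: h; rewrite mulrC ler_pdivrMr ?exp2z_gt0// mulrC.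
  by [].
have ak k : cmodulus (a k) <= 2 ^ k * s * probe_mass k.
  apply: cint_ae_bounded; last exact: cL1_block.
  - by rewrite mulr_ge0// ltW// exp2z_gt0.
  - exact: mfk.
  - exact: ae_fk.
have a0 k : (2 <= k) || (k <= -2) -> a k = 0.
  move=> hk; rewrite /a /dyadic_block /multiplier -/(block k) block_probe0//.
  by apply: cint_eq0 => x; rewrite mulr0.
have fE : f probe = a 0 + a 1 + a (-1).
  have hz : zsums_to a (f probe) by exact: dec probe_schwartz.
  (* With two terms on each side the partial sums already contain the indices -1, 0 and 1, so they
     are constant along this diagonal. *)
  have c : (fun N : nat => (N.+2, N.+2)) @ \oo --> filter_prod \oo \oo.
    have S2 (P : set nat) : \oo P -> \forall N \near \oo, P N.+2.
      by move=> [n _ hn]; exists n => // N /= nN; apply: hn; rewrite /= ltnW// ltnW.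
    move=> P [[P1 P2] [/= h1 h2] hP]; apply: filterS (filterI (S2 _ h1) (S2 _ h2)) => N [b1 b2].
    exact: (hP (N.+2, N.+2)).
  have hc := cvg_comp _ _ c hz.
  have gen (b : int -> C) : (forall k, (2 <= k) || (k <= -2) -> b k = 0) -> forall N,
      \sum_(0 <= k < N.+2) b k%:Z + \sum_(0 <= k < N.+2) b (- k.+1%:Z) = b 0 + b 1 + b (-1).
    move=> b0 N; rewrite big_nat_recl// big_nat_recl// big1 ?addr0 => [|k _]; last by rewrite b0.
    rewrite big_nat_recl// [X in _ + (_ + X)]big1 ?addr0// => k _.
    by apply: b0; apply/orP; right; rewrite lerN2.
  have e := gen a a0.
  have {}hc : (fun _ : nat => cmodulus (a 0 + a 1 + a (-1) - f probe)) @ \oo --> (0 : R).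
    by apply: cvg_trans hc; apply: near_eq_cvg; apply: nearW => N /=; rewrite e.
  apply: (@cvg_cmodulus_unique R (fun=> a 0 + a 1 + a (-1))); first exact: hc.
  by rewrite subrr cmodulus0; exact: cvg_cst.
rewrite fE -/s (le_trans (cmodulusD _ _))// (le_trans (lerD (cmodulusD _ _) (lexx _)))//.
apply: le_trans (lerD (lerD (ak 0) (ak 1)) (ak (-1))) _.
rewrite expr0z expr1z exprN1 /probe_const le_eqVlt; apply/orP; left; apply/eqP.
by move: (probe_mass 0) (probe_mass 1) (probe_mass (-1)) (s) => p0 p1 p2 u; ring.
Qed.

Section flow_norms.
Variables (m r : nat) (A : R).
Hypothesis A0 : 0 <= A.
Hypothesis eps_half : eps m r A <= 2^-1.
Local Notation level := (level m r A0).
Local Notation wlev := (wlev m r A0).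
Local Notation wpart := (wpart m r A0).
Local Notation wsum := (wsum m r A0).
Local Notation eps := (eps m r A).
Local Notation amp := (amp m r A).

Lemma enorm_zvec (nu : R) : 1 <= enorm (zvec nu).
Proof. by rewrite (le_trans _ (coord_le_enorm _ 0))// coordE/= normr1. Qed.

Definition block_level t g j N : C :=
  \sum_(0 <= k < N) cint leb3 (fun x : mE => (wlev j t x)%:C * multiplier_fun (block k%:Z) g x).

Lemma block_levelE t g j N : cL1 leb3 (g : mE -> C) ->
  block_level t g j N = \sum_(p <- level j)
    (mcoef p t * block_sum N (zvec (mfreq p)))%:C * wave_coef g (zvec (mfreq p)) (phase j).
Proof.
move=> jg; rewrite /block_level.
transitivity (\sum_(0 <= k < N) \sum_(p <- level j)
    (mcoef p t)%:C * ((block k%:Z (zvec (mfreq p)))%:C * wave_coef g (zvec (mfreq p)) (phase j))).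
  apply: eq_bigr => k _; rewrite cint_wave_sum; last exact: cL1_block.
  by apply: eq_bigr => p _; rewrite wave_coef_block.
rewrite exchange_big; apply: eq_bigr => p _ /=.
by rewrite -mulr_sumr -mulr_suml -rmorph_sum mulrA -rmorphM.
Qed.

Lemma block_level_le t g j N : cL1 leb3 (g : mE -> C) ->
  cmodulus (block_level t g j N) <= eps ^+ j * amp * \int[leb3]_x cmodulus (g x).
Proof.
move=> jg; rewrite block_levelE// -(level_bound m r A0) mulr_suml (le_trans (cmodulus_sum _ _))//.
apply: ler_sum => p _; rewrite cmodulusM cmodulus_real.
have /andP[c0 c1] := mcoef_le p t; have /andP[b0 b1] := block_sum_le1 N (enorm_zvec (mfreq p)).
apply: ler_pM; rewrite ?cmodulus_ge0//; last exact: wave_coef_le.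
by rewrite ger0_norm ?mulr_ge0// (le_trans _ c1)// ler_piMr.
Qed.

Lemma block_level_cvg t g j : cL1 leb3 (g : mE -> C) ->
  (fun N => cmodulus (block_level t g j N - cint leb3 (fun x : mE => (wlev j t x)%:C * g x)))
    @ \oo --> (0 : R).
Proof.
move=> jg.
have e N : block_level t g j N - cint leb3 (fun x : mE => (wlev j t x)%:C * g x) =
    \sum_(p <- level j) (mcoef p t * (block_sum N (zvec (mfreq p)) - 1))%:C *
      wave_coef g (zvec (mfreq p)) (phase j).
  rewrite block_levelE// cint_wave_sum// -sumrB; apply: eq_bigr => p _.
  by rewrite -mulrBl -rmorphB mulrBr mulr1.
under eq_fun do rewrite e.
apply: cmodulus_sum_cvg0 => p.
rewrite (_ : (fun n => _) = (fun N => `|mcoef p t| * `|block_sum N (zvec (mfreq p)) - 1| *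
    cmodulus (wave_coef g (zvec (mfreq p)) (phase j)))); last first.
  by apply/funext => N; rewrite cmodulusM cmodulus_real normrM.
rewrite -[X in _ --> X](mul0r (cmodulus (wave_coef g (zvec (mfreq p)) (phase j)))).
apply: cvgM; last exact: cvg_cst.
rewrite -[X in _ --> X](mulr0 `|mcoef p t|); apply: cvgM; first exact: cvg_cst.
rewrite -(normr0 R); apply: cvg_norm; rewrite -(subrr 1).
by apply: cvgB; [exact: block_sum_cvg (enorm_zvec _)|exact: cvg_cst].
Qed.

(** There are infinitely many frequencies, so the blocks cannot be summed mode by mode. Truncation
    at level n costs at most a multiple of eps^n uniformly in N ([UT]), because block sums lie in
    [0, 1] at every frequency. Finitely many levels then converge, and an e/3 argument concludes. *)
Lemma wsum_block_cvg t g : cL1 leb3 (g : mE -> C) ->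
  (fun N => cmodulus (\sum_(0 <= k < N)
      cint leb3 (fun x : mE => (wsum t x)%:C * multiplier_fun (block k%:Z) g x) -
    cint leb3 (fun x : mE => (wsum t x)%:C * g x))) @ \oo --> (0 : R).
Proof.
move=> jg; pose Ng := \int[leb3]_x cmodulus (g x).
have Ng0 : 0 <= Ng by apply: Rintegral_ge0 => x _; exact: cmodulus_ge0.
pose U N := \sum_(0 <= k < N) cint leb3 (fun x : mE => (wsum t x)%:C * multiplier_fun (block k%:Z) g x).
pose S n N := \sum_(0 <= j < n) block_level t g j N.
pose V := cint leb3 (fun x : mE => (wsum t x)%:C * g x).
pose v n := cint leb3 (fun x : mE => (wpart n t x)%:C * g x).
have SE n N : S n N = \sum_(0 <= k < N) cint leb3 (fun x : mE => (wpart n t x)%:C * multiplier_fun (block k%:Z) g x).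
  rewrite /S /block_level exchange_big; apply: eq_bigr => k _ /=.
  by rewrite wlev_test_sum//; exact: cL1_block.
have SU N : (fun n => cmodulus (S n N - U N)) @ \oo --> (0 : R).
  under eq_fun do rewrite SE -sumrB.
  apply: cmodulus_sum_cvg0 => k.
  exact: (@wpart_test_cvg R m r A A0 eps_half _ t id (cL1_block k jg) cvg_id).
have tail n N k : cmodulus (S (n + k)%N N - S n N) <= 2 * eps ^+ n * amp * Ng.
  rewrite [S (n + k)%N N](big_cat_nat (leq0n n) (leq_addr k n))/= addrAC subrr add0r.
  rewrite (le_trans (cmodulus_sum _ _))// (le_trans (ler_sum _ (fun j _ => block_level_le t j N jg)))//.
  by rewrite -mulr_suml ler_wpM2r// (geometric_tail A0 eps_half).
have UT n N : cmodulus (U N - S n N) <= 2 * eps ^+ n * amp * Ng.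
  have c : (fun k => cmodulus (S k N - U N) + 2 * eps ^+ n * amp * Ng) @ \oo --> 0 + 2 * eps ^+ n * amp * Ng.
    by apply: cvgD; [exact: SU|exact: cvg_cst].
  rewrite -[leRHS]add0r; apply: (ler_cvg_to (cvg_cst (cmodulus (U N - S n N))) c); near=> k.
  have nk : (n <= k)%N by near: k; exact: nbhs_infty_ge.
  rewrite (le_trans _ (lerD (lexx _) (tail n N (k - n)%N)))// subnKC// -(cmodulusN (S k N - U N)).
  by rewrite (le_trans _ (cmodulusD _ _))// (_ : - (S k N - U N) + _ = U N - S n N)//; ring.
have Sv n : (fun N => cmodulus (S n N - v n)) @ \oo --> (0 : R).
  rewrite /v wlev_test_sum//; under eq_fun do rewrite -sumrB.
  by apply: cmodulus_sum_cvg0 => j; exact: block_level_cvg.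
have vV : (fun n => cmodulus (v n - V)) @ \oo --> (0 : R).
  exact: (@wpart_test_cvg R m r A A0 eps_half _ t id jg cvg_id).
have eps0 := eps_ge0 m r A0; have amp0 := amp_ge0 m r A0.
have T0 : (fun n => 2 * eps ^+ n * amp * Ng) @ \oo --> (0 : R).
  rewrite (_ : (fun n => _) = (fun n => eps ^+ n * (2 * amp * Ng))); last first.
    by apply/funext => n; ring.
  rewrite -[X in _ --> X](mul0r (2 * amp * Ng)); apply: cvgM; last exact: cvg_cst.
  by apply: cvg_expr; rewrite ger0_norm// (le_lt_trans eps_half)// invf_lt1// ltr1n.
apply/cvgrPdist_le => e e0.
have e30 : 0 < e / 3 by rewrite divr_gt0.
have [n [n1 n2]] : exists n, 2 * eps ^+ n * amp * Ng <= e / 3 /\ cmodulus (v n - V) <= e / 3.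
  have /cvgrPdist_le/(_ _ e30) h1 := T0; have /cvgrPdist_le/(_ _ e30) h2 := vV.
  have [n _ /(_ n (leqnn n))[a b]] : \forall n \near \oo,
      `|0 - 2 * eps ^+ n * amp * Ng| <= e / 3 /\ `|0 - cmodulus (v n - V)| <= e / 3.
    by near=> n; split; near: n.
  exists n; split; first by rewrite (le_trans _ a)// sub0r normrN ler_norm.
  by rewrite (le_trans _ b)// sub0r normrN ler_norm.
near=> N; rewrite sub0r normrN ger0_norm ?cmodulus_ge0//.
have h3 : cmodulus (S n N - v n) <= e / 3.
  rewrite -[leLHS]ger0_norm ?cmodulus_ge0// -normrN -sub0r; near: N.
  by have /cvgrPdist_le := Sv n; apply.
rewrite -/(U N) -/V (_ : U N - V = (U N - S n N) + (S n N - v n) + (v n - V)); last by ring.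
rewrite (le_trans (cmodulusD _ _))// (_ : e = e / 3 + e / 3 + e / 3); last by field.
by rewrite lerD// (le_trans (cmodulusD _ _))// lerD// (le_trans (UT n N)).
Unshelve. all: by end_near. Qed.

Lemma wsum_in_tl t (q : R) : 1 <= q -> in_tl phi q (of_fun (fun x => (wsum t x)%:C)).
Proof.
move=> q1; have q0 : 0 < q by exact: lt_le_trans q1.
have [mw _ _] := wsum_annihilates A0 eps_half t.
split; first by apply: (of_fun_tempered mw) => x; exact: (wsum_le A0 eps_half).
(* The same function w in every block k >= 0: the weights 2^-k make the l^q sum finite, using
   (2^-n)^q <= 2^-n for q >= 1. *)
pose fk (k : int) x : C := match k with Posz _ => (wsum t x)%:C | Negz _ => 0 end.
exists fk; split; first split.
- case=> n; first exact: cmeas_real.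
  by split; exact: measurable_cst.
- move=> g [/schwartz_csch/csch_cL1 jg _]; apply: zsums_to_halfline.
    by move=> n; apply: cint_eq0 => x; rewrite mul0r.
  exact: wsum_block_cvg.
pose W := 2 * amp; have W0 : 0 <= W by rewrite mulr_ge0 ?(amp_ge0 m r A0).
apply: (@le_lt_trans _ _ ((2 * W `^ q) `^ q^-1)%:E); last exact: ltry.
apply: tl_size_le => //; first by rewrite mulr_ge0// powR_ge0.
move=> N x; apply: (@le_trans _ _ (\sum_(0 <= n < N) 2 ^- n * W `^ q)).
  apply: ler_sum => n _; have d0 : 0 < 2 ^- n :> R by rewrite invr_gt0 exprn_gt0.
  apply: (@le_trans _ _ ((2 ^- n * W) `^ q)).
    have dW : 0 <= 2 ^- n * W by exact: mulr_ge0 (ltW d0) W0.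
    have df : 0 <= 2 ^- n * cmodulus (fk n x) by exact: mulr_ge0 (ltW d0) (cmodulus_ge0 _).
    apply: ge0_ler_powR; rewrite ?nnegrE ?(ltW q0)//.
    by rewrite ler_wpM2l ?(ltW d0)// cmodulus_real (wsum_le A0 eps_half).
  rewrite powRM ?(ltW d0)// ler_wpM2r ?powR_ge0// -[leRHS](powRr1 (ltW d0)).
  by apply: ger_powR => //; rewrite d0/= invf_le1 ?exprn_gt0// exprn_ege1// ler1n.
rewrite -mulr_suml ler_wpM2r ?powR_ge0//.
suff -> : \sum_(0 <= n < N) (2 ^- n : R) = 2 - 2 * 2 ^- N by rewrite gerBl mulr_ge0// invr_ge0 exprn_ge0.
elim: N => [|N IH]; first by rewrite big_geq// expr0 invr1 mulr1 subrr.
by rewrite big_nat_recr//= IH exprS; field; rewrite expf_neq0.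
Qed.

(** On [0, 4^-n), which lies in [0, T), the exponents add up to -2 * 4^n tau - T >= -3. So the
    integrand is at least A^2 4^n e^-3 / 2 on an interval of length 4^-n, and the power of 4
    cancels. *)
Lemma duhamel_zero_mode_ge n T : 0 < T <= 1 -> 1 <= freq n ^+ 2 * T ->
  2^-1 * A ^+ 2 * expR (- 3) <= duhamel A n 0 (coef0 A n) T.
Proof.
move=> /andP[T0 T1] nT; have f0 : 0 < freq n :> R by exact: freq_gt0.
pose d : R := freq n ^- 2; have d0 : 0 < d by rewrite invr_gt0 exprn_gt0.
have dT : d <= T by rewrite -(mulr1 d) /d ler_pdivrMl ?exprn_gt0.
pose L := 2^-1 * A ^+ 2 * freq n ^+ 2 * expR (- 3).
have L0 : 0 <= L by rewrite mulr_ge0 ?expR_ge0// mulr_ge0 ?sqr_ge0// mulr_ge0 ?sqr_ge0.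
have jd := duhamel_integrable A0 n 0 T (coef0_measurable A n) (coef0_le A0 n).
rewrite -lee_fin /duhamel -rint_EFin//.
apply: (@le_trans _ _ (\int[leb]_tau (L * \1_(`[0, d[%classic : set mR) tau)%:E)%E).
  under eq_integral do rewrite EFinM.
  rewrite ge0_integralZl//=; last first.
    by apply/measurable_EFinP; exact: measurable_indic.
  have muI : leb (`[0, d[%classic : set mR) = d%:E.
    by rewrite lebesgue_measure_itv/= lte_fin d0 -EFinB subr0.
  have iI : (\int[leb]_x (\1_(`[0%R, d[%classic : set mR) x)%:E = d%:E)%E.
    by rewrite integral_indic// setIT; exact: muI.
  rewrite iI -EFinM lee_fin.
  by rewrite /L /d le_eqVlt; apply/orP; left; apply/eqP; field; rewrite gt_eqF.
apply: ge0_le_integral => //.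
- by move=> tau _; rewrite lee_fin mulr_ge0.
- apply/measurable_EFinP; apply: measurable_funM => //; exact: measurable_indic.
- by move: jd => /(measurable_int leb).
move=> tau _; rewrite lee_fin indicE.
have [i0 _] := andP (duhamel_integrand_bounds A0 n 0 T tau (coef0_le A0 n)).
case: (boolP (tau \in _)) => [|_]; last by rewrite mulr0.
rewrite inE/= in_itv/= => /andP[t0 td]; rewrite mulr1.
have tT := lt_le_trans td dT.
rewrite /duhamel_integrand t0 tT/= /coef0 ltNge t0/= /vcoef.
have -> : 2^-1 * (A * freq n * expR (- freq n ^+ 2 * tau)) * expR (- (1 + 0 ^+ 2) * (T - tau)) *
    (A * freq n * expR (- (1 + freq n ^+ 2) * tau)) =
    2^-1 * A ^+ 2 * freq n ^+ 2 * (expR (- freq n ^+ 2 * tau) * expR (- (1 + 0 ^+ 2) * (T - tau)) *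
      expR (- (1 + freq n ^+ 2) * tau)) by ring.
rewrite -!expRD; apply: ler_wpM2l; first by rewrite mulr_ge0 ?sqr_ge0// mulr_ge0 ?sqr_ge0.
rewrite ler_expR.
have h : freq n ^+ 2 * tau <= 1.
  by rewrite -(mulfV (lt0r_neq0 (exprn_gt0 2 f0))) ler_wpM2l ?sqr_ge0// ltW.
rewrite expr0n/= addr0; lra.
Qed.

Lemma level_probe t j : cint leb3 (fun x : mE => (wlev j t x)%:C * probe x) =
  (\sum_(p <- level j) mcoef p t * (phi (zvec (mfreq p)) * cos (phase j)))%:C.
Proof.
rewrite cint_wave_sum; last exact: csch_cL1 probe_csch.
by rewrite rmorph_sum; apply: eq_bigr => p _; rewrite wave_coef_probe -rmorphM.
Qed.

Lemma wsum_probe_ge T : 0 < T <= 1 -> (forall n, (m <= n)%N -> 1 <= freq n ^+ 2 * T) ->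
  r%:R * (2^-1 * A ^+ 2 * expR (- 3)) - 2 * eps ^+ 2 * amp * \int[leb3]_x cmodulus (probe x) <=
  cmodulus (of_fun (fun x => (wsum T x)%:C) probe).
Proof.
move=> T01 nT; have jp := csch_cL1 probe_csch.
have [_ phi0 _ _ [phi1 _]] := hphi.
pose X := \sum_(p <- level 1) mcoef p T * phi (zvec (mfreq p)).
(* Level 0 contributes cos(-pi/2) = 0 and level 1 contributes with the factor cos 0 = 1. *)
have wp2 : cint leb3 (fun x : mE => (wpart 2 T x)%:C * probe x) = X%:C.
  rewrite wlev_test_sum// big_nat_recl// big_nat1 !level_probe.
  rewrite /phase sub0r mulN1r cosN cos_pihalf subrr mul0r cos0.
  rewrite big1 ?add0r => [|p _]; last by rewrite !mulr0.
  by congr _%:C; apply: eq_bigr => p _; rewrite mulr1.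
have Xge : r%:R * (2^-1 * A ^+ 2 * expR (- 3)) <= X.
  rewrite /X sum_levelS sum_level0.
  have -> : r%:R * (2^-1 * A ^+ 2 * expR (- 3)) = \sum_(n <- iota m r) 2^-1 * A ^+ 2 * expR (- 3).
    by rewrite big_const_seq count_predT size_iota iter_addr_0 mulr_natl.
  rewrite big_seq [leRHS]big_seq; apply: ler_sum => n nm.
  have t0 p : 0 <= mcoef p T * phi (zvec (mfreq p)).
    by have /andP[c0 _] := mcoef_le p T; rewrite mulr_ge0.
  (* All terms being nonnegative, only the difference child of [mode0 n] with the same n is kept:
     its frequency is (1, 0, 0), where phi = 1. *)
  rewrite (big_rem n nm) -[leLHS]addr0; apply: lerD; last first.
    by apply: sumr_ge0 => n' _; apply: addr_ge0; exact: t0.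
  rewrite -[leLHS]add0r; apply: lerD; first exact: t0.
  rewrite /= subrr (phi1 (zvec 0)) ?mulr1.
    by apply: duhamel_zero_mode_ge => //; apply: nT; move: nm; rewrite mem_iota => /andP[].
  have -> : enorm (zvec 0 : E) = 1 by rewrite /enorm dotE/= !mulr0 !addr0 mulr1 sqrtr1.
  by apply/andP; split; lra.
have jw (b : E -> R) : annihilates (plane 2%:R) b -> cL1 leb3 (fun x : mE => (b x)%:C * probe x).
  by move=> [mb [M hM] _]; exact: cL1_bounded_mul mb hM jp.
have jws := jw _ (wsum_annihilates A0 eps_half T).
have jw2 := jw _ (wpart_annihilates m r A0 2 T).
have diff : cmodulus (cint leb3 (fun x : mE => (wpart 2 T x)%:C * probe x) -
    cint leb3 (fun x : mE => (wsum T x)%:C * probe x)) <= 2 * eps ^+ 2 * amp * \int[leb3]_x cmodulus (probe x).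
  rewrite -mulN1r -cintZ// -cintD//; last exact: cL1Z.
  rewrite (le_trans (cmodulus_cint_le (cL1D jw2 (cL1Z _ jws))))// -RintegralZl//; last exact: jp.2.
  apply: le_Rintegral => //; first exact: (cL1D jw2 (cL1Z (-1) jws)).2.
    exact: rintegrableZ jp.2.
  move=> x _; rewrite mulN1r -mulrBl -(rmorphB (real_complex R)) cmodulusM cmodulus_real.
  by rewrite ler_wpM2r ?cmodulus_ge0// distrC (wsum_tail A0 eps_half).
rewrite lerBlDr (le_trans Xge)// (le_trans (ler_norm X))// -cmodulus_real -wp2.
rewrite (le_trans _ (lerD (lexx _) diff))//.
rewrite addrC (le_trans _ (cmodulusD _ _))//.
by rewrite subrK.
Qed.

End flow_norms.

End triebel_lizorkin.

Section shear_flow_norms.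
Context {R : realType}.
Local Open Scope complex_scope.
Local Notation E := (R * R * R)%type.
Variable phi : E -> R.
Hypothesis hphi : littlewood_paley phi.
Variables (m r : nat) (A : R).
Hypothesis A0 : 0 <= A.
Hypothesis eps_half : eps m r A <= 2^-1.
Hypothesis m0 : (0 < m)%N.

(** The third component is covered only at t = 0: later it also contains the low frequencies that
    cause the growth. *)
Lemma flow_wave_tl (q t : R) (i : 'I_3) : 2 < q -> 0 <= t -> (i != 2%:R) || (t == 0) ->
  in_tl phi q (of_field (flow m r A0 t) i) /\
  (tl_norm phi q (of_field (flow m r A0 t) i) <= (r%:R `^ q^-1 * A)%:E)%E.
Proof.
move=> q2 t0 it.
have f0 n : 0 < freq n :> R by exact: freq_gt0.
have W (c : nat -> R) (z : nat -> E) th : (forall n, `|c n| <= A * 2 ^+ n) ->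
    (forall n, (m <= n)%N -> 7 / 8 * 2 ^+ n <= enorm (z n) <= 5 / 4 * 2 ^+ n) ->
    (forall x, flow m r A0 t i x = \sum_(n <- iota m r) c n * wave (z n) th x) ->
    in_tl phi q (of_field (flow m r A0 t) i) /\
    (tl_norm phi q (of_field (flow m r A0 t) i) <= (r%:R `^ q^-1 * A)%:E)%E.
  move=> hc hz /funext e; have := wave_sum_tl hphi r th q2 A0 hc hz.
  by rewrite /of_field e.
have kn n : enorm (kvec n : E) = freq n.
  by rewrite /enorm dotE/= !mul0r add0r addr0 -expr2 sqrtr_sqr gtr0_norm.
have kv n : (m <= n)%N -> 7 / 8 * 2 ^+ n <= enorm (kvec n : E) <= 5 / 4 * 2 ^+ n.
  by move=> _; rewrite kn -/(freq n); have := f0 n; lra.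
elim/forall_ord3: i it W => it W.
- apply: (W (fun n => vcoef A n t) (fun n => kvec n) 0) => // n.
  by rewrite ger0_norm ?(vcoef_ge0 A0)// (vcoef_le A0).
- apply: (W (fun=> 0) (fun n => kvec n) 0) => // [n|x].
    by rewrite normr0 mulr_ge0// exprn_ge0.
  by rewrite big1// => n _; rewrite mul0r.
have {it} /eqP t00 : t == 0 by case/orP: it.
apply: (W (fun n => coef0 A n 0) (fun n => zvec (freq n)) (phase 0)) => [n|n mn|x].
- by have /andP[c0 c1] := coef0_le A0 n 0; rewrite ger0_norm.
(* This is where m > 0 enters: sqrt(1 + 4^n) <= (5/4) 2^n holds for n >= 1 and fails for n = 0. *)
- have f2 : 2 <= freq n :> R.
    by rewrite /freq -[leLHS]expr1 ler_weXn2l ?ler1n// (leq_trans m0).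
  have e2 : enorm (zvec (freq n) : E) ^+ 2 = 1 + freq n ^+ 2 by rewrite enorm_sqr dotE/=; ring.
  rewrite -/(freq n); apply/andP; split.
    rewrite -(@ler_pXn2r _ 2)// ?nnegrE ?enorm_ge0 ?mulr_ge0 ?(ltW (f0 n))// e2.
    by have := f0 n; nra.
  rewrite -(@ler_pXn2r _ 2)// ?nnegrE ?enorm_ge0 ?mulr_ge0 ?(ltW (f0 n))// e2; nra.
- by rewrite flowE t00 (wsum0 A0 eps_half) /wlev sum_level0.
Qed.

Lemma eps_le : eps m r A <= r%:R * (A / 2 ^+ m).
Proof.
have -> : r%:R * (A / 2 ^+ m) = \sum_(n <- iota m r) A / 2 ^+ m.
  by rewrite big_const_seq count_predT size_iota iter_addr_0 mulr_natl.
rewrite /eps big_seq [leRHS]big_seq; apply: ler_sum => n; rewrite mem_iota => /andP[mn _].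
by rewrite ler_wpM2l// lef_pV2 ?posrE ?exprn_gt0// ler_weXn2l// ler1n.
Qed.

Lemma amp_le : amp m r A <= r%:R * (A * 2 ^+ (m + r)).
Proof.
have -> : r%:R * (A * 2 ^+ (m + r)) = \sum_(n <- iota m r) A * 2 ^+ (m + r).
  by rewrite big_const_seq count_predT size_iota iter_addr_0 mulr_natl.
rewrite /amp big_seq [leRHS]big_seq; apply: ler_sum => n; rewrite mem_iota => /andP[_ mn].
by rewrite ler_wpM2l// ler_weXn2l// ?ler1n// ltnW.
Qed.

End shear_flow_norms.

(** * Choice of the parameters *)

Section parameters.
Context {R : realType}.

(* [q > 2] enters here: the data has size [r^(1/q) A], the output [r A^2]. *)
Lemma exists_amplitude (q d : R) : 2 < q -> 0 < d ->
  exists (r : nat) (A : R),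
    [/\ (0 < r)%N, 0 < A, r%:R `^ q^-1 * A = d & d^-1 <= r%:R * A ^+ 2].
Proof.
move=> q2 d0; have q0 : 0 < q by exact: lt_trans q2.
have [al [alE al0]] : exists al : R, al = 1 - 2 / q /\ 0 < al.
  by exists (1 - 2 / q); rewrite subr_gt0 ltr_pdivrMr// mul1r.
(* With A = d r^(-1/q) one has r A^2 = d^2 r^al, so r^al >= d^-3 is what is wanted; al > 0 allows
   any r above the root y of y^al = d^-3. *)
have [y [yal y0]] : exists y : R, d ^- 3 = y `^ al /\ 0 < y.
  exists ((d ^- 3) `^ al^-1); rewrite -powRrM mulVf ?gt_eqF// powRr1; last first.
    by rewrite invr_ge0 exprn_ge0// ltW.
  by rewrite powR_gt0// invr_gt0 exprn_gt0.
have [r ry] : exists r : nat, y < r%:R by exists (Num.bound y); exact/archi_boundP/ltW.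
have r0 : 0 < r%:R :> R by exact: lt_trans ry.
exists r, (d * r%:R `^ (- q^-1)); split.
- by rewrite -(ltr0n R).
- by rewrite mulr_gt0 ?powR_gt0.
- by rewrite powRN mulrCA mulfV ?mulr1// gt_eqF// powR_gt0.
have -> : r%:R * (d * r%:R `^ (- q^-1)) ^+ 2 = d ^+ 2 * r%:R `^ al.
  rewrite alE powRD; last by apply/implyP => _; rewrite gt_eqF.
  rewrite (powRr1 (ltW r0)) exprMn -(powR_mulrn 2 (powR_ge0 _ _)) -powRrM.
  by rewrite (_ : - q^-1 * 2 = - (2 / q)) ?mulrA 1?[r%:R * _]mulrC//; ring.
have h : d ^- 3 <= r%:R `^ al.
  by rewrite yal; apply: ge0_ler_powR; rewrite ?nnegrE ?(ltW al0) ?(ltW y0) ?(ltW r0) ?(ltW ry).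
have := ler_wpM2l (sqr_ge0 d) h; congr (_ <= _).
by field; rewrite gt_eqF.
Qed.

(** With r and A fixed, eps <= r A 2^-m and amp <= r A 2^(m+r), hence eps^2 amp <= (r A)^3 2^r 2^-m.
    A single lower bound on 2^m meets all the requirements. *)
Lemma exists_frequency (r : nat) (A T N Z : R) : 0 < A -> 0 < T -> 0 <= N -> 0 < Z ->
  exists m : nat, [/\ (0 < m)%N, eps m r A <= 2^-1,
    forall n, (m <= n)%N -> 1 <= freq n ^+ 2 * T &
    2 * eps m r A ^+ 2 * amp m r A * N <= Z].
Proof.
move=> A0 T0 N0 Z0; have rA0 : 0 <= r%:R * A by rewrite mulr_ge0// ltW.
have [Y [YE Y0]] : exists Y, Y = 2 * (r%:R * A) ^+ 3 * 2 ^+ r * N /\ 0 <= Y.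
  exists (2 * (r%:R * A) ^+ 3 * 2 ^+ r * N).
  by split=> //; rewrite mulr_ge0// mulr_ge0 ?exprn_ge0// mulr_ge0// exprn_ge0.
have YZ0 : 0 <= Y / Z by rewrite divr_ge0// ltW.
have Ti0 : 0 < T^-1 by rewrite invr_gt0.
have [m [m0 XP]] : exists m : nat, (0 < m)%N /\ T^-1 + 2 * (r%:R * A) + Y / Z + 1 < 2 ^+ m.
  exists (Num.bound (T^-1 + 2 * (r%:R * A) + Y / Z + 1)).+1; split=> //.
  exact: upper_nthrootP.
have [P [PE P0]] : exists P : R, P = 2 ^+ m /\ 0 < P by exists (2 ^+ m); rewrite exprn_gt0.
have [P1 PT PA PY] : [/\ 1 <= P, T^-1 <= P, 2 * (r%:R * A) <= P & Y / Z <= P].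
  rewrite -PE in XP; move: XP YZ0 Ti0 rA0.
  move: (T^-1) (r%:R * A) (Y / Z) => a b c h1 h2 h3 h4; split; lra.
exists m; split=> //.
- rewrite (le_trans (eps_le m r (ltW A0)))// mulrA -PE ler_pdivrMr//.
  by move: PA; move: (r%:R * A) => a; lra.
- move=> n mn; have fP : P <= freq n by rewrite PE ler_weXn2l// ler1n.
  have h1 : 1 <= P * T by rewrite -ler_pdivrMr// mul1r.
  rewrite (le_trans h1)// ler_pM2r// expr2 (le_trans fP)// ler_peMl//.
    exact: le_trans (ltW P0) fP.
  exact: le_trans P1 fP.
have h1 : eps m r A ^+ 2 <= (r%:R * (A / P)) ^+ 2.
  apply: lerXn2r; rewrite ?nnegrE ?(eps_ge0 m r (ltW A0))//.
    by rewrite mulr_ge0// divr_ge0// ltW.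
  by rewrite PE eps_le// ltW.
have h2 : eps m r A ^+ 2 * amp m r A <= (r%:R * (A / P)) ^+ 2 * (r%:R * (A * 2 ^+ (m + r))).
  apply: ler_pM => //; first exact: sqr_ge0.
    by apply: amp_ge0; exact: ltW.
  by apply: amp_le; exact: ltW.
apply: (@le_trans _ _ (Y / P)); last by rewrite ler_pdivrMr// mulrC -ler_pdivrMr.
have := ler_wpM2r N0 (ler_wpM2l (ler0n R 2) h2); rewrite -!mulrA => /le_trans; apply.
rewrite YE exprD -PE le_eqVlt; apply/orP; left; apply/eqP; field.
by rewrite gt_eqF.
Qed.

End parameters.

Theorem theorem1p3 (R : realType) (phi : R * R * R -> R)
    (hphi : littlewood_paley phi) (q : R) (hq : 2 < q) :
  exists C c : R, [/\ 0 < C, 0 < c &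
    forall delta : R, 0 < delta ->
    exists (u0 : 'I_3 -> functional R) (Tmax : R)
           (u : R -> 'I_3 -> R * R * R -> R),
      [/\ in_tl_vec phi q u0,
          div_free u0,
          (tl_norm_vec phi q u0 <= (C * delta)%:E)%E,
          navier_stokes_solution Tmax u0 u &
          exists T : R,
            [/\ 0 < T < delta,
                T <= Tmax,
                in_tl_vec phi q (of_field (u T)) &
                ((c / delta)%:E <= tl_norm_vec phi q (of_field (u T)))%E]]].
Proof.
have q0 : 0 < q by exact: lt_trans hq.
have K0 := probe_const_ge0 phi; set K := probe_const phi in K0.
(* K is only known to be nonnegative; K + 1 can be divided by. *)
have K1 : 0 < K + 1 by rewrite ltr_wpDl.
(* The first iterate is worth r A^2 e^-3 / 2, that is 2 Z for the Z below; half of it is given up to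
   the later iterates, which leaves r A^2 c1. *)
have [c1 [c1E c10]] : exists c1 : R, c1 = expR (- 3) / 4 /\ 0 < c1.
  by exists (expR (- 3) / 4); rewrite divr_gt0 ?expR_gt0.
exists 1, (c1 / (K + 1)); split; [by []|by rewrite divr_gt0|].
move=> delta delta0.
(* The bound d <= 1 gives T <= 1, as [duhamel_zero_mode_ge] asks, and d <= delta keeps 1/d >=
   1/delta. *)
have [d [d0 dd d1]] : exists d : R, [/\ 0 < d, d <= delta & d <= 1].
  by exists (Num.min delta 1); rewrite lt_min delta0 ltr01 !ge_min !lexx orbT.
have [r [A [r0 A0 rA rA2]]] := exists_amplitude hq d0.
have [T [T0 Td T1]] : exists T : R, [/\ 0 < T, T < delta & T <= 1].
  exists (d / 2); split; first by rewrite divr_gt0.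
    by rewrite ltr_pdivrMr// (le_lt_trans dd)// ltr_pMr// ltr1n.
  by rewrite ler_pdivrMr// mul1r (le_trans d1)// ler1n.
have N0 : 0 <= \int[leb3]_x cmodulus (probe phi x) by apply: Rintegral_ge0 => x _; exact: cmodulus_ge0.
have [Z [ZE Z0]] : exists Z, Z = r%:R * A ^+ 2 * c1 /\ 0 < Z.
  by exists (r%:R * A ^+ 2 * c1); rewrite mulr_gt0// mulr_gt0 ?ltr0n// exprn_gt0.
have [m [m0 eps_half freqT small]] := exists_frequency r A0 T0 N0 Z0.
have A0' := ltW A0.
have wave_tl t i := @flow_wave_tl R phi hphi m r A A0' eps_half m0 q t i hq.
exists (of_field (flow m r A0' 0)), T, (flow m r A0'); split.
- by move=> i; have [] := wave_tl 0 i (lexx _); rewrite ?eqxx ?orbT.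
- exact: flow_div_free.
- rewrite mul1r /tl_norm_vec; apply: (big_ind (fun z => (z <= delta%:E)%E)).
  + by rewrite lee_fin ltW.
  + by move=> a b ha hb; rewrite ge_max ha.
  move=> i _; have [|_ h] := wave_tl 0 i (lexx _); first by rewrite eqxx orbT.
  by rewrite (le_trans h)// lee_fin rA.
- exact: flow_solution.
exists T; split=> //; first by rewrite T0.
  move=> i; have [->|i2] := eqVneq i 2%:R.
    by apply: (@wsum_in_tl R phi hphi m r A A0' eps_half T q); rewrite (le_trans _ (ltW hq))// ler1n.
  by have [] := wave_tl T i (ltW T0); rewrite ?i2.
suff low : ((c1 / (K + 1) / delta)%:E <= tl_norm phi q (of_field (flow m r A0' T) 2%:R))%E.
  by apply: (le_trans low); rewrite /tl_norm_vec (bigD1 2%:R)//= le_max lexx.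
apply: le_ereal_inf_tmp => _ [fk [dec Soo] <-].
have h1 := tl_size_ge_probe hphi q0 dec Soo.
have T01 : 0 < T <= 1 by rewrite T0.
have h2 := wsum_probe_ge hphi A0' eps_half T01 freqT.
have h3 : c1 / delta <= K * Num.max 0 (fine (tl_size q fk)).
  apply: le_trans h1; apply: le_trans h2.
  have h4 : r%:R * (2^-1 * A ^+ 2 * expR (- 3)) = 2 * Z by rewrite ZE c1E; field.
  rewrite h4; apply: (@le_trans _ _ Z); last first.
    by rewrite lerBrDr [leRHS]mulr_natl mulr2n lerD2l.
  have h5 : c1 / delta <= c1 * d^-1 by rewrite ler_wpM2l ?(ltW c10)// lef_pV2.
  by rewrite (le_trans h5)// mulrC ZE ler_wpM2r// ltW.
have h4 : c1 / delta <= (K + 1) * Num.max 0 (fine (tl_size q fk)).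
  by rewrite (le_trans h3)// ler_wpM2r ?lerDl// le_max lexx.
have h5 : c1 / (K + 1) / delta <= Num.max 0 (fine (tl_size q fk)).
  by rewrite mulrAC ler_pdivrMr// [leRHS]mulrC.
(* Positivity forces [fine (tl_size q fk)] to be positive, which excludes the infinite values, where
   [fine] is 0. *)
have h6 : 0 < c1 / (K + 1) / delta by rewrite !divr_gt0.
move: h5 (lt_le_trans h6 h5); rewrite lt_max ltxx/= => h5 h7.
move: h5 h7 Soo; rewrite /Num.max; case: (tl_size q fk) => [v| |] /=; rewrite ?ltxx//.
by move=> + v0; rewrite v0 lee_fin.
Qed.
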